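(* Let $k\ge1$ and fix $(\gamma_0,\gamma_1)\in\Gamma^k_{\mathrm{crit}}$. If $\gamma_0=\gamma_1$, let $r$ be the unique root of $\Delta_k$ in $\mathcal{S}=[\gamma_1,1-\gamma_0]$, which has multiplicity three; if $\gamma_0\ne\gamma_1$, let $r$ denote the root of $\Delta_k$ in $\mathcal{S}$ with multiplicity one. The following statements hold. (1) If $\gamma_0\ne\gamma_1$, then for each sufficiently small $\delta>0$ and any initial state $x=x_n\in\mathcal{S}^n$, we have $\mathbb{E}_x[T^n_{\mathrm{enter}}(B_\delta(r))]=O(n^{1/3})$, and the mixing time of the process $X^n$ satisfies $t^n_{\mathrm{mix}}=\Theta(n^{1/3})$. (2) If $\gamma_0=\gamma_1$, then for any initial state $x=x_n\in\mathcal{S}^n$, we have $\mathbb{E}_x[T^n_{\mathrm{enter}}(B_{1/n}(r))]=O(n^{1/2})$, and the mixing time of the process $X^n$ satisfies $t^n_{\mathrm{mix}}=\Theta(n^{1/2})$.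
   Context: Fix an integer $k\ge1$ (independent of $n$) and parameters $(\gamma_0,\gamma_1)\in\Gamma:=\{(\gamma_0,\gamma_1)\in(0,1)^2: 0<\gamma_0+\gamma_1<1\}$. Write $\mathcal{S}=[\gamma_1,1-\gamma_0]$ and let $P_k$ be the polynomial $P_k(x)=\sum_{r=k+1}^{2k}\binom{2k}{r}x^r(1-x)^{2k-r}$. The $2k$-choices model with stubborn agents: there are $n$ agents (complete network), with $N_i^n=\lceil n\gamma_i\rceil$ agents stubbornly holding opinion $i\in\{0,1\}$ forever; each other agent updates at the points of an independent unit-rate Poisson process by sampling $2k$ of the other $n-1$ agents uniformly at random with replacement and adopting the majority opinion among the sampled agents and itself. $X^n(t)$ is the proportion of agents holding opinion $1$ at time $t\ge0$. Equivalently (for $n$ large enough that the state space is nonempty), $X^n$ is the continuous-time birth-death Markov chain on $\mathcal{S}^n=\{N_1^n/n,(N_1^n+1)/n,\ldots,1-N_0^n/n\}$ jumping from $x$ to $x+1/n$ at rate $q^n_+(x)=n\left(1-x-\frac{N_0^n}{n}\right)P_k(b_nx)$ and from $x$ to $x-1/n$ at rate $q^n_-(x)=n\left(x-\frac{N_1^n}{n}\right)P_k(b_n(1-x))$, where $b_n=n/(n-1)$. It is ergodic with unique stationary distribution $\pi^n$. The limiting drift is the polynomial $\Delta_k(x)=(1-x-\gamma_0)P_k(x)-(x-\gamma_1)P_k(1-x)$. $\Gamma^k_{\mathrm{crit}}$ is the set of $(\gamma_0,\gamma_1)\in\Gamma$ for which the real roots of $\Delta_k$ in $\mathcal{S}$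 are either one simple root and one double root, or one triple root. (For $(\gamma_0,\gamma_1)\in\Gamma^k_{\mathrm{crit}}$, the triple-root case occurs when $\gamma_0=\gamma_1$, with the root at $1/2$, and the simple-plus-double case occurs when $\gamma_0\neq\gamma_1$.) Notation: $B_\delta(p)=(p-\delta,p+\delta)$; $T^n_{\mathrm{enter}}(B)=\inf\{t\ge0:X^n(t)\in B\}$; $\mathbb{P}_x,\mathbb{E}_x$ denote probability and expectation given $X^n(0)=x\in\mathcal{S}^n$. $d^n(t)=\max_{x\in\mathcal{S}^n}\max_{A\subseteq\mathcal{S}^n}|\mathbb{P}_x(X^n(t)\in A)-\pi^n(A)|$ and $t^n_{\mathrm{mix}}=\inf\{t:d^n(t)\le1/4\}$. $f(n)=O(g(n))$ means $\limsup_{n\to\infty}f(n)/g(n)<\infty$, and $f=\Theta(g)$ means $f=O(g)$ and $g=O(f)$. *)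

(* Defs.v *)
(* MathComp / MathComp-Analysis; all real numbers live in an abstract
   [R : realType]. *)
From HB Require Import structures.
From mathcomp Require Import all_boot all_order all_algebra.
From mathcomp Require Import all_classical all_reals all_analysis.
Set Implicit Arguments.
Unset Strict Implicit.
Unset Printing Implicit Defensive.
Import Order.TTheory GRing.Theory Num.Theory.
Import numFieldNormedType.Exports.
Local Open Scope classical_set_scope.
Local Open Scope ring_scope.

Section Asymptotics.
Context {R : realType}.
Local Open Scope ereal_scope.

(* The values are extended reals because an expected hitting time or an infimum
   of times may be infinite.  In [\bar R], [0^-1 = +oo], so a numerator bounded
   away from 0 over a vanishing denominator gives an infinite quotient. *)
Definition extO (f g : nat -> \bar R) : Prop :=
  limn_esup (fun n => f n / g n) < +oo.

Definition extTheta (f g : nat -> \bar R) : Prop := extO f g /\ extO g f.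

Definition npow (a : R) (n : nat) : \bar R := (n%:R `^ a)%:E.

End Asymptotics.

Section FiniteChain.
Context {R : realType} {m : nat}.
Variable Q : 'M[R]_m.

(* The transition matrix [exp (t Q)], entrywise. *)
Definition trans (t : R) : 'M[R]_m :=
  \matrix_(i, j) limn (series (fun l : nat => t ^+ l / l`!%:R * (Q ^+ l) i j)).

Definition stationary (p : 'rV[R]_m) : Prop :=
  [/\ forall i, 0 <= p 0 i,
      \sum_i p 0 i = 1 &
      forall t, 0 <= t -> p *m trans t = p].

(* The stationary distribution, when there is exactly one. *)
Definition stat_dist : 'rV[R]_m := xget 0 [set p | stationary p].

(* [\sum_(y in A) trans t x y] is the probability, starting from [x], of being
   in [A] at time [t] (see [chain_law]). *)
Definition tv_dist (t : R) : R :=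
  \big[Num.max/0]_(x : 'I_m) \big[Num.max/0]_(A : {set 'I_m})
    `|\sum_(y in A) trans t x y - \sum_(y in A) stat_dist 0 y|.

Definition mix_time : \bar R :=
  ereal_inf [set t%:E | t in [set t : R | 0 <= t /\ tv_dist t <= 4^-1]].

(* [X] is a right-continuous Markov chain started from [x], with generator [Q]
   and state space the range of [st]; the index [i] stands for the state [st i],
   [st] being injective in all uses.  A history [h] is a finite list of pairs
   (time, value).  Only the times [t >= 0] matter. *)
Definition chain_from (st : 'I_m -> R) (x : R)
    d (T : measurableType d) (P : probability T R) (X : R -> T -> R) : Prop :=
  [/\ forall t, 0 <= t -> measurable_fun setT (X t),
      forall t w, 0 <= t -> exists i, X t w = st i,
      forall t w, 0 <= t -> X^~ w @ t^'+ --> X t w,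
      (exists i, x = st i) /\ P [set w | X 0 w = x] = 1%E &
      forall (h : seq (R * R)) (s t : R) (i j : 'I_m),
        (forall p, p \in h -> 0 <= p.1 <= s) -> 0 <= s -> s <= t ->
        let past := [set w | (forall p, p \in h -> X p.1 w = p.2)
                             /\ X s w = st i] in
        P (past `&` [set w | X t w = st j]) = (P past * (trans (t - s) i j)%:E)%E].

Lemma chain_law (st : 'I_m -> R) (i j : 'I_m) (t : R)
    d (T : measurableType d) (P : probability T R) (X : R -> T -> R) :
  chain_from st (st i) P X -> 0 <= t ->
  P [set w | X t w = st j] = (trans t i j)%:E.
Proof.
case=> mX _ _ [_ P0] markov t0.
have m0 : measurable [set w | X 0 w = st i].
  by rewrite -[X in measurable X]setTI; exact: (mX 0 (lexx 0) measurableT [set st i]).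
have mt : measurable [set w | X t w = st j].
  by rewrite -[X in measurable X]setTI; exact: (mX t t0 measurableT [set st j]).
have := markov [::] 0 t i j (fun p => ltac:(by [])) (lexx 0) t0.
have -> : [set w | (forall p : R * R, p \in [::] -> X p.1 w = p.2) /\ X 0 w = st i]
          = [set w | X 0 w = st i].
  by apply/seteqP; split => w /=; [case | split].
rewrite /= P0 mul1e subr0 => <-.
have PC : P (~` [set w | X 0 w = st i]) = 0%E.
  by rewrite probability_setC // P0 subee.
apply/eqP; rewrite eq_le; apply/andP; split; last first.
  by apply: le_measure; rewrite ?inE //; exact: measurableI.
set A := [set w | X t w = st j]; set B := [set w | X 0 w = st i].
rewrite -[X in (P X <= _)%E](setUIDK A B) [A `&` B]setIC.
have mBA : measurable (B `&` A) by exact: measurableI.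
have mAB : measurable (A `\` B) by exact: measurableD.
apply: (le_trans (measureU2 _ mBA mAB)).
rewrite -[leRHS]adde0; apply: leeD => //; rewrite -PC.
by apply: le_measure; rewrite ?inE //; exact: measurableC.
Qed.

End FiniteChain.

Section HittingTime.
Context {R : realType} d (T : measurableType d).
Variables (P : probability T R) (X : R -> T -> R).

Definition T_enter (B : set R) (w : T) : \bar R :=
  ereal_inf [set t%:E | t in [set t : R | 0 <= t /\ B (X t w)]].

Definition mean_T_enter (B : set R) : \bar R := (\int[P]_w T_enter B w)%E.

End HittingTime.

Section Choices.
Context {R : realType}.
Variable k : nat.

Definition Pk : {poly R} :=
  \sum_(k.+1 <= r < (2 * k).+1)
    'C(2 * k, r)%:R *: ('X ^+ r * (1 - 'X) ^+ (2 * k - r)).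

Variables g0 g1 : R.

Definition in_Gamma : Prop :=
  [/\ 0 < g0 < 1, 0 < g1 < 1 & 0 < g0 + g1 < 1].

Definition in_S (x : R) : bool := g1 <= x <= 1 - g0.

Definition Delta : {poly R} :=
  (1 - 'X - g0%:P) * Pk - ('X - g1%:P) * (Pk \Po (1 - 'X)).

Definition root_in_S (r : R) (mult : nat) : Prop :=
  [/\ in_S r, root Delta r & mup r Delta = mult].

Definition Gamma_crit : Prop :=
  in_Gamma /\
  ((exists r1 r2 : R,
      [/\ root_in_S r1 1, root_in_S r2 2 &
          forall x, in_S x -> root Delta x -> x = r1 \/ x = r2])
   \/ (exists r : R,
      root_in_S r 3 /\ forall x, in_S x -> root Delta x -> x = r)).

Definition stubborn (n : nat) (g : R) : nat := `|Num.ceil (n%:R * g)|%N.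

Definition N0 (n : nat) : nat := stubborn n g0.
Definition N1 (n : nat) : nat := stubborn n g1.

(* The number [n - N0 - N1 + 1] of states, which is 0 if [N0 + N1 > n]. *)
Definition nstates (n : nat) : nat := (n.+1 - (N0 n + N1 n))%N.

Definition state (n : nat) (i : 'I_(nstates n)) : R := (N1 n + i)%:R / n%:R.

Definition bn (n : nat) : R := n%:R / (n%:R - 1).

Definition qplus (n : nat) (x : R) : R :=
  n%:R * (1 - x - (N0 n)%:R / n%:R) * Pk.[bn n * x].

Definition qminus (n : nat) (x : R) : R :=
  n%:R * (x - (N1 n)%:R / n%:R) * Pk.[bn n * (1 - x)].

Definition generator (n : nat) : 'M[R]_(nstates n) :=
  \matrix_(i, j)
    if j == i.+1 :> nat then qplus n (state i)
    else if i == j.+1 :> nat then qminus n (state i)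
    else if i == j then - (qplus n (state i) + qminus n (state i))
    else 0.

(* [X] is the process X^n started from [x]. *)
Definition process_from (n : nat) (x : R)
    d (T : measurableType d) (P : probability T R) (X : R -> T -> R) : Prop :=
  chain_from (generator n) (@state n) x P X.

Definition t_mix (n : nat) : \bar R := mix_time (generator n).

(* E_{x_n}[T_enter(B_n)] = O(n^a) for every sequence of initial states x_n and
   every choice of the processes X^n with X^n(0) = x_n.  Since the state space
   may be empty for small [n], these are only required for large [n]. *)
Definition mean_T_enter_bigO (B : nat -> set R) (a : R) : Prop :=
  forall (x : nat -> R) (d : nat -> measure_display)
    (T : forall n, measurableType (d n)) (P : forall n, probability (T n) R)
    (X : forall n, R -> T n -> R),
    (\forall n \near \oo, process_from n (x n) (P n) (X n)) ->
    extO (fun n => mean_T_enter (P n) (X n) (B n)) (npow a).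

End Choices.

Definition openball {R : realType} (delta p : R) : set R :=
  [set x | p - delta < x < p + delta].

(* Main.v *)
Require Import Defs.
From mathcomp Require Import all_boot all_order all_algebra.
From mathcomp Require Import all_classical all_reals all_analysis.
From mathcomp Require Import measurable_realfun ring lra zify.
Set Implicit Arguments.
Unset Strict Implicit.
Unset Printing Implicit Defensive.
Import Order.TTheory GRing.Theory Num.Theory.
Import numFieldNormedType.Exports.
Local Open Scope classical_set_scope.
Local Open Scope ring_scope.

(** Put [h = 1 / n]. From [x] the chain jumps by [h] upwards at rate [n * P] and
    downwards at rate [n * M], where [P - M] differs from [Delta x] by [O(h)] and
    [P], [M] are of order 1 away from the end points. So it drifts with speed
    [Delta x] and diffuses with a variance of order [h] per unit of time. Near a
    root of order [m] of [Delta], the drift [s ^ m] at distance [s] balances the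
    noise [h / s] at the critical length [s], given by [s ^ (m + 1) = h], and
    moving by [s] takes a time of order [s / s ^ m], that is
    [n ^ ((m - 1) / (m + 1))]. This is [n ^ (1 / 3)] at a double root, where
    the chain is slowed down on its way to the simple root, and [n ^ (1 / 2)] at a
    triple root. A triple root must be [1 / 2] ([triple_root_half]) and forces
    [g0 = g1]; conversely, if [g0 = g1], the reflection [x -> 1 - x] permutes the
    roots, which excludes a simple root together with a double one. Thus the two
    cases of the theorem are [m = 2] and [m = 3] ([Gamma_crit_cases]).

    Upper bounds. Let [z] be the state next to the root [r]. For a birth-death
    chain Poisson's equation for the expected time [g] to reach [z] has an
    explicit solution in terms of the stationary distribution
    ([mean_hitting_poisson]). Its increments are bounded by those of any function
    that decreases in mean at unit speed off [z] ([mean_hitting_itv]); the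
    [barrier] is the derivative of such a function up to a constant factor
    ([barrier_drift]), and its integral is of order [s ^- (m - 1)]
    ([barrier_sum]). So [g] is at most [H = O(s ^- (m - 1))] ([critical_hitting]),
    and this gives both upper bounds.
    - As [g] decreases in mean at unit speed, the mean entrance time of any
      neighbourhood of [z] is [O(H)]. Since the process is known through its
      finite-dimensional laws, it is sampled at small time steps
      ([mean_T_enter_le]).
    - Uniformization writes the semigroup as a Poisson mixture of the powers of a
      lazy reversible kernel ([trans_poisson]). The excess over equilibrium of the
      probability to be back at [z] is essentially nonincreasing, and its integral
      over time is at most [H]; hence it is [O(H / t)] at time [t]
      ([excess_return_le]), and the Cauchy-Schwarz inequality makes the law
      started from [z] close to equilibrium after a time [O(H)]. From any other
      state, [z] is reached in a time [O(H)] ([act_pow_le], [tv_dist_hitting]).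

    Lower bound. The generator applied to a smooth indicator of the complement of
    a window of width [s] near the root of order [m] is [O(s ^ (m - 1))]
    ([displacement_drift]). So, from two starting states separated by [2 s], the
    chain stays in two disjoint windows with high probability up to a small
    multiple of [s ^- (m - 1)], and the two laws cannot both be close to the same
    distribution ([tv_dist_two_starts], [critical_escape]). *)

(** * Uniformization of finite chains *)

Section ExponentialSeries.
Context {R : realType}.
Implicit Types (x y lam : R) (a b : nat -> R).

Lemma exp_coeffD x y l :
  \sum_(i < l.+1) exp_coeff x i * exp_coeff y (l - i)%N = exp_coeff (x + y) l.
Proof.
rewrite /exp_coeff /= addrC exprDn mulr_suml; apply: eq_bigr => i _.
have il : (i <= l)%N by rewrite -ltnS.
rewrite -[X in _ = X / _]mulr_natr -(bin_fact il) !natrM.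
have /eqP bn0 : 'C(l, i) != 0%N by rewrite -lt0n bin_gt0.
have f0 (j : nat) : j`!%:R != 0 :> R by rewrite pnatr_eq0 -lt0n fact_gt0.
have b0 : 'C(l, i)%:R != 0 :> R by rewrite pnatr_eq0; apply/eqP.
by field; rewrite b0 !f0.
Qed.

Lemma sum_triangle a b N :
  \sum_(l < N) \sum_(i < l.+1) a i * b (l - i)%N
  = \sum_(i < N) a i * \sum_(j < (N - i)%N) b j.
Proof.
elim: N => [|N IH]; first by rewrite !big_ord0.
rewrite big_ord_recr /= IH [RHS]big_ord_recr /= subSnn big_ord1.
rewrite [X in _ + X]big_ord_recr /= subnn addrA; congr (_ + _).
rewrite -big_split /=; apply: eq_bigr => i _.
by rewrite subSn 1?ltnW // big_ord_recr /= mulrDr.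
Qed.

Lemma expR_tail x lam M : `|x| <= lam ->
  `|\sum_(j < M) exp_coeff x j - expR x| <= expR lam - \sum_(j < M) exp_coeff lam j.
Proof.
move=> xl; have l0 : 0 <= lam by exact: le_trans xl.
pose u := fun N : nat => `|\sum_(j < M) exp_coeff x j - series (exp_coeff x) N|.
pose v := fun N : nat => series (exp_coeff lam) N - \sum_(j < M) exp_coeff lam j.
have cu : u @ \oo --> `|\sum_(j < M) exp_coeff x j - expR x|.
  by apply: cvg_norm; apply: cvgB; [exact: cvg_cst|exact: is_cvg_series_exp_coeff].
have cv : v @ \oo --> expR lam - \sum_(j < M) exp_coeff lam j.
  by apply: cvgB; [exact: is_cvg_series_exp_coeff|exact: cvg_cst].
rewrite -(cvg_lim _ cu) // -(cvg_lim _ cv) //.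
apply: ler_lim; [exact: cvgP cu|exact: cvgP cv|].
exists M => // N /= MN; rewrite /u /v /series /=.
rewrite -!(big_mkord xpredT) (big_cat_nat (leq0n M) MN) //=.
rewrite [X in _ <= X - _](big_cat_nat (leq0n M) MN) //=.
rewrite opprD addrA subrr sub0r normrN [X in _ <= X]addrAC subrr add0r.
apply: le_trans (ler_norm_sum _ _ _) _; apply: ler_sum => j _.
by rewrite normrM normfV normrX (ger0_norm (ler0n _ _)) ler_wpM2r ?invr_ge0 // lerXn2r ?nnegrE.
Qed.

(** Cauchy product with an exponential series: the error of the truncated
    product is dominated by the same error for the two majorants, which is
    [expR lam * expR lam - expR (2 lam)] in the limit, that is 0. *)
Lemma cauchy_product_exp a lam : (forall l, `|a l| <= exp_coeff lam l) ->
  (fun N => \sum_(l < N) \sum_(i < l.+1) a i * exp_coeff (- lam) (l - i)%N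
            - expR (- lam) * \sum_(i < N) a i) @ \oo --> (0 : R).
Proof.
move=> al; have l0 : 0 <= lam.
  have := al 1%N; rewrite /exp_coeff /= expr1 divr1; exact: le_trans.
pose u N := expR lam * series (exp_coeff lam) N - series (exp_coeff (lam + lam)) N.
have cu : u @ \oo --> 0.
  rewrite -[X in _ --> X](subrr (expR lam * expR lam)) -{2}expRD.
  apply: cvgB; last exact: is_cvg_series_exp_coeff.
  by apply: cvgMl_tmp; exact: is_cvg_series_exp_coeff.
apply/norm_cvg0P; apply: (squeeze_cvgr _ (cvg_cst 0) cu); near=> N.
rewrite normr_ge0 /= /u /series /= !big_mkord.
rewrite -(eq_bigr _ (fun (l : 'I_N) _ => exp_coeffD lam lam l)).
rewrite !sum_triangle !mulr_sumr -!sumrB.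
apply: le_trans (ler_norm_sum _ _ _) _; apply: ler_sum => i _.
rewrite [expR (- lam) * _]mulrC [expR lam * _]mulrC -!mulrBr normrM ler_pM //.
by apply: expR_tail; rewrite normrN ger0_norm.
Unshelve. all: by end_near. Qed.

Lemma cvg_series_dominated_exp a lam : (forall l, `|a l| <= exp_coeff lam l) ->
  cvgn (series a).
Proof.
move=> al; apply: normed_cvg; apply: (series_le_cvg _ _ al) => //.
- by move=> n; exact: le_trans (al n).
- exact: is_cvg_series_exp_coeff.
Qed.

End ExponentialSeries.

Section PoissonMixture.
Context {R : realType}.

Definition poisson (lam : R) (l : nat) : R := expR (- lam) * exp_coeff lam l.

Lemma poisson_ge0 lam l : 0 <= lam -> 0 <= poisson lam l.
Proof. by move=> l0; rewrite mulr_ge0 ?expR_ge0 ?exp_coeff_ge0. Qed.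

Lemma cvg_poisson_sum lam :
  series (poisson lam) @ \oo --> (1 : R).
Proof.
rewrite -(mulVf (lt0r_neq0 (expR_gt0 lam))) -expRN.
rewrite (_ : series _ = fun N => expR (- lam) * series (exp_coeff lam) N); last first.
  by apply/funext => N; rewrite /series /= mulr_sumr.
by apply: cvgMl_tmp; exact: is_cvg_series_exp_coeff.
Qed.

Lemma poissonS lam l : poisson lam l.+1 * l.+1%:R = lam * poisson lam l.
Proof.
rewrite /poisson /exp_coeff /= factS natrM exprS.
have f0 : l`!%:R != 0 :> R by rewrite pnatr_eq0 -lt0n fact_gt0.
have l0 : l%:R + 1 != 0 :> R by rewrite natr1 pnatr_eq0.
by rewrite -natr1; field; rewrite f0 l0.
Qed.

Lemma cvg_poisson_mean lam :
  series (fun l => poisson lam l * l%:R) @ \oo --> lam.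
Proof.
have c : (fun N => lam * series (poisson lam) N) @ \oo --> lam * 1.
  by apply: cvgMl_tmp; exact: cvg_poisson_sum.
rewrite -cvg_shiftS; rewrite mulr1 in c; apply: cvg_trans c; apply: near_eq_cvg.
apply: nearW => N; rewrite /series /= big_nat_recl //= mulr0 add0r mulr_sumr.
by apply: eq_bigr => l _; rewrite poissonS.
Qed.

Lemma cvg_poisson_fact2 lam :
  series (fun l => poisson lam l * (l%:R * (l%:R - 1))) @ \oo --> lam ^+ 2.
Proof.
have c : (fun N => lam * series (fun l => poisson lam l * l%:R) N) @ \oo --> lam * lam.
  by apply: cvgMl_tmp; exact: cvg_poisson_mean.
rewrite -cvg_shiftS expr2; apply: cvg_trans c; apply: near_eq_cvg.
apply: nearW => N; rewrite /series /= big_nat_recl //= mul0r mulr0 add0r mulr_sumr.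
by apply: eq_bigr => l _; rewrite [RHS]mulrA poissonS -mulrA -natr1 addrK.
Qed.

End PoissonMixture.

Lemma scalemx_exp (R : comNzRingType) (m : nat) (a : R) (A : 'M[R]_m) l :
  (a *: A) ^+ l = a ^+ l *: A ^+ l.
Proof.
elim: l => [|l IH]; first by rewrite !expr0 scale1r.
by rewrite !exprS IH -!mulmxE -scalemxAl -scalemxAr scalerA.
Qed.

Section Uniformization.
Context {R : realType} {m : nat}.
Variables (Q : 'M[R]_m) (Lam : R).
Hypothesis Lam_gt0 : 0 < Lam.

(** The chain with generator [Q] jumps according to this kernel at the constant
    rate [Lam], possibly without moving. *)
Definition jump_kernel : 'M[R]_m := 1 + Lam^-1 *: Q.

Local Notation K := jump_kernel.
Hypothesis K_ge0 : forall i j, 0 <= K i j.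
Hypothesis K_sum : forall i, \sum_j K i j = 1.

Lemma kernel_powE l (i j : 'I_m) : (K ^+ l.+1) i j = \sum_x K i x * (K ^+ l) x j.
Proof. by rewrite exprS mxE. Qed.

Lemma kernel_pow_ge0 l i j : 0 <= (K ^+ l) i j.
Proof.
elim: l i j => [|l IH] i j; first by rewrite expr0 mxE ler0n.
by rewrite kernel_powE sumr_ge0 // => x _; rewrite mulr_ge0.
Qed.

Lemma kernel_pow_sum l i : \sum_j (K ^+ l) i j = 1.
Proof.
elim: l i => [|l IH] i.
  rewrite expr0 (bigD1 i) //= mxE eqxx big1 ?addr0 // => j ji.
  by rewrite mxE eq_sym (negbTE ji).
under eq_bigr do rewrite kernel_powE.
rewrite exchange_big /= -[RHS](K_sum i); apply: eq_bigr => x _.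
by rewrite -mulr_sumr IH mulr1.
Qed.

Lemma kernel_pow_le1 l i j : (K ^+ l) i j <= 1.
Proof.
rewrite -(kernel_pow_sum l i) (bigD1 j) //= lerDl.
by apply: sumr_ge0 => x _; exact: kernel_pow_ge0.
Qed.

(** Binomial expansion of [Q ^ l = Lam ^ l (K - 1) ^ l]: this is the coefficient
    of the Cauchy product of the series of [exp (Lam t K)] and
    [exp (- Lam t)]. *)
Lemma generator_powE t l i j :
  t ^+ l / l`!%:R * (Q ^+ l) i j
  = \sum_(x < l.+1) (exp_coeff (Lam * t) x * (K ^+ x) i j)
                    * exp_coeff (- (Lam * t)) (l - x)%N.
Proof.
have -> : Q ^+ l = Lam ^+ l *: (K - 1) ^+ l.
  have -> : K - 1 = Lam^-1 *: Q by rewrite /jump_kernel addrC addKr.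
  rewrite scalemx_exp scalerA -exprMn mulfV ?lt0r_neq0 // expr1n scale1r //.
rewrite mxE addrC exprDn_comm; last exact/commr_sym/commrN1.
rewrite summxE !mulr_sumr; apply: eq_bigr => x _.
have xl : (x <= l)%N by rewrite -ltnS.
have -> : ((-1) ^+ (l - x) * K ^+ x *+ 'C(l, x)) i j
    = (-1) ^+ (l - x) * (K ^+ x) i j * 'C(l, x)%:R.
  rewrite mulmxnE mulr_natr; congr (_ *+ _); elim: (l - x)%N => [|p IH].
    by rewrite !expr0 !mul1r.
  by rewrite !exprS -!mulrA !mulN1r mxE IH.
rewrite /exp_coeff /= -(bin_fact xl) !natrM [(- (Lam * t)) ^+ _]exprNn !exprMn.
have -> : Lam ^+ l = Lam ^+ x * Lam ^+ (l - x) by rewrite -exprD subnKC.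
have -> : t ^+ l = t ^+ x * t ^+ (l - x) by rewrite -exprD subnKC.
have f0 (k : nat) : k`!%:R != 0 :> R by rewrite pnatr_eq0 -lt0n fact_gt0.
have b0 : 'C(l, x)%:R != 0 :> R by rewrite pnatr_eq0 -lt0n bin_gt0.
by field; rewrite b0 !f0.
Qed.

(** [exp (t Q) = exp (- Lam t) exp (Lam t K)], where both sides are limits of
    entrywise series: the difference of the partial sums is the error term of
    [cauchy_product_exp]. *)
Lemma trans_poisson t i j : 0 <= t ->
  series (fun l => poisson (Lam * t) l * (K ^+ l) i j) @ \oo --> trans Q t i j.
Proof.
move=> t0; set lam := Lam * t.
have lam0 : 0 <= lam by rewrite mulr_ge0 // ltW.
pose a l := exp_coeff lam l * (K ^+ l) i j.
have al l : `|a l| <= exp_coeff lam l.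
  rewrite normrM !ger0_norm ?kernel_pow_ge0 ?exp_coeff_ge0 //.
  by rewrite ler_piMr ?kernel_pow_le1 ?exp_coeff_ge0.
have ca := cvg_series_dominated_exp al.
have e1 : series (fun l => poisson lam l * (K ^+ l) i j)
   = (fun N => expR (- lam) * \sum_(x < N) a x).
  apply/funext => N; rewrite /series /= big_mkord mulr_sumr.
  by apply: eq_bigr => x _; rewrite /poisson -mulrA.
have c1 : cvgn (series (fun l => poisson lam l * (K ^+ l) i j)).
  rewrite e1 (_ : (fun N => _) = (fun N => expR (- lam) * series a N)).
    exact: is_cvgMl_tmp.
  by apply/funext => N; rewrite /series /= big_mkord.
have cc := cauchy_product_exp al.
rewrite /trans mxE.
suff <- : limn (series (fun l => poisson lam l * (K ^+ l) i j))
   = limn (series (fun l : nat => t ^+ l / l`!%:R * (Q ^+ l) i j)) by [].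
apply/esym/cvg_lim => //.
have -> : series (fun l : nat => t ^+ l / l`!%:R * (Q ^+ l) i j)
  = (fun N => (\sum_(l < N) \sum_(x < l.+1) a x * exp_coeff (- lam) (l - x)%N
            - expR (- lam) * \sum_(x < N) a x)
     + series (fun l => poisson lam l * (K ^+ l) i j) N).
  apply/funext => N; rewrite e1 subrK /series /= big_mkord.
  by apply: eq_bigr => l _; rewrite generator_powE.
rewrite -[X in _ --> X]add0r; exact: cvgD cc c1.
Qed.

Lemma trans_ge0 t i j : 0 <= t -> 0 <= trans Q t i j.
Proof.
move=> t0; have c := @trans_poisson t i j t0.
rewrite -(cvg_lim _ c) //; apply: limr_ge; first exact: cvgP c.
near=> N; apply: sumr_ge0 => l _.
by rewrite mulr_ge0 ?kernel_pow_ge0 ?poisson_ge0 // mulr_ge0 // ltW.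
Unshelve. all: by end_near. Qed.

Lemma trans_fun_poisson t (f : 'I_m -> R) i : 0 <= t ->
  series (fun l => poisson (Lam * t) l * \sum_j (K ^+ l) i j * f j) @ \oo
    --> \sum_j trans Q t i j * f j.
Proof.
move=> t0; rewrite (_ : series _ = fun N => \sum_j
   (series (fun l => poisson (Lam * t) l * (K ^+ l) i j) N) * f j); last first.
  apply/funext => N; rewrite /series /=.
  under eq_bigr do rewrite mulr_sumr.
  rewrite exchange_big /=; apply: eq_bigr => j _; rewrite mulr_suml.
  by apply: eq_bigr => l _; rewrite mulrA.
apply: cvg_big => [|j _]; [exact: add_continuous|]; apply: cvgMr_tmp; exact: trans_poisson.
Qed.

Lemma trans_sum t i : 0 <= t -> \sum_j trans Q t i j = 1.
Proof.
move=> t0; have c := @trans_fun_poisson t (fun=> 1) i t0.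
under eq_bigr do rewrite -[trans _ _ _ _]mulr1.
rewrite -(cvg_lim _ c) //; apply/cvg_lim => //.
under eq_fun do (under eq_bigr do rewrite mulr1).
have -> : (fun l => poisson (Lam * t) l * \sum_j (K ^+ l) i j) = poisson (Lam * t).
  by apply/funext => l; rewrite kernel_pow_sum mulr1.
exact: cvg_poisson_sum.
Qed.

(** The number of jumps up to time [t] is a Poisson variable, whose first two
    factorial moments are [Lam * t] and [(Lam * t) ^ 2]. *)
Lemma trans_fun_le t (f : 'I_m -> R) i (a b c : R) : 0 <= t ->
  (forall l, \sum_j (K ^+ l) i j * f j <= a + b * l%:R + c * (l%:R * (l%:R - 1))) ->
  \sum_j trans Q t i j * f j <= a + b * (Lam * t) + c * (Lam * t) ^+ 2.
Proof.
move=> t0 h; set lam := Lam * t.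
have lam0 : 0 <= lam by rewrite mulr_ge0 // ltW.
have cf := @trans_fun_poisson t f i t0.
have cp : (fun N => a * series (poisson lam) N + b * series (fun l => poisson lam l * l%:R) N
    + c * series (fun l => poisson lam l * (l%:R * (l%:R - 1))) N) @ \oo
    --> a * 1 + b * lam + c * lam ^+ 2.
  apply: cvgD; first apply: cvgD; apply: cvgMl_tmp.
  - exact: cvg_poisson_sum.
  - exact: cvg_poisson_mean.
  - exact: cvg_poisson_fact2.
rewrite -[a]mulr1 -(cvg_lim _ cf) // -(cvg_lim _ cp) //.
apply: ler_lim; [exact: cvgP cf|exact: cvgP cp|].
near=> N; rewrite /series /= !mulr_sumr -!big_split /=; apply: ler_sum => l _.
apply: le_trans (ler_wpM2l (poisson_ge0 l lam0) (h l)) _.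
by rewrite le_eqVlt; apply/orP; left; apply/eqP; rewrite -/lam; ring.
Unshelve. all: by end_near. Qed.

(** By Chebyshev's inequality, a Poisson variable of mean [lam] is below
    [lam / 2] with probability at most [4 / lam]. The quadratic in [l] that is
    integrated is [eps + 4 (l - lam) ^ 2 / lam ^ 2]. *)
Lemma trans_fun_tail t (f : 'I_m -> R) i eps L : 0 < t ->
  (forall l, \sum_j (K ^+ l) i j * f j <= eps + 1) ->
  (forall l, (L <= l)%N -> \sum_j (K ^+ l) i j * f j <= eps) ->
  2 * L%:R <= Lam * t ->
  \sum_j trans Q t i j * f j <= eps + 4 / (Lam * t).
Proof.
move=> t0 h1 hL Llam; set lam := Lam * t in Llam *.
have lam0 : 0 < lam by exact: mulr_gt0.
have l2 : 0 < lam ^+ 2 by rewrite exprn_gt0.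
suff h l : \sum_j (K ^+ l) i j * f j
    <= (eps + 4) + (4 * (1 - 2 * lam) / lam ^+ 2) * l%:R
       + 4 / lam ^+ 2 * (l%:R * (l%:R - 1)).
  apply: le_trans (trans_fun_le (ltW t0) h) _; rewrite -/lam.
  by rewrite le_eqVlt; apply/orP; left; apply/eqP; field; rewrite lt0r_neq0.
have -> : (eps + 4) + (4 * (1 - 2 * lam) / lam ^+ 2) * l%:R
       + 4 / lam ^+ 2 * (l%:R * (l%:R - 1)) = eps + 4 * (l%:R - lam) ^+ 2 / lam ^+ 2.
  by field; rewrite lt0r_neq0.
have [Ll|lL] := leqP L l.
  apply: le_trans (hL _ Ll) _; rewrite lerDl divr_ge0 ?sqr_ge0 //.
  by rewrite mulr_ge0 ?sqr_ge0.
apply: le_trans (h1 l) _; rewrite lerD2l ler_pdivlMr // mul1r.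
have : l%:R <= L%:R :> R by rewrite ler_nat ltnW.
by move=> lL'; nra.
Qed.

End Uniformization.

(** * Return probabilities of lazy reversible kernels *)

Section MatrixAction.
Context {R : realFieldType} {m : nat}.
Implicit Types (A B : 'M[R]_m) (f g : 'I_m -> R).

Definition mx_act A f (i : 'I_m) : R := \sum_j A i j * f j.

Lemma mx_act1 f : mx_act 1 f =1 f.
Proof.
move=> i; rewrite /mx_act (bigD1 i) //= mxE eqxx mul1r big1 ?addr0 // => j ji.
by rewrite mxE eq_sym (negbTE ji) mul0r.
Qed.

Lemma mx_actM A B f : mx_act (A * B) f =1 mx_act A (mx_act B f).
Proof.
move=> i; rewrite /mx_act; under eq_bigr do rewrite mxE mulr_suml.
rewrite exchange_big; apply: eq_bigr => x _; rewrite mulr_sumr.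
by apply: eq_bigr => j _; rewrite mulrA.
Qed.

Lemma eq_mx_act A f g : f =1 g -> mx_act A f =1 mx_act A g.
Proof. by move=> fg i; apply: eq_bigr => j _; rewrite fg. Qed.

Lemma mx_actS A l f : mx_act (A ^+ l.+1) f =1 mx_act A (mx_act (A ^+ l) f).
Proof. by move=> i; rewrite exprS mx_actM. Qed.

Lemma mx_actSr A l f : mx_act (A ^+ l.+1) f =1 mx_act (A ^+ l) (mx_act A f).
Proof. by move=> i; rewrite exprSr mx_actM. Qed.

Lemma mx_actZD A a b f g :
  mx_act A (fun i => a * f i + b * g i) =1 fun i => a * mx_act A f i + b * mx_act A g i.
Proof.
move=> i; rewrite /mx_act !mulr_sumr -big_split; apply: eq_bigr => j _ /=.
by rewrite mulrDr !(mulrCA (A i j)).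
Qed.

End MatrixAction.

Section StochasticAction.
Context {R : realFieldType} {m : nat}.
Variable A : 'M[R]_m.
Hypothesis A_ge0 : forall i j, 0 <= A i j.
Hypothesis A_sum : forall i, \sum_j A i j = 1.
Implicit Types f g : 'I_m -> R.

Lemma mx_act_le f g i : (forall j, f j <= g j) -> mx_act A f i <= mx_act A g i.
Proof. by move=> fg; apply: ler_sum => j _; rewrite ler_wpM2l. Qed.

Lemma mx_act_cst c i : mx_act A (fun=> c) i = c.
Proof. by rewrite /mx_act -mulr_suml A_sum mul1r. Qed.

Lemma mx_act_pow_le f g l i :
  (forall j, f j <= g j) -> mx_act (A ^+ l) f i <= mx_act (A ^+ l) g i.
Proof.
move=> fg; elim: l i => [|l IH] i; first by rewrite expr0 !mx_act1.
by rewrite !mx_actS; exact: mx_act_le.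
Qed.

Lemma mx_act_pow_cst c l i : mx_act (A ^+ l) (fun=> c) i = c.
Proof.
elim: l i => [|l IH] i; first by rewrite expr0 mx_act1.
by rewrite mx_actS (eq_mx_act _ IH) mx_act_cst.
Qed.

(** Variance is nonnegative. *)
Lemma mx_act_jensen f i : (mx_act A f i) ^+ 2 <= mx_act A (fun j => f j ^+ 2) i.
Proof.
rewrite -subr_ge0; set c := mx_act A f i.
have -> : mx_act A (fun j => f j ^+ 2) i - c ^+ 2
    = mx_act A (fun j => (f j - c) ^+ 2) i.
  have -> : mx_act A (fun j => (f j - c) ^+ 2) i
     = mx_act A (fun j => 1 * f j ^+ 2 + 1 * ((- 2 * c) * f j + c ^+ 2 * 1)) i.
    by apply: eq_mx_act => j; ring.
  rewrite mx_actZD (mx_actZD A (- 2 * c) (c ^+ 2) f (fun=> 1)) mx_act_cst -/c.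
  by ring.
by apply: sumr_ge0 => j _; rewrite mulr_ge0 ?sqr_ge0.
Qed.

End StochasticAction.

Section ReversibleKernel.
Context {R : realFieldType} {m : nat}.
Variables (K : 'M[R]_m) (pi : 'I_m -> R).
Hypothesis K_sum : forall i, \sum_j K i j = 1.
Hypothesis pi_gt0 : forall i, 0 < pi i.
Hypothesis pi_sum : \sum_i pi i = 1.
Hypothesis reversible : forall i j, pi i * K i j = pi j * K j i.
(* Half of the mass of each row stays on the diagonal, so that [2 K - 1] is
   again stochastic. *)
Hypothesis K_offdiag_ge0 : forall i j, i != j -> 0 <= K i j.
Hypothesis K_lazy : forall i, 2^-1 <= K i i.
Implicit Types f g : 'I_m -> R.

Definition inner f g := \sum_i pi i * (f i * g i).

Lemma lazy_kernel_ge0 i j : 0 <= K i j.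
Proof.
have [<-|ij] := eqVneq i j; last exact: K_offdiag_ge0.
by apply: le_trans (K_lazy i); rewrite invr_ge0.
Qed.

Lemma innerC f g : inner f g = inner g f.
Proof. by apply: eq_bigr => i _; rewrite (mulrC (f i)). Qed.

Lemma innerZD a b f g h :
  inner (fun i => a * f i + b * g i) h = a * inner f h + b * inner g h.
Proof. by rewrite /inner !mulr_sumr -big_split; apply: eq_bigr => i _ /=; ring. Qed.

Lemma inner_sqrD a b f h :
  inner (fun i => a * f i + b * h i) (fun i => a * f i + b * h i)
  = a ^+ 2 * inner f f + 2 * (a * b) * inner f h + b ^+ 2 * inner h h.
Proof.
rewrite /inner !mulr_sumr -!big_split; apply: eq_bigr => i _ /=; ring.
Qed.

Lemma eq_inner f f' g g' : f =1 f' -> g =1 g' -> inner f g = inner f' g'.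
Proof. by move=> ff gg; apply: eq_bigr => i _; rewrite ff gg. Qed.

Lemma inner_ge0 f : 0 <= inner f f.
Proof. by apply: sumr_ge0 => i _; rewrite mulr_ge0 ?(ltW (pi_gt0 _)) // -expr2 sqr_ge0. Qed.

Lemma inner_act f g : inner f (mx_act K g) = inner (mx_act K f) g.
Proof.
rewrite /inner /mx_act; under eq_bigr do rewrite !mulr_sumr.
under [RHS]eq_bigr do rewrite mulr_suml mulr_sumr.
rewrite exchange_big; apply: eq_bigr => i _; apply: eq_bigr => j _ /=.
have := reversible i j; rewrite -/(pi i) => h.
by transitivity (pi j * K j i * f j * g i); [ring | rewrite -h; ring].
Qed.

Lemma inner_act_pow l f g : inner f (mx_act (K ^+ l) g) = inner (mx_act (K ^+ l) f) g.
Proof.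
elim: l f g => [|l IH] f g; first by apply: eq_inner => // i; rewrite expr0 mx_act1.
rewrite (eq_inner (fun=> erefl) (mx_actS _ _ _)) inner_act IH.
by apply: eq_inner => // i; rewrite mx_actSr.
Qed.

Lemma inner1_act_pow l f : inner (fun=> 1) (mx_act (K ^+ l) f) = inner (fun=> 1) f.
Proof.
by rewrite inner_act_pow; apply: eq_inner => // i; exact: mx_act_pow_cst.
Qed.

(** Jensen's inequality at each state, then invariance of [pi]. *)
Lemma inner_jensen (S : 'M[R]_m) f :
  (forall i j, 0 <= S i j) -> (forall i, \sum_j S i j = 1) ->
  (forall i j, pi i * S i j = pi j * S j i) ->
  inner (mx_act S f) (mx_act S f) <= inner f f.
Proof.
move=> S0 S1 Srev; pose f2 := fun i => f i ^+ 2.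
apply: (@le_trans _ _ (\sum_i pi i * mx_act S f2 i)).
  apply: ler_sum => i _; rewrite ler_wpM2l ?(ltW (pi_gt0 _)) // -expr2.
  exact: mx_act_jensen.
rewrite /mx_act; under eq_bigr do rewrite mulr_sumr.
rewrite exchange_big /=; apply: ler_sum => i _.
under eq_bigr => j _ do rewrite mulrA Srev.
by rewrite -mulr_suml -mulr_sumr S1 mulr1 -expr2.
Qed.

(** [K = (1 + S) / 2] with [S = 2 K - 1] stochastic and reversible, hence a
    contraction for the inner product: a lazy kernel is a nonnegative operator. *)
Lemma inner_lazy_ge0 f : 0 <= inner f (mx_act K f).
Proof.
pose S : 'M[R]_m := 2 *: K - 1.
have SE i j : S i j = 2 * K i j - (i == j)%:R by rewrite !mxE.
have S0 i j : 0 <= S i j.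
  rewrite SE; case: eqVneq => [<-|ij] /=.
    rewrite subr_ge0 -ler_pdivrMl // mulr1; exact: K_lazy.
  by rewrite subr0 mulr_ge0 // K_offdiag_ge0.
have S1 i : \sum_j S i j = 1.
  under eq_bigr do rewrite SE; rewrite sumrB -mulr_sumr K_sum.
  rewrite (bigD1 i) //= eqxx /= big1 ?addr0; first by ring.
  by move=> j ji; rewrite eq_sym (negbTE ji).
have Srev i j : pi i * S i j = pi j * S j i.
  rewrite !SE !mulrBr ![_ * (2 * _)]mulrCA reversible eq_sym.
  by case: eqVneq => [->|_]; rewrite ?mulr0.
have actK : mx_act K f =1 fun i => 2^-1 * f i + 2^-1 * mx_act S f i.
  move=> i; rewrite /mx_act.
  rewrite (eq_bigr (fun j => 2^-1 * ((i == j)%:R * f j) + 2^-1 * (S i j * f j))); last first.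
    by move=> j _; rewrite SE; field.
  rewrite big_split -!mulr_sumr (bigD1 i) //= eqxx mul1r big1 ?addr0 // => j ji.
  by rewrite eq_sym (negbTE ji) mul0r.
rewrite (eq_inner (fun=> erefl) actK) innerC innerZD -mulrDr mulr_ge0 ?invr_ge0 //.
have := inner_jensen f S0 S1 Srev.
have := inner_ge0 (fun i => 1 * f i + 1 * mx_act S f i).
rewrite inner_sqrD [inner f (mx_act S f)]innerC; lra.
Qed.

Section HittingState.
Variables (z : 'I_m) (Lam H : R) (g : 'I_m -> R).
Hypothesis Lam_gt0 : 0 < Lam.
Hypothesis H_gt0 : 0 < H.
Hypothesis g_poisson :
  forall i, mx_act K g i = g i + ((i == z)%:R / pi z - 1) / Lam.
Hypothesis g_itv : forall i, 0 <= g i - g z <= H.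

(** By reversibility, the density with respect to [pi] of the law after [l] steps
    from [z], minus 1. *)
Definition excess_density l : 'I_m -> R :=
  mx_act (K ^+ l) (fun i => (i == z)%:R / pi z - 1).

Local Notation rho := excess_density.

Definition excess_return l : R := rho l z.

Lemma inner_rho0 f : inner (rho 0) f = f z - inner (fun=> 1) f.
Proof.
rewrite (eq_inner (f' := fun i => 1 * ((i == z)%:R / pi z) + (- 1) * 1) (g' := f)) //.
  rewrite (innerZD 1 (- 1) (fun i => (i == z)%:R / pi z) (fun=> 1)) mul1r mulN1r.
  congr (_ - _); rewrite /inner (bigD1 z) //= eqxx /= big1 ?addr0.
    by field; rewrite lt0r_neq0.
  by move=> i iz; rewrite (negbTE iz) !mul0r mulr0.
by move=> i; rewrite /excess_density expr0 mx_act1 mul1r mulr1.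
Qed.

Lemma excess_returnD i j : excess_return (i + j) = inner (rho i) (rho j).
Proof.
have c0 l : inner (fun=> 1) (rho l) = 0.
  rewrite inner1_act_pow innerC (eq_inner (f' := rho 0) (g' := fun=> 1)) //.
    rewrite inner_rho0 /inner; under eq_bigr do rewrite mulr1 mulr1.
    by rewrite pi_sum subrr.
  by move=> x; rewrite /excess_density expr0 mx_act1.
have -> : inner (rho i) (rho j) = inner (rho 0) (rho (i + j)).
  have e : rho i =1 mx_act (K ^+ i) (rho 0).
    by move=> x; apply: eq_mx_act => y; rewrite /excess_density expr0 mx_act1.
  rewrite (eq_inner e (fun=> erefl)) -inner_act_pow; apply: eq_inner => // x.
  by rewrite /excess_density exprD mx_actM.
by rewrite inner_rho0 c0 subr0.
Qed.

Lemma excess_return_odd_ge0 l : 0 <= excess_return (l + l).+1.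
Proof.
rewrite -addnS excess_returnD (eq_inner (fun=> erefl) (mx_actS _ _ _)).
exact: inner_lazy_ge0.
Qed.

Lemma excess_return_even_noninc l :
  excess_return (l.+1 + l.+1) <= excess_return (l + l).
Proof.
rewrite !excess_returnD (eq_inner (mx_actS _ _ _) (mx_actS _ _ _)).
by apply: inner_jensen => //; exact: lazy_kernel_ge0.
Qed.

(** By Poisson's equation the mean of [g] along the chain started from [z]
    increases at each step by the excess return probability over [Lam], and [g]
    never exceeds [g z] by more than [H]. *)
Lemma excess_return_sum_le L : \sum_(l < L) excess_return l <= Lam * H.
Proof.
have -> : \sum_(l < L) excess_return l = Lam * (mx_act (K ^+ L) g z - g z).
  elim: L => [|L IH]; first by rewrite big_ord0 expr0 mx_act1 subrr mulr0.
  rewrite big_ord_recr /= IH mx_actSr (eq_mx_act _ g_poisson).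
  have -> : mx_act (K ^+ L) (fun i => g i + ((i == z)%:R / pi z - 1) / Lam) z
     = mx_act (K ^+ L) g z + excess_return L / Lam.
    have -> : mx_act (K ^+ L) g z + excess_return L / Lam
        = 1 * mx_act (K ^+ L) g z + Lam^-1 * excess_return L by ring.
    rewrite -mx_actZD; apply: eq_mx_act => i; ring.
  by field; rewrite lt0r_neq0.
rewrite ler_pM2l // lerBlDr -(mx_act_pow_cst K_sum (H + g z) L z).
apply: mx_act_pow_le => [|j]; first exact: lazy_kernel_ge0.
by have /andP[_] := g_itv j; rewrite lerBlDr.
Qed.

(** The excess at the even times is nonincreasing, and at the odd times it is
    nonnegative, because the kernel is lazy; so the sum over the times up to
    [2 L] contains at least [L + 1] times the last term. *)
Lemma excess_return_le L : L.+1%:R * excess_return (L + L) <= Lam * H.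
Proof.
apply: le_trans (excess_return_sum_le (L + L).+1).
elim: L => [|L IH]; first by rewrite mul1r addn0 big_ord1.
rewrite -addn1 natrD mulrDl mul1r addSn addnS !big_ord_recr /= -addrA.
have o := excess_return_odd_ge0 L; have e := excess_return_even_noninc L.
move: IH; rewrite big_ord_recr /=.
have : (L.+1%:R : R) * excess_return (L.+1 + L.+1) <= L.+1%:R * excess_return (L + L).
  by rewrite ler_wpM2l.
have -> : (L + L).+2 = (L.+1 + L.+1)%N by rewrite addSn addnS.
lra.
Qed.

(** The left side is the inner product of [f] with the excess density, whose
    squared norm is the excess return probability at time [2 L]. *)
Lemma act_pow_center_le L f eps : (forall i, 0 <= f i <= 1) -> 0 <= eps ->
  Lam * H <= eps ^+ 2 * L.+1%:R ->
  mx_act (K ^+ L) f z - inner (fun=> 1) f <= eps.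
Proof.
move=> f01 eps0 hL; set d := _ - _.
have dE : d = inner (rho L) f.
  have e : rho L =1 mx_act (K ^+ L) (rho 0).
    by move=> x; apply: eq_mx_act => y; rewrite /excess_density expr0 mx_act1.
  by rewrite (eq_inner e (fun=> erefl)) -inner_act_pow inner_rho0 inner1_act_pow.
have ff1 : inner f f <= 1.
  rewrite -pi_sum; apply: ler_sum => i _; rewrite ler_piMr ?(ltW (pi_gt0 _)) //.
  by have /andP[a b] := f01 i; rewrite mulr_ile1.
have d2 : d ^+ 2 <= excess_return (L + L).
  have := inner_ge0 (fun i => 1 * rho L i + (- d) * f i).
  rewrite inner_sqrD -dE excess_returnD.
  have := sqr_ge0 d; nra.
have : d ^+ 2 <= eps ^+ 2.
  have := excess_return_le L; have L0 : 0 < L.+1%:R :> R by [].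
  move=> h; apply: le_trans d2 _; rewrite -(ler_pM2r L0) mulrC; exact: le_trans h hL.
have [d0|d0 _] := leP 0 d; last exact: ltW (lt_le_trans d0 eps0).
by rewrite ler_pXn2r.
Qed.

(** Away from [z] the function [1 + (g - g z) / H] decays at rate
    [1 / (2 * Lam * H)] under the kernel, because it lies between 1 and 2 and
    loses [1 / (Lam * H)] per step. A decaying multiple of it is thus a
    supersolution, which carries the estimate at [z] to all other states once the
    chain had [J] steps to reach [z]. *)
Lemma act_pow_le L J f eps x : (forall i, 0 <= f i <= 1) -> 0 <= eps ->
  1 <= Lam * H -> Lam * H <= eps ^+ 2 * L.+1%:R -> 4 * (Lam * H) <= eps * J%:R ->
  mx_act (K ^+ (L + J)) f x - inner (fun=> 1) f <= 2 * eps.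
Proof.
move=> f01 eps0 LH1 hL hJ; pose T := Lam * H.
have T0 : 0 < T by exact: mulr_gt0.
pose theta := 1 - (2 * T)^-1.
have iT : (2 * T)^-1 <= 1 by rewrite invf_le1 ?mulr_gt0 //; rewrite -/T in LH1; lra.
have iT0 : 0 < (2 * T)^-1 by rewrite invr_gt0 mulr_gt0.
have th0 : 0 <= theta by rewrite subr_ge0.
have pif0 : 0 <= inner (fun=> 1) f.
  by apply: sumr_ge0 => i _; rewrite mul1r mulr_ge0 ?(ltW (pi_gt0 _)) //; case/andP: (f01 i).
have g1 i : 1 <= 1 + (g i - g z) / H <= 2.
  have /andP[a b] := g_itv i; apply/andP; split.
    by rewrite lerDl divr_ge0 // ltW.
  by have : (g i - g z) / H <= 1; [rewrite ler_pdivrMr ?mul1r | lra].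
have super j i : mx_act (K ^+ (L + j)) f i - inner (fun=> 1) f
     <= eps + theta ^+ j * (1 + (g i - g z) / H).
  elim: j i => [|j IH] i.
    rewrite addn0 mul1r; have /andP[a _] := g1 i.
    have : mx_act (K ^+ L) f i <= 1.
      rewrite -(mx_act_pow_cst K_sum 1 L i); apply: mx_act_pow_le => [|k].
        exact: lazy_kernel_ge0.
      by case/andP: (f01 k).
    lra.
  have [->|iz] := eqVneq i z.
    rewrite subrr mul0r addr0 mulr1.
    have : mx_act (K ^+ (L + j.+1)) f z - inner (fun=> 1) f <= eps.
      apply: act_pow_center_le => //; apply: le_trans hL _.
      by rewrite ler_wpM2l ?sqr_ge0 // ler_nat ltnS leq_addr.
    have := exprn_ge0 j.+1 th0; lra.
  rewrite addnS mx_actS lerBlDr.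
  pose c := inner (fun=> 1) f + eps + theta ^+ j * (1 - g z / H).
  apply: (@le_trans _ _ (mx_act K (fun k => c * 1 + (theta ^+ j / H) * g k) i)).
    apply: mx_act_le => [|k]; first exact: lazy_kernel_ge0.
    have := IH k; rewrite lerBlDr => /le_trans; apply; rewrite /c.
    by rewrite le_eqVlt; apply/orP; left; apply/eqP; field; rewrite lt0r_neq0.
  rewrite mx_actZD mx_act_cst // g_poisson (negbTE iz) mul0r sub0r.
  have /andP[a b] := g1 i; set G := 1 + _ in a b *.
  have -> : c * 1 + theta ^+ j / H * (g i + - 1 / Lam)
      = inner (fun=> 1) f + eps + theta ^+ j * (G - T^-1).
    by rewrite /c /G /T; field; rewrite !lt0r_neq0.
  rewrite exprSr -mulrA -subr_ge0.
  have -> : eps + theta ^+ j * (theta * G) + inner (fun=> 1) f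
     - (inner (fun=> 1) f + eps + theta ^+ j * (G - T^-1))
     = theta ^+ j * ((2 * T)^-1 * (2 - G)).
    by rewrite /theta; field; rewrite lt0r_neq0.
  by rewrite mulr_ge0 ?exprn_ge0 // mulr_ge0 ?(ltW iT0) // subr_ge0.
apply: le_trans (super J x) _; have /andP[_ b] := g1 x.
(* Bernoulli: [theta ^ J * (1 + J / (2 T)) <= 1] *)
have bern j : theta ^+ j * (1 + j%:R * (2 * T)^-1) <= 1.
  elim: j => [|j IH]; first by rewrite mul0r addr0 mulr1.
  rewrite exprSr -natr1; apply: le_trans IH.
  rewrite -mulrA ler_wpM2l ?exprn_ge0 // /theta.
  set a := (2 * T)^-1; rewrite -subr_ge0.
  rewrite (_ : _ - _ = (j%:R + 1) * a ^+ 2); last by ring.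
  by rewrite mulr_ge0 ?sqr_ge0 // addr_ge0.
have := bern J; set y := theta ^+ J => hy.
have y0 : 0 <= y by exact: exprn_ge0.
have : y * J%:R <= 2 * T.
  have -> : y * J%:R = (y * (J%:R * (2 * T)^-1)) * (2 * T) by field; rewrite lt0r_neq0.
  apply: ler_piMl; first by rewrite mulr_ge0 ?(ltW T0).
  by move: hy; rewrite mulrDr mulr1; lra.
move=> yJ; have J0 : 0 < J%:R :> R.
  rewrite ltr0n lt0n; apply/eqP => J0; move: hJ; rewrite J0 mulr0 -/T; lra.
have : 2 * y <= eps.
  rewrite -(ler_pM2r J0); apply: le_trans hJ; rewrite -/T; lra.
have : y * (1 + (g x - g z) / H) <= y * 2 by rewrite ler_wpM2l.
lra.
Qed.

End HittingState.

End ReversibleKernel.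

(** * Birth-death chains *)

Section BirthDeath.
Context {R : realFieldType}.

Definition birth_death_gen (m : nat) (p q : nat -> R) : 'M[R]_m :=
  \matrix_(i, j)
    if j == i.+1 :> nat then p i
    else if i == j.+1 :> nat then q i
    else if i == j then - (p i + q i)
    else 0.

Lemma sum_ord_pick m c (F : nat -> R) :
  \sum_(j < m) (j == c :> nat)%:R * F j = if (c < m)%N then F c else 0.
Proof.
case: ltnP => [cm|mc].
  rewrite (bigD1 (Ordinal cm)) //= eqxx mul1r big1 ?addr0 // => j jc.
  by rewrite (_ : (j == c :> nat) = false) ?mul0r //; apply/negbTE.
rewrite big1 // => j _; rewrite (_ : (j == c :> nat) = false) ?mul0r //.
by apply/negbTE; rewrite neq_ltn (leq_trans (ltn_ord j) mc).
Qed.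

Variables (m : nat) (p q : nat -> R).
Hypothesis q0 : q 0%N = 0.
Hypothesis p_last : forall i, i.+1 = m -> p i = 0.
Hypothesis p_gt0 : forall i, (i.+1 < m)%N -> 0 < p i.
Hypothesis q_gt0 : forall i, (i.+1 < m)%N -> 0 < q i.+1.

Local Notation Q := (birth_death_gen m p q).

Lemma birth_death_act (G : nat -> R) (i : 'I_m) :
  mx_act Q (fun j => G j) i = p i * (G i.+1 - G i) + q i * (G i.-1 - G i).
Proof.
rewrite /mx_act.
rewrite (eq_bigr (fun j : 'I_m => p i * ((j == i.+1 :> nat)%:R * G j)
     + ((0 < i)%:R * q i) * ((j == i.-1 :> nat)%:R * G j)
     - (p i + q i) * ((j == i :> nat)%:R * G j))); last first.
  move=> j _; rewrite mxE; have [ji|ji] := eqVneq (j : nat) i.+1.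
    rewrite !ji gtn_eqF ?ltnS ?leq_pred // (gtn_eqF (ltnSn i)) /=.
    by rewrite mul1r !mul0r !mulr0 addr0 subr0.
  have [ij|ij] := eqVneq (i : nat) j.+1.
    by rewrite ij /= eqxx (ltn_eqF (ltnSn j)) !mul1r !mul0r !mulr0 add0r subr0.
  have [<-|nij] := eqVneq i j.
    rewrite eqxx /= mul0r mulr0 add0r mul1r.
    by case: (i : nat) => [|i'] /=; rewrite ?(gtn_eqF (ltnSn i')) !mul0r ?mulr0 sub0r mulNr.
  have -> : (j == i :> nat) = false.
    by apply/negbTE; apply: contra nij => /eqP ji'; apply/eqP/val_inj.
  have -> : (0 < i)%:R * q i * ((j == i.-1 :> nat)%:R * G j) = 0.
    case: (i : nat) ij => [|i'] ij' /=; first by rewrite !mul0r.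
    by rewrite (_ : (j == i' :> nat) = false) ?mul0r ?mulr0 //;
       apply/negbTE; apply: contra ij' => /eqP ->.
  by rewrite /= !mul0r !mulr0 addr0 subr0.
rewrite sumrB big_split /= -!mulr_sumr !sum_ord_pick ltn_ord.
have -> : p i * (if (i.+1 < m)%N then G i.+1 else 0) = p i * G i.+1.
  by case: ltnP => // mi; rewrite p_last ?mul0r //; apply/eqP; rewrite eqn_leq mi ltn_ord.
rewrite (leq_ltn_trans (leq_pred _) (ltn_ord i)).
have -> : (0 < i)%:R * q i = q i.
  by case: (i : nat) => [|i']; rewrite ?q0 ?mulr0 ?mul1r.
ring.
Qed.

Fixpoint bd_weight (i : nat) : R :=
  if i is j.+1 then bd_weight j * p j / q j.+1 else 1.

Definition bd_stat (i : nat) : R := bd_weight i / \sum_(j < m) bd_weight j.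

Local Notation pi := bd_stat.

Lemma bd_weight_gt0 i : (i < m)%N -> 0 < bd_weight i.
Proof.
elim: i => [|i IH] im //=.
by rewrite divr_gt0 ?mulr_gt0 ?p_gt0 ?q_gt0 ?IH // ltnW.
Qed.

Lemma bd_stat_gt0 i : (i < m)%N -> 0 < pi i.
Proof.
move=> im; rewrite divr_gt0 ?bd_weight_gt0 //.
rewrite (bigD1 (Ordinal im)) //= ltr_pwDl ?bd_weight_gt0 //.
by apply: sumr_ge0 => j _; rewrite ltW ?bd_weight_gt0.
Qed.

Lemma bd_stat_sum : (0 < m)%N -> \sum_(i < m) pi i = 1.
Proof.
move=> m0; rewrite -mulr_suml mulfV // lt0r_neq0 //.
rewrite (bigD1 (Ordinal m0)) //= ltr_pwDl //.
by apply: sumr_ge0 => j _; rewrite ltW ?bd_weight_gt0.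
Qed.

Lemma bd_stat_balance i : (i.+1 < m)%N -> pi i * p i = pi i.+1 * q i.+1.
Proof.
move=> im; rewrite /bd_stat /=; set Z := (X in _ / X).
by rewrite mulrAC [RHS]mulrAC divfK // lt0r_neq0 ?q_gt0.
Qed.

Lemma birth_death_reversible (i j : 'I_m) : pi i * Q i j = pi j * Q j i.
Proof.
wlog ij : i j / (i <= j)%N.
  move=> h; have [/h //|/ltnW/h //] := leqP i j.
have := ltn_ord j; rewrite !mxE; have [ji|ji] := eqVneq (j : nat) i.+1.
  by rewrite ji => im; rewrite (ltn_eqF (leqnSn i.+1)) ?eqxx bd_stat_balance.
have [ie|ie] := eqVneq (i : nat) j.+1; first by move: ij; rewrite ie ltnn.
by rewrite [j == i]eq_sym; case: eqVneq => [->|]; rewrite // !mulr0.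
Qed.

Section HittingTime.
Variables (z : nat) (wl wr : nat -> R) (H : R).
Hypothesis zm : (z < m)%N.
(* The slopes of a function that decreases in mean at unit speed at least off
   [z]: [wl i] is its decrease from [i] to [i + 1] left of [z], and [wr i] its
   increase from [i - 1] to [i] right of [z]. *)
Hypothesis wl_drift : forall i, (i < z)%N -> 1 + q i * wl i.-1 <= p i * wl i.
Hypothesis wr_drift : forall i, (z < i < m)%N -> 1 + p i * wr i.+1 <= q i * wr i.
Hypothesis wl_ge0 : forall i, (i < z)%N -> 0 <= wl i.
Hypothesis wr_ge0 : forall i, (z < i < m)%N -> 0 <= wr i.
Hypothesis wl_sum : \sum_(0 <= i < z) wl i <= H.
Hypothesis wr_sum : \sum_(z <= i < m.-1) wr i.+1 <= H.

Let m_gt0 : (0 < m)%N. Proof. exact: leq_ltn_trans zm. Qed.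

Definition bd_cum (j : nat) : R := \sum_(0 <= l < j.+1) pi l.

Lemma bd_cumS j : bd_cum j.+1 = bd_cum j + pi j.+1.
Proof. by rewrite /bd_cum big_nat_recr. Qed.

Lemma bd_cum_last : bd_cum m.-1 = 1.
Proof. by rewrite /bd_cum prednK // big_mkord bd_stat_sum. Qed.

Definition hitting_step (j : nat) : R := (bd_cum j - (z <= j)%:R) / (pi j * p j).

(** Up to an additive constant, the expected time to reach [z]. Poisson's equation
    prescribes the divergence of the flux [pi j * p j * (g (j + 1) - g j)], which
    is summed from the left end. *)
Definition mean_hitting (i : nat) : R := - \sum_(0 <= j < i) hitting_step j.

Lemma mean_hittingS i : mean_hitting i.+1 - mean_hitting i = - hitting_step i.
Proof. by rewrite /mean_hitting big_nat_recr //=; ring. Qed.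

Lemma mean_hitting_poisson (i : 'I_m) :
  mx_act Q (fun j => mean_hitting j) i = (i == z :> nat)%:R / pi z - 1.
Proof.
rewrite birth_death_act mean_hittingS.
have pii := bd_stat_gt0 (ltn_ord i).
have -> : p i * - hitting_step i = - (bd_cum i - (z <= i)%:R) / pi i.
  have [im|mi] := ltnP i.+1 m.
    by rewrite /hitting_step; field; rewrite !lt0r_neq0 ?p_gt0.
  have im : i.+1 = m by apply/eqP; rewrite eqn_leq mi ltn_ord.
  rewrite p_last // mul0r; have -> : nat_of_ord i = m.-1 by exact: (congr1 predn im).
  by rewrite bd_cum_last -ltnS prednK // zm subrr oppr0 mul0r.
have -> : (i == z :> nat)%:R / pi z = (i == z :> nat)%:R / pi i.
  by case: eqP => [->|] //; rewrite !mul0r.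
case: i pii => -[|i] im /= pii.
  rewrite q0 mul0r addr0 leqn0 [z == _]eq_sym /bd_cum big_nat1.
  by field; rewrite lt0r_neq0.
have -> : q i.+1 * (mean_hitting i - mean_hitting i.+1)
    = (bd_cum i - (z <= i)%:R) / pi i.+1.
  rewrite -opprB mean_hittingS opprK /hitting_step bd_stat_balance //.
  by field; rewrite !lt0r_neq0 ?q_gt0.
rewrite bd_cumS leq_eqVlt ltnS eq_sym.
have -> : ((i.+1 == z) || (z <= i)%N)%:R = (i.+1 == z)%:R + (z <= i)%:R :> R.
  by case: eqP => [<-|_] /=; rewrite ?ltnn ?addr0 ?add0r.
by field; rewrite lt0r_neq0.
Qed.

(** Summing [wl_drift] against the stationary weights: the flux of the comparison
    function across the edge on the right of [i] is at least the stationary mass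
    on its left. *)
Lemma bd_cum_le i : (i < z)%N -> bd_cum i <= pi i * p i * wl i.
Proof.
elim: i => [|i IH] iz.
  rewrite /bd_cum big_nat1 -mulrA; have := wl_drift iz; rewrite q0 mul0r addr0 => h.
  by rewrite ler_peMr // ltW // bd_stat_gt0 // (ltn_trans iz).
rewrite bd_cumS; have iz' := ltnW iz; have im := ltn_trans iz zm.
apply: (@le_trans _ _ (pi i.+1 * q i.+1 * wl i + pi i.+1)).
  by rewrite lerD2r -bd_stat_balance // IH.
rewrite (_ : _ + _ = pi i.+1 * (1 + q i.+1 * wl i)); last by ring.
by rewrite -mulrA ler_wpM2l ?(ltW (bd_stat_gt0 _)) // (wl_drift iz).
Qed.

Lemma bd_tail_le d j : (j + d).+2 = m -> (z <= j)%N ->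
  1 - bd_cum j <= pi j * p j * wr j.+1.
Proof.
elim: d j => [|d IH] j jm zj.
  have jm1 : j.+1 = m.-1 by rewrite -jm addn0.
  have jm' : (j.+1 < m)%N by rewrite -jm addn0.
  have -> : 1 - bd_cum j = pi j.+1.
    by have := bd_cum_last; rewrite -jm1 bd_cumS => <-; ring.
  rewrite bd_stat_balance // -mulrA ler_peMr ?(ltW (bd_stat_gt0 _)) //.
  have w : (z < j.+1 < m)%N by rewrite ltnS zj.
  have pl : p j.+1 = 0 by apply: p_last; rewrite -jm addn0.
  by have := wr_drift w; rewrite pl mul0r addr0.
have jm' : (j.+2 < m)%N by rewrite -jm addnS !ltnS leq_addr.
have -> : 1 - bd_cum j = pi j.+1 + (1 - bd_cum j.+1) by rewrite bd_cumS; ring.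
have := IH j.+1; rewrite addSn -addnS => /(_ jm (leqW zj)) h.
rewrite bd_stat_balance 1?ltnW //.
apply: (@le_trans _ _ (pi j.+1 * (1 + p j.+1 * wr j.+2))).
  by rewrite mulrDr mulr1 mulrA lerD2l.
rewrite -mulrA ler_wpM2l ?(ltW (bd_stat_gt0 (ltnW jm'))) //.
by apply: wr_drift; rewrite ltnS zj ltnW.
Qed.

Lemma bd_cum_ge0 j : (j < m)%N -> 0 <= bd_cum j.
Proof.
move=> jm; rewrite /bd_cum big_nat; apply: sumr_ge0 => l /andP[_ lj].
by rewrite ltW // bd_stat_gt0 // (leq_ltn_trans _ jm).
Qed.

Lemma bd_cum_le1 j : (j < m)%N -> bd_cum j <= 1.
Proof.
move=> jm; rewrite -bd_cum_last /bd_cum prednK // (big_cat_nat (leq0n j.+1) jm) /=.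
rewrite lerDl big_nat; apply: sumr_ge0 => l /andP[_ lm].
by rewrite ltW // bd_stat_gt0.
Qed.

Lemma mean_hitting_itv (i : 'I_m) : 0 <= mean_hitting i - mean_hitting z <= H.
Proof.
have [iz|zi] := leqP i z.
  have -> : mean_hitting i - mean_hitting z = \sum_(i <= j < z) hitting_step j.
    by rewrite /mean_hitting (big_cat_nat (leq0n i) iz) /=; ring.
  have h j : (i <= j < z)%N -> 0 <= hitting_step j <= wl j.
    move=> /andP[_ jz]; have jm := ltn_trans jz zm.
    have d0 : 0 < pi j * p j.
      by rewrite mulr_gt0 ?bd_stat_gt0 ?p_gt0 // (leq_ltn_trans jz).
    rewrite /hitting_step leqNgt jz subr0 divr_ge0 ?bd_cum_ge0 ?(ltW d0) //=.
    by rewrite ler_pdivrMr // mulrC bd_cum_le.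
  apply/andP; split; first by rewrite big_nat; apply: sumr_ge0 => j /h /andP[].
  apply: le_trans wl_sum; rewrite (big_cat_nat (leq0n i) iz) /=.
  apply: (@le_trans _ _ (\sum_(i <= j < z) wl j)).
    by rewrite big_nat [leRHS]big_nat; apply: ler_sum => j /h /andP[].
  rewrite lerDr big_nat; apply: sumr_ge0 => j /andP[_ ji]; apply: wl_ge0.
  exact: leq_trans iz.
have zi' := ltnW zi.
have -> : mean_hitting i - mean_hitting z = \sum_(z <= j < i) - hitting_step j.
  by rewrite sumrN /mean_hitting (big_cat_nat (leq0n z) zi') /=; ring.
have h j : (z <= j < i)%N -> 0 <= - hitting_step j <= wr j.+1.
  move=> /andP[zj ji]; have jm : (j.+1 < m)%N := leq_ltn_trans ji (ltn_ord i).
  have d0 : 0 < pi j * p j by rewrite mulr_gt0 ?bd_stat_gt0 ?p_gt0 // ltnW.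
  rewrite /hitting_step zj -mulNr opprB divr_ge0 ?subr_ge0 ?bd_cum_le1 ?(ltW d0) 1?ltnW //=.
  rewrite ler_pdivrMr // mulrC (bd_tail_le (d := m - j.+2)) //.
  by rewrite -!addSn subnKC.
apply/andP; split; first by rewrite big_nat; apply: sumr_ge0 => j /h /andP[].
have im : (i <= m.-1)%N by rewrite -ltnS prednK.
apply: le_trans wr_sum; rewrite (big_cat_nat zi' im) /=.
apply: (@le_trans _ _ (\sum_(z <= j < i) wr j.+1)).
  by rewrite big_nat [leRHS]big_nat; apply: ler_sum => j /h /andP[].
rewrite lerDl big_nat; apply: sumr_ge0 => j /andP[ij jm]; apply: wr_ge0.
by rewrite ltnS (leq_trans zi' ij) /= -(prednK m_gt0) ltnS.
Qed.

End HittingTime.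

End BirthDeath.

(** * Mixing of reversible continuous-time chains *)

Lemma sub_le_complement (R : realFieldType) (a b c p p' u : R) :
  a - p <= u -> b - p' <= u -> c + b = 1 -> p + p' = 1 -> a - c <= 2 * u.
Proof. lra. Qed.

Section GeneratorKernel.
Context {R : realType} {m : nat}.
Variables (Q : 'M[R]_m) (Lam : R).
Hypothesis Q_offdiag : forall i j, i != j -> 0 <= Q i j.
Hypothesis Q_sum : forall i, \sum_j Q i j = 0.
Hypothesis Lam_ge1 : 1 <= Lam.
Hypothesis Q_diag : forall i, - Q i i <= Lam / 2.

Local Notation K := (jump_kernel Q Lam).

Let Lam_gt0 : 0 < Lam. Proof. exact: lt_le_trans Lam_ge1. Qed.

Lemma jump_kernelE i j : K i j = (i == j)%:R + Q i j / Lam.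
Proof. by rewrite /jump_kernel !mxE mulrC. Qed.

Lemma jump_kernel_offdiag i j : i != j -> 0 <= K i j.
Proof. by move=> ij; rewrite jump_kernelE (negbTE ij) add0r divr_ge0 ?Q_offdiag // ltW. Qed.

Lemma jump_kernel_lazy i : 2^-1 <= K i i.
Proof.
rewrite jump_kernelE eqxx -lerBlDl ler_pdivlMr //.
have := Q_diag i; rewrite /=; lra.
Qed.

Lemma jump_kernel_ge0 i j : 0 <= K i j.
Proof.
have [<-|ij] := eqVneq i j; last exact: jump_kernel_offdiag.
by apply: le_trans (jump_kernel_lazy i); rewrite invr_ge0.
Qed.

Lemma jump_kernel_act f i : mx_act K f i = f i + mx_act Q f i / Lam.
Proof.
rewrite -[f i](mx_act1 f) /mx_act mulr_suml -big_split; apply: eq_bigr => j _ /=.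
by rewrite jump_kernelE !mxE; ring.
Qed.

Lemma jump_kernel_sum i : \sum_j K i j = 1.
Proof.
have := jump_kernel_act (fun=> 1) i; rewrite /mx_act.
under eq_bigr do rewrite mulr1; under [in RHS]eq_bigr do rewrite mulr1.
by rewrite Q_sum mul0r addr0.
Qed.

Lemma generator_trans_ge0 t i j : 0 <= t -> 0 <= trans Q t i j.
Proof. exact: (trans_ge0 Lam_gt0 jump_kernel_ge0 jump_kernel_sum). Qed.

Lemma generator_trans_sum t i : 0 <= t -> \sum_j trans Q t i j = 1.
Proof. exact: (trans_sum Lam_gt0 jump_kernel_ge0 jump_kernel_sum). Qed.

Lemma trans_act_sum t f g i : 0 <= t -> (forall j, f j + g j = 1) ->
  mx_act (trans Q t) f i + mx_act (trans Q t) g i = 1.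
Proof.
move=> t0 fg; rewrite -(generator_trans_sum i t0).
rewrite -big_split; apply: eq_bigr => j _ /=.
by rewrite -mulrDr fg mulr1.
Qed.

(** Each jump raises the mean of [f] by at most [B / Lam], and there are
    [Lam * t] jumps on average. *)
Lemma trans_act_drift t f i B : 0 <= t -> f i = 0 ->
  (forall j, mx_act Q f j <= B) -> mx_act (trans Q t) f i <= B * t.
Proof.
move=> t0 fi QB.
have := @trans_fun_le _ _ Q _ Lam_gt0 jump_kernel_ge0 jump_kernel_sum t f i 0 (B / Lam) 0 t0.
rewrite mul0r addr0 add0r (_ : B / Lam * (Lam * t) = B * t); last first.
  by field; rewrite lt0r_neq0.
apply => l; rewrite mul0r addr0 add0r -/(mx_act _ _ _).
rewrite -[leRHS]add0r -{1}fi; elim: l {fi} i => [|l IH] i.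
  by rewrite expr0 mx_act1 mulr0 addr0.
rewrite mx_actS (_ : f i + _ = f i + B / Lam + B / Lam * l%:R); last first.
  by rewrite -natr1; ring.
apply: (@le_trans _ _ (mx_act K (fun j => 1 * f j + (B / Lam * l%:R) * 1) i)).
  by apply: mx_act_le => [|j]; [exact: jump_kernel_ge0|rewrite mul1r mulr1].
rewrite mx_actZD mx_act_cst ?jump_kernel_sum //; last exact: jump_kernel_sum.
rewrite mul1r mulr1 lerD2r jump_kernel_act lerD2l ler_wpM2r ?invr_ge0 //.
exact: ltW.
Qed.

(** The semigroup differs from its linearization by an error quadratic in the
    time, which is absorbed by half of the decrease when the time is small. *)
Lemma trans_act_lyapunov (g : 'I_m -> R) G : (forall i, 0 <= g i <= G) ->
  exists2 h, 0 < h & forall i, mx_act Q g i <= - 1 ->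
    mx_act (trans Q h) g i <= g i - h / 2.
Proof.
move=> gG; pose C := `|G| + 1; pose h := (2 * (C * Lam ^+ 2))^-1.
have C0 : 0 < C by rewrite ltr_wpDl.
have CL0 : 0 < C * Lam ^+ 2 by rewrite mulr_gt0 ?exprn_gt0.
have h0 : 0 < h by rewrite invr_gt0 mulr_gt0.
exists h => // i Qg.
suff H l : \sum_j (K ^+ l) i j * g j
    <= g i + (- Lam^-1) * l%:R + C * (l%:R * (l%:R - 1)).
  apply: le_trans (trans_fun_le Lam_gt0 jump_kernel_ge0 jump_kernel_sum (ltW h0) H) _.
  rewrite le_eqVlt; apply/orP; left; apply/eqP.
  by rewrite /h; field; rewrite !lt0r_neq0.
have L1 : Lam^-1 <= 1 by rewrite invf_le1.
have Li0 : 0 <= Lam^-1 by rewrite invr_ge0 ltW.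
rewrite -/(mx_act _ _ _); case: l => [|[|l]].
- by rewrite expr0 mx_act1 mul0r !mulr0 !addr0.
- rewrite expr1 jump_kernel_act subrr !mulr0 addr0 mulr1 lerD2l.
  by rewrite -mulN1r ler_wpM2r.
have -> : l.+2%:R - 1 = l.+1%:R :> R by rewrite -natr1 addrK.
have : mx_act (K ^+ l.+2) g i <= `|G|.
  rewrite -(mx_act_pow_cst jump_kernel_sum `|G| l.+2 i).
  apply: mx_act_pow_le => [|j]; first exact: jump_kernel_ge0.
  by have /andP[_ gj] := gG j; apply: le_trans gj (ler_norm _).
have /andP[gi _] := gG i.
have l2 : 1 <= l.+2%:R :> R by rewrite ler1n.
have l1 : 1 <= l.+1%:R :> R by rewrite ler1n.
have G0 := normr_ge0 G.
move=> /le_trans; apply; rewrite -[leLHS]add0r -addrA lerD //.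
rewrite /C mulrDl mul1r addrC -addrA -[leLHS]addr0 lerD //.
  by rewrite ler_peMr // -[leLHS]mulr1 ler_pM.
rewrite mulNr subr_ge0 mulrC ler_pM //; exact: le_trans l1.
Qed.

Section Reversible.
Variable pi : 'I_m -> R.
Hypothesis pi_gt0 : forall i, 0 < pi i.
Hypothesis pi_sum : \sum_i pi i = 1.
Hypothesis Q_reversible : forall i j, pi i * Q i j = pi j * Q j i.

Lemma jump_kernel_reversible i j : pi i * K i j = pi j * K j i.
Proof.
rewrite !jump_kernelE !mulrDr !mulrA Q_reversible eq_sym.
by case: eqVneq => [->|]; rewrite ?mulr0.
Qed.

Lemma jump_kernel_pow_reversible l i j : pi i * (K ^+ l) i j = pi j * (K ^+ l) j i.
Proof.
elim: l i j => [|l IH] i j.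
  by rewrite expr0 !mxE eq_sym; case: eqVneq => [->|]; rewrite ?mulr0.
rewrite [in LHS]exprS mxE [in RHS]exprSr mxE !mulr_sumr; apply: eq_bigr => x _.
by rewrite mulrA jump_kernel_reversible mulrAC IH; ring.
Qed.

Lemma trans_reversible t i j : 0 <= t -> pi i * trans Q t i j = pi j * trans Q t j i.
Proof.
move=> t0; have h x y := @trans_poisson _ _ Q _ Lam_gt0 jump_kernel_ge0 jump_kernel_sum t x y t0.
have c x y : (fun N => pi x * series (fun l => poisson (Lam * t) l * (K ^+ l) x y) N) @ \oo
    --> pi x * trans Q t x y by apply: cvgMl_tmp; exact: h.
rewrite -(cvg_lim _ (c i j)) // -(cvg_lim _ (c j i)) //.
congr (limn _); apply/funext => N; rewrite /series /= !mulr_sumr.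
by apply: eq_bigr => l _; rewrite mulrCA jump_kernel_pow_reversible mulrCA.
Qed.

Lemma stationary_stat_dist : stationary Q (stat_dist Q).
Proof.
suff h : stationary Q (\row_i pi i) by apply: (xgetPex 0); exists (\row_i pi i).
split=> [i|| t t0].
- by rewrite mxE ltW.
- by under eq_bigr do rewrite mxE.
apply/rowP => j; rewrite !mxE.
under eq_bigr do rewrite mxE trans_reversible //.
by rewrite -mulr_sumr generator_trans_sum ?mulr1.
Qed.

Lemma set_act (A : {set 'I_m}) (B : 'M[R]_m) i :
  \sum_(y in A) B i y = mx_act B (fun y => (y \in A)%:R) i.
Proof.
rewrite /mx_act big_mkcond; apply: eq_bigr => y _.
by case: ifP => _; rewrite ?mulr1 ?mulr0.
Qed.

Lemma tv_dist_le t e : 0 <= t -> 0 <= e ->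
  (forall (A : {set 'I_m}) x, `|\sum_(y in A) trans Q t x y
      - \sum_(y in A) stat_dist Q 0 y| <= e) -> tv_dist Q t <= e.
Proof.
move=> t0 e0 h; rewrite /tv_dist.
by apply: bigmax_le => // x _; apply: bigmax_le => // A _; exact: h.
Qed.

Lemma le_tv_dist t (A : {set 'I_m}) x :
  `|\sum_(y in A) trans Q t x y - \sum_(y in A) stat_dist Q 0 y| <= tv_dist Q t.
Proof.
rewrite /tv_dist; apply: le_trans (le_bigmax _ _ x).
by apply: le_trans (le_bigmax _ _ A).
Qed.

(** The one-sided bound, for [A] from [x] and for the complement of [A] from [y],
    compares the laws started from [x] and from [y]; any stationary distribution
    is an average of the latter. *)
Lemma tv_dist_mixing t e : 0 <= t ->
  (forall (A : {set 'I_m}) x,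
     mx_act (trans Q t) (fun y => (y \in A)%:R) x
       - inner pi (fun=> 1) (fun y => (y \in A)%:R) <= e) ->
  tv_dist Q t <= 2 * e.
Proof.
move=> t0 h; have [p0 p1 pt] := stationary_stat_dist.
have e0 (x : 'I_m) : 0 <= e.
  apply: le_trans (h finset.set0 x); rewrite /inner /mx_act.
  by rewrite !big1 ?subrr // => j _; rewrite inE ?mulr0.
have diff (A : {set 'I_m}) x y :
    mx_act (trans Q t) (fun y => (y \in A)%:R) x
    - mx_act (trans Q t) (fun y => (y \in A)%:R) y <= 2 * e.
  have hx := h A x; have hy := h (~: A)%SET y.
  have s : mx_act (trans Q t) (fun y => (y \in A)%:R) y
      + mx_act (trans Q t) (fun y => (y \in ~: A)%:R) y = 1.
    by apply: trans_act_sum => // j; rewrite inE; case: (j \in A); rewrite ?addr0 ?add0r.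
  have pA : inner pi (fun=> 1) (fun y => (y \in A)%:R)
      + inner pi (fun=> 1) (fun y => (y \in ~: A)%:R) = 1.
    rewrite /inner -big_split -[RHS]pi_sum; apply: eq_bigr => j _ /=.
    by rewrite !mul1r inE; case: (j \in A); rewrite /= ?mulr1 ?mulr0 ?addr0 ?add0r.
  exact: sub_le_complement hx hy s pA.
have statE (A : {set 'I_m}) : \sum_(y in A) stat_dist Q 0 y
    = \sum_x stat_dist Q 0 x * mx_act (trans Q t) (fun y => (y \in A)%:R) x.
  have -> : \sum_(y in A) stat_dist Q 0 y
     = \sum_(y in A) \sum_x stat_dist Q 0 x * trans Q t x y.
    by apply: eq_bigr => y _; rewrite -{1}(pt t t0) mxE.
  rewrite exchange_big; apply: eq_bigr => x _ /=.
  by rewrite -mulr_sumr set_act.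
have [x0 _|m0] := pickP (fun x : 'I_m => true); last first.
  by move/eqP: p1; rewrite big1 => [|x]; [rewrite eq_sym oner_eq0|have := m0 x].
apply: tv_dist_le => // [|A x]; first by rewrite mulr_ge0 ?(e0 x0).
rewrite set_act statE ler_norml.
set F := mx_act _ _.
have lb c : (forall y, F y <= c) -> \sum_y stat_dist Q 0 y * F y <= c.
  move=> hc; rewrite -[c]mul1r -p1 mulr_suml; apply: ler_sum => y _.
  by rewrite ler_wpM2l.
have ub c : (forall y, c <= F y) -> c <= \sum_y stat_dist Q 0 y * F y.
  move=> hc; rewrite -[c]mul1r -p1 mulr_suml; apply: ler_sum => y _.
  by rewrite ler_wpM2l.
apply/andP; split.
  by rewrite lerBrDr addrC lerBlDr; apply: lb => y; rewrite -lerBlDl; exact: diff.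
by rewrite lerBlDr -lerBlDl; apply: ub => y; rewrite lerBlDl -lerBlDr; exact: diff.
Qed.

(** With [T = Lam * H], the discrete estimate [act_pow_le] at precision
    [eps = 1 / 32] needs [T / eps ^ 2 = 1024 T] steps from [z] and
    [4 T / eps = 128 T] steps to reach it; after a time [4000 * H] the mean number
    of jumps [4000 T] is more than twice their sum. *)
Lemma tv_dist_hitting z g H t : 1 <= H ->
  (forall i, mx_act Q g i = (i == z)%:R / pi z - 1) ->
  (forall i, 0 <= g i - g z <= H) -> 4000 * H <= t -> tv_dist Q t <= 4^-1.
Proof.
move=> H1 Qg gH Ht.
have H0 : 0 < H by exact: lt_le_trans H1.
have t0 : 0 < t by apply: lt_le_trans Ht; rewrite mulr_gt0 ?ltr0n.
have -> : (4^-1 : R) = 2 * (1 / 8) by field.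
apply: tv_dist_mixing => [|A x]; first exact: ltW.
set f := fun y => _; pose c := inner pi (fun=> 1) f.
have f01 i : 0 <= f i <= 1 by rewrite /f ler0n lern1 leq_b1.
pose T := Lam * H.
have T1 : 1 <= T by rewrite -[leLHS]mulr1 ler_pM.
have T0 : 0 < T by exact: lt_le_trans T1.
pose eps : R := 1 / 32.
have e0 : 0 <= eps by rewrite divr_ge0 ?ler01 ?ler0n.
pose L := Num.truncn (1024 * T); pose J := (Num.truncn (128 * T)).+1.
have hL : T <= eps ^+ 2 * L.+1%:R.
  have : 1024 * T < L.+1%:R by exact: truncnS_gt.
  rewrite /eps; lra.
have hJ : 4 * T <= eps * J%:R.
  have : 128 * T < J%:R by exact: truncnS_gt.
  rewrite /eps; lra.
have LJ : 2 * (L + J)%:R <= Lam * t.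
  have hl : L%:R <= 1024 * T by rewrite truncn_le mulr_ge0 ?ler0n ?(ltW T0).
  have hj : J%:R <= 128 * T + 1.
    rewrite (_ : J%:R = (Num.truncn (128 * T))%:R + 1); last by rewrite natr1.
    by rewrite lerD2r truncn_le mulr_ge0 ?ler0n ?(ltW T0).
  have : Lam * (4000 * H) <= Lam * t by rewrite ler_wpM2l ?(ltW Lam_gt0).
  rewrite natrD mulrCA -/T; lra.
have gp i : mx_act K g i = g i + ((i == z)%:R / pi z - 1) / Lam.
  by rewrite jump_kernel_act Qg.
have bound l : (L + J <= l)%N -> mx_act (K ^+ l) f x - c <= 2 * eps.
  move=> hl; have -> : l = (L + (l - L))%N.
    by rewrite subnKC // (leq_trans (leq_addr _ _) hl).
  apply: (act_pow_le jump_kernel_sum pi_gt0 pi_sum jump_kernel_reversible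
    jump_kernel_offdiag jump_kernel_lazy Lam_gt0 H0 gp gH x f01 e0 T1 hL).
  apply: le_trans hJ _; rewrite ler_wpM2l // ler_nat.
  by rewrite leq_subRL ?(leq_trans (leq_addr _ _) hl).
have c0 : 0 <= c.
  apply: sumr_ge0 => i _; rewrite mul1r mulr_ge0 ?(ltW (pi_gt0 i)) //.
have pow1 l : mx_act (K ^+ l) f x <= 1.
  rewrite -(mx_act_pow_cst jump_kernel_sum 1 l x); apply: mx_act_pow_le => [|j].
    exact: jump_kernel_ge0.
  by case/andP: (f01 j).
have := @trans_fun_tail _ _ Q _ Lam_gt0 jump_kernel_ge0 jump_kernel_sum t f x
  (c + 2 * eps) (L + J) t0 _ _ LJ.
rewrite -!/(mx_act _ _ _) => tail.
have {tail} : mx_act (trans Q t) f x <= c + 2 * eps + 4 / (Lam * t).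
  apply: tail => l; rewrite -/(mx_act _ _ _).
    have := pow1 l; rewrite /eps; lra.
  by move=> /bound; lra.
have : 4 / (Lam * t) <= eps.
  have LT : 4000 * T <= Lam * t by rewrite /T mulrCA ler_wpM2l ?(ltW Lam_gt0).
  have Lt0 : 0 < Lam * t by rewrite mulr_gt0.
  rewrite ler_pdivrMr // /eps; lra.
rewrite -/c /eps; lra.
Qed.

(** Let [t] be so small that the means of [fx] and [fy] under the laws started
    from [x] and [y] are still small. By Markov's inequality, these laws hardly
    charge the sets where [fx] and [fy] are at least [1 / 2]; these two sets cover
    the whole space, so no distribution can be close to both laws. *)
Lemma tv_dist_two_starts x y (fx fy : 'I_m -> R) B t : 0 <= t ->
  fx x = 0 -> fy y = 0 -> (forall i, 0 <= fx i) -> (forall i, 0 <= fy i) ->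
  (forall i, mx_act Q fx i <= B) -> (forall i, mx_act Q fy i <= B) ->
  (forall i, 2^-1 <= fx i \/ 2^-1 <= fy i) ->
  tv_dist Q t <= 4^-1 -> 8^-1 <= B * t.
Proof.
move=> t0 fx0 fy0 px py Qx Qy cover tv.
have [p0 p1 pt] := stationary_stat_dist.
have esc f u : f u = 0 -> (forall i, 0 <= f i) -> (forall i, mx_act Q f i <= B) ->
    \sum_(i in [set i | 2^-1 <= f i]%SET) stat_dist Q 0 i <= 4^-1 + 2 * (B * t).
  move=> fu pf Qf; set A := [set i | _]%SET.
  have : mx_act (trans Q t) (fun i => (i \in A)%:R) u <= 2 * (B * t).
    apply: (@le_trans _ _ (2 * mx_act (trans Q t) f u)).
      rewrite /mx_act mulr_sumr; apply: ler_sum => i _; rewrite mulrCA ler_wpM2l //.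
        exact: generator_trans_ge0.
      rewrite inE; case: (leP 2^-1 (f i)) => fi /=; last by rewrite mulr_ge0.
      lra.
    by rewrite ler_wpM2l // trans_act_drift.
  have := le_trans (le_tv_dist t A u) tv; rewrite set_act ler_norml => /andP[a b].
  lra.
have hx := esc fx x fx0 px Qx; have hy := esc fy y fy0 py Qy.
have : 1 <= \sum_(i in [set i | 2^-1 <= fx i]%SET) stat_dist Q 0 i
     + \sum_(i in [set i | 2^-1 <= fy i]%SET) stat_dist Q 0 i.
  rewrite big_mkcond [X in _ + X]big_mkcond -big_split /= -[leLHS]p1.
  apply: ler_sum => i _ /=; rewrite !inE; have := p0 i.
  by case: (cover i) => -> p; [rewrite lerDl|rewrite lerDr]; case: ifP.
lra.
Qed.

End Reversible.

End GeneratorKernel.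

(** * Expected entrance times *)

Section MeanHittingTime.
Context {R : realType} {m : nat}.
Variables (Q : 'M[R]_m) (st : 'I_m -> R) (x : R).
Context d (T : measurableType d) (P : probability T R) (X : R -> T -> R).
Hypothesis chain : chain_from Q st x P X.
Local Open Scope ereal_scope.

(** The integral of a nonnegative function is a supremum over simple functions.
    This form applies to the entrance time, an infimum over uncountably many
    times whose measurability is unclear. *)
Lemma le_integral_pointwise (f g : T -> \bar R) :
  (forall w, 0 <= f w) -> (forall w, f w <= g w) ->
  \int[P]_w f w <= \int[P]_w g w.
Proof.
move=> f0 fg; have g0 w : 0 <= g w by exact: le_trans (fg w).
rewrite !ge0_integralTE //; apply: ereal_sup_le => _ [h /= hf <-].
by exists h => // w; exact: le_trans (fg w).
Qed.

Lemma measure_cover_le (I : eqType) (s : seq I) (E : I -> set T) (F : set T) :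
  (forall i, measurable (E i)) -> measurable F ->
  (forall w, F w -> exists2 i, i \in s & E i w) ->
  P F <= \sum_(i <- s) P (E i).
Proof.
move=> mE mF cov.
apply: (@le_trans _ _ (P (\big[setU/set0]_(i <- s) E i))).
  apply: le_measure; rewrite ?inE //; first exact: bigsetU_measurable.
  move=> w /cov[i si Ew]; elim: s si {cov} => //= j s IH; rewrite in_cons.
  move=> /orP[/eqP ij|si]; rewrite big_cons; first by left; rewrite -ij.
  by right; exact: IH.
elim: s {cov} => [|i s IH]; first by rewrite !big_nil measure0.
rewrite !big_cons; apply: le_trans (leeD2l _ IH).
by apply: measureU2 => //; exact: bigsetU_measurable.
Qed.

Definition state_event (t y : R) : set T := [set w | X t w = y].

Lemma measurable_state_event t y : (0 <= t)%R -> measurable (state_event t y).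
Proof.
case: chain => mX _ _ _ _ t0.
by rewrite -[X in measurable X]setTI; exact: (mX t t0 measurableT [set y]).
Qed.

Definition history_event (h : seq (R * R)) : set T :=
  [set w | forall p, p \in h -> X p.1 w = p.2].

Lemma measurable_history_event h :
  (forall p, p \in h -> (0 <= p.1)%R) -> measurable (history_event h).
Proof.
elim: h => [|p h IH] h0.
  by rewrite (_ : history_event _ = setT) //; apply/seteqP; split.
have -> : history_event (p :: h) = state_event p.1 p.2 `&` history_event h.
  apply/seteqP; split => [w hw|w [e hw] p'].
    split; first by apply: hw; rewrite mem_head.
    by move=> p' ph; apply: hw; rewrite inE ph orbT.
  by rewrite inE => /orP[/eqP ->|/hw].
apply: measurableI; first by apply: measurable_state_event; apply: h0; rewrite mem_head.
by apply: IH => p' ph; apply: h0; rewrite inE ph orbT.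
Qed.

Variable B : set R.

(** Looking at the process only at the times [s], [s + h], [s + 2 h] and so on can
    only postpone its entrance in [B], and makes the law of the entrance time a
    matter of finite-dimensional distributions. *)
Definition avoid_event (s h : R) (j : nat) : set T :=
  [set w | forall l, (l <= j)%N -> ~ B (X (s + l%:R * h) w)].

Lemma measurable_avoid_event s h j : (0 <= s)%R -> (0 <= h)%R ->
  measurable (avoid_event s h j).
Proof.
move=> s0 h0.
have mB t : (0 <= t)%R -> measurable [set w | ~ B (X t w)].
  move=> t0; have [_ Xst _ _ _] := chain.
  have -> : [set w | ~ B (X t w)]
     = \bigcup_(i in [set i | ~ B (st i)]) state_event t (st i).
    apply/seteqP; split => [w /= nB|w [i /= nB e]]; last by rewrite e.
    by have [i Xi] := Xst t w t0; exists i; rewrite //= -Xi.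
  apply: fin_bigcup_measurable => [|i _]; first exact: finite_finset.
  exact: measurable_state_event.
elim: j => [|j IH].
  have -> : avoid_event s h 0 = [set w | ~ B (X s w)].
    apply/seteqP; split => w /= H; first by have := H 0%N isT; rewrite mul0r addr0.
    by move=> l; rewrite leqn0 => /eqP ->; rewrite mul0r addr0.
  exact: mB.
have -> : avoid_event s h j.+1
   = avoid_event s h j `&` [set w | ~ B (X (s + j.+1%:R * h) w)].
  apply/seteqP; split => w /= H.
    by split=> [l lj|]; [apply: H; exact: leqW|exact: H].
  by move=> l; rewrite leq_eqVlt ltnS => /orP[/eqP ->|]; [exact: H.2|exact: H.1].
by apply: measurableI => //; apply: mB; rewrite addr_ge0 // mulr_ge0.
Qed.

Variables (g : 'I_m -> R) (h : R).
Hypothesis h_gt0 : (0 < h)%R.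
Hypothesis g_ge0 : forall i, (0 <= g i)%R.
Hypothesis g_drift :
  forall i, ~ B (st i) -> (mx_act (trans Q h) g i <= g i - h / 2)%R.

(** Each step outside [B] costs [h / 2] in the mean of the nonnegative function
    [g]. The induction on the number of steps moves the present state into the
    history, hence a statement for an arbitrary past. *)
Lemma sampled_avoid_le J (hist : seq (R * R)) (s : R) (i : 'I_m) :
  (0 <= s)%R -> (forall p, p \in hist -> (0 <= p.1 <= s)%R) ->
  forall past, past = history_event hist `&` state_event s (st i) ->
  \sum_(0 <= j < J) (h / 2)%:E * P (past `&` avoid_event s h j) <= P past * (g i)%:E.
Proof.
have [_ Xst _ _ markov] := chain.
elim: J hist s i => [|J IH] hist s i s0 hs past pastE.
  by rewrite big_nil mule_ge0 // lee_fin.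
have sh0 : (0 <= s + h)%R by rewrite addr_ge0 // ltW.
have m1 : measurable past.
  rewrite pastE; apply: measurableI; last exact: measurable_state_event.
  by apply: measurable_history_event => p /hs /andP[].
have [Bi|nBi] := pselect (B (st i)).
  rewrite big1 ?mule_ge0 ?lee_fin // => j _.
  rewrite (_ : past `&` _ = set0) ?measure0 ?mule0 //.
  rewrite pastE; apply/seteqP; split => w //= [[_ Xs]] /(_ 0%N isT).
  by rewrite mul0r addr0 Xs; exact.
pose hist' := (s, st i) :: hist.
pose past' i' := history_event hist' `&` state_event (s + h) (st i').
have hs' p : p \in hist' -> (0 <= p.1 <= s + h)%R.
  rewrite inE => /orP[/eqP ->|/hs /andP[a b]] /=; first by rewrite s0 lerDl ltW.
  by rewrite a (le_trans b) // lerDl ltW.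
have m2 i' : measurable (past' i').
  apply: measurableI; last exact: measurable_state_event.
  by apply: measurable_history_event => p /hs' /andP[].
have histE : history_event hist' = past.
  rewrite pastE; apply/seteqP; split => [w hw|w [hw e] p].
    split; last by apply: (hw (s, st i)); rewrite mem_head.
    by move=> p ph; apply: hw; rewrite inE ph orbT.
  by rewrite inE => /orP[/eqP ->|/hw].
have Ppast' i' : P (past' i') = P past * (trans Q h i i')%:E.
  have := markov hist s (s + h)%R i i' hs s0; rewrite lerDl (ltW h_gt0) => /(_ isT).
  by rewrite addrAC subrr add0r /past' histE pastE.
have step j : P (past `&` avoid_event s h j.+1)
    <= \sum_(i' <- index_enum 'I_m) P (past' i' `&` avoid_event (s + h) h j).
  apply: measure_cover_le => [i'||w [pw aw]].
  - by apply: measurableI => //; apply: measurable_avoid_event => //; exact: ltW.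
  - by apply: measurableI => //; apply: measurable_avoid_event => //; exact: ltW.
  have [i' Xi'] := Xst (s + h)%R w sh0; exists i'; first exact: mem_index_enum.
  split; first by rewrite /past' histE.
  move=> l lj; have := aw l.+1; rewrite ltnS => /(_ lj).
  by rewrite -natr1 mulrDl mul1r [(_ * h + h)%R]addrC addrA.
rewrite big_nat_recl //=.
apply: (@le_trans _ _ ((h / 2)%:E * P past
   + \sum_(i' <- index_enum 'I_m) P (past' i') * (g i')%:E)).
  apply: leeD.
    rewrite lee_pmul2l // ?lte_fin ?divr_gt0 //.
    apply: le_measure; rewrite ?inE //.
    by apply: measurableI => //; apply: measurable_avoid_event => //; exact: ltW.
  apply: (@le_trans _ _ (\sum_(0 <= j < J) \sum_(i' <- index_enum 'I_m)
      (h / 2)%:E * P (past' i' `&` avoid_event (s + h) h j))).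
    apply: lee_sum => j _; rewrite -ge0_sume_distrr; last by [].
    by rewrite lee_pmul2l // ?lte_fin ?divr_gt0.
  rewrite exchange_big /=; apply: lee_sum => i' _.
  exact: (IH hist' (s + h)%R i' sh0 hs' _ erefl).
have -> : \sum_(i' <- index_enum 'I_m) P (past' i') * (g i')%:E
    = P past * (mx_act (trans Q h) g i)%:E.
  have Pf : P past \is a fin_num by exact: fin_num_measure.
  rewrite -(fineK Pf) /mx_act -EFinM mulr_sumr -sumEFin; apply: eq_bigr => i' _.
  by rewrite Ppast' -(fineK Pf) -!EFinM mulrA.
have Pf : P past \is a fin_num by exact: fin_num_measure.
rewrite -(fineK Pf) -!EFinM -EFinD lee_fin.
have p0 : (0 <= fine (P past))%R by apply: fine_ge0.
have := ler_wpM2l p0 (g_drift nBi); rewrite mulrBr; lra.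
Qed.

(** The entrance time is at most [h] times the number of sampling times before the
    sampled process is in [B]. *)
Lemma mean_T_enter_le (i0 : 'I_m) : x = st i0 -> mean_T_enter P X B <= (2 * g i0)%:E.
Proof.
move=> xi0; have [mX Xst _ [_ P0] _] := chain.
pose E j := avoid_event 0 h j.
have mE j : measurable (E j) by apply: measurable_avoid_event => //; exact: ltW.
pose F w := \sum_(0 <= j <oo) (h * \1_(E j) w)%:E.
have hE0 j w : 0 <= (h * \1_(E j) w)%:E by rewrite lee_fin mulr_ge0 // ltW.
have TF w : T_enter X B w <= F w.
  have part J : (forall j, (j < J)%N -> E j w) -> (J%:R * h)%:E <= F w.
    move=> EJ; apply: le_trans (nneseries_lim_ge J _) => //.
    rewrite (eq_big_nat _ _ (F2 := fun=> h%:E)) => [|j /andP[_ jJ]]; last first.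
      by rewrite indicE mem_set ?mulr1 //; exact: EJ.
    by rewrite sumEFin big_mkord sumr_const card_ord mulr_natl.
  have [ex'|none] := pselect (exists j, ~ E j w); last first.
    have all J : (J%:R * h)%:E <= F w.
      by apply: part => j _; apply: contrapT => nE; apply: none; exists j.
    case: (F w) all => [r all||all]; [|by rewrite leey|].
      have := all (Num.truncn (r / h)).+1; rewrite lee_fin leNgt.
      by rewrite -ltr_pdivrMr // truncnS_gt.
    by have := all 0%N.
  have ex : exists j, `[< ~ E j w >].
    by have [j jB] := ex'; exists j; exact/asboolP.
  case: (ex_minnP ex) => J /asboolP nEJ minJ.
  have EJ j : (j < J)%N -> E j w.
    move=> jJ; apply: contrapT => nE; have := minJ j (introT (asboolP _) nE).
    by rewrite leqNgt jJ.
  apply: le_trans (part J EJ).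
  have [l lJ Bl] : exists2 l, (l <= J)%N & B (X (0 + l%:R * h) w).
    apply: contrapT => nB; apply: nEJ => l lJ Bl; apply: nB; by exists l.
  apply: (@le_trans _ _ (l%:R * h)%:E).
    apply: ereal_inf_lbound; exists (l%:R * h)%R => //; split.
      by rewrite mulr_ge0 // ltW.
    by rewrite add0r in Bl.
  by rewrite lee_fin ler_pM2r // ler_nat.
have T0 w : 0 <= T_enter X B w.
  by apply: le_ereal_inf_tmp => _ [t [t0 _] <-]; rewrite lee_fin.
apply: le_trans (le_integral_pointwise T0 TF) _.
rewrite integral_nneseries //; last first.
  by move=> j; apply/measurable_EFinP; apply: measurable_funM.
have intE j : \int[P]_w (h * \1_(E j) w)%:E = h%:E * P (E j).
  under eq_integral do rewrite EFinM.
  rewrite ge0_integralZl_EFin ?(ltW h_gt0) //.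
    by rewrite integral_indic // setIT.
  apply/measurable_EFinP; exact: measurable_indic.
under eq_eseriesr do rewrite intE.
apply: lime_le.
  by apply: is_cvg_nneseries => j _ _; rewrite mule_ge0 ?lee_fin ?(ltW h_gt0).
apply: nearW => J.
have hist0 p : p \in ([::] : seq (R * R)) -> (0 <= p.1 <= 0)%R by [].
have := @sampled_avoid_le J [::] 0%R i0 (lexx 0%R) hist0 _ erefl.
set past := _ `&` _ => H.
have pastE : past = state_event 0 x.
  by rewrite /past xi0; apply/seteqP; split => [w []|w].
have mp : measurable (state_event 0 x) by exact: measurable_state_event.
have full j : P (E j) = P (past `&` E j).
  rewrite pastE; apply/eqP; rewrite eq_le; apply/andP; split; last first.
    by apply: le_measure; rewrite ?inE //; exact: measurableI.
  have PC : P (~` state_event 0 x) = 0.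
    by rewrite probability_setC // P0 subee.
  apply: (@le_trans _ _ (P ((state_event 0 x `&` E j) `|` ~` state_event 0 x))).
    apply: le_measure; rewrite ?inE //.
      by apply: measurableU; [exact: measurableI|exact: measurableC].
    by move=> w Ew; have [?|?] := pselect (state_event 0 x w); [left|right].
  apply: le_trans (measureU2 _ _ _) _; first exact: measurableI.
    exact: measurableC.
  by rewrite [X in _ + X]PC adde0.
move: H; rewrite {2}pastE P0 mul1e => H.
rewrite (eq_bigr (fun j => 2%:E * ((h / 2)%:E * P (past `&` E j)))); last first.
  by move=> j _; rewrite full muleA -EFinM; congr (_%:E * _); field.
rewrite -ge0_sume_distrr; last by move=> j _; rewrite mule_ge0 // lee_fin divr_ge0 ?(ltW h_gt0).
by rewrite [leRHS]EFinM lee_pmul2l // lte_fin.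
Qed.

End MeanHittingTime.

(** * A barrier for the drift *)

Section Barrier.
Context {R : realFieldType}.
Implicit Types (h s v w x c b : R).

Definition inv_quadratic s v : R := (s ^+ 2 + v ^+ 2)^-1.

Lemma inv_quadratic_gt0 s v : 0 < s -> 0 < inv_quadratic s v.
Proof. by move=> s0; rewrite invr_gt0 ltr_wpDr ?sqr_ge0 ?exprn_gt0. Qed.

(** An antiderivative of [(s + `|v|) ^- 2], bounded by [1 / s]. *)
Definition capped_inverse s v : R := v / (s * (s + `|v|)).

Lemma capped_inverse_le s v : 0 < s -> `|capped_inverse s v| <= s^-1.
Proof.
move=> s0; have sv : 0 < s + `|v| by rewrite ltr_pwDl.
rewrite normrM normfV (gtr0_norm (mulr_gt0 s0 sv)) invfM mulrCA.
by rewrite ler_piMr ?invr_ge0 ?(ltW s0) // ler_pdivrMr // mul1r lerDr ltW.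
Qed.

Lemma capped_inverse_step s h v : 0 < h -> h <= s ->
  h * inv_quadratic s v <= 4 * (capped_inverse s v - capped_inverse s (v - h)).
Proof.
move=> h0 hs; have s0 : 0 < s by exact: lt_le_trans hs.
have q0 : 0 < s ^+ 2 + v ^+ 2 by rewrite ltr_wpDr ?sqr_ge0 ?exprn_gt0.
rewrite /inv_quadratic /capped_inverse ler_pdivrMr //.
have [v0|v0] := leP v 0.
  have vh : v - h <= 0 by lra.
  rewrite (ler0_norm v0) (ler0_norm vh).
  have d1 : 0 < s - v by lra.
  have d2 : 0 < s - v + h by lra.
  have -> : v / (s * (s + - v)) - (v - h) / (s * (s + - (v - h)))
     = h / ((s - v) * (s - v + h)).
    by field; rewrite !lt0r_neq0 //; lra.
  rewrite mulrAC mulrA ler_pdivlMr ?mulr_gt0 //.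
  have : (s - v) * (s - v + h) <= 4 * (s ^+ 2 + v ^+ 2).
    have : (s - v) * h <= (s - v) * s by rewrite ler_wpM2l // ltW.
    by have := (sqr_ge0 (s + v), sqr_ge0 (s - v), sqr_ge0 s, sqr_ge0 v); case=> [[[]]]; lra.
  by move=> H; rewrite [leRHS]mulrC ler_wpM2l ?(ltW h0).
have [vh|vh] := leP 0 (v - h).
  rewrite (gtr0_norm v0) (ger0_norm vh).
  have d1 : 0 < s + v by lra.
  have d2 : 0 < s + v - h by lra.
  have -> : v / (s * (s + v)) - (v - h) / (s * (s + (v - h)))
     = h / ((s + v) * (s + v - h)).
    by field; rewrite !lt0r_neq0 //; lra.
  rewrite mulrAC mulrA ler_pdivlMr ?mulr_gt0 //.
  have : (s + v) * (s + v - h) <= 4 * (s ^+ 2 + v ^+ 2).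
    have : 0 <= (s + v) * h by rewrite mulr_ge0 // ltW.
    by have := (sqr_ge0 (s + v), sqr_ge0 (s - v), sqr_ge0 s, sqr_ge0 v); case=> [[[]]]; lra.
  by move=> H; rewrite [leRHS]mulrC ler_wpM2l ?(ltW h0).
rewrite (gtr0_norm v0) (ltr0_norm vh).
have d1 : 0 < s + v by lra.
have d2 : 0 < s - (v - h) by lra.
have f1 : v / (2 * s ^+ 2) <= v / (s * (s + v)).
  rewrite ler_wpM2l ?(ltW v0) // lef_pV2 ?posrE ?mulr_gt0 ?exprn_gt0 //.
  by rewrite expr2 mulrCA ler_wpM2l ?(ltW s0) //; lra.
have f2 : (h - v) / (2 * s ^+ 2) <= - ((v - h) / (s * (s + - (v - h)))).
  have hv0 : 0 <= h - v by lra.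
  have d3 : 0 < s + (h - v) by lra.
  rewrite -mulNr opprB (ler_wpM2l hv0) // lef_pV2 ?posrE ?mulr_gt0 ?exprn_gt0 //.
  by rewrite expr2 mulrCA ler_wpM2l ?(ltW s0) //; lra.
have f3 : h / (2 * s ^+ 2) <= v / (s * (s + v)) - (v - h) / (s * (s + - (v - h))).
  by apply: le_trans (lerD f1 f2); rewrite -mulrDl addrC subrK.
apply: (@le_trans _ _ (4 * (h / (2 * s ^+ 2)) * (s ^+ 2 + v ^+ 2))).
  have -> : 4 * (h / (2 * s ^+ 2)) * (s ^+ 2 + v ^+ 2)
     = 2 * h * ((s ^+ 2 + v ^+ 2) / s ^+ 2) by field; rewrite lt0r_neq0.
  have : 1 <= (s ^+ 2 + v ^+ 2) / s ^+ 2.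
    by rewrite ler_pdivlMr ?exprn_gt0 // mul1r lerDl sqr_ge0.
  by nra.
by rewrite ler_wpM2r ?(ltW q0) // ler_wpM2l.
Qed.

(** A Riemann sum of a function whose integral over the line is of order
    [1 / s]. *)
Lemma sum_inv_quadratic_le s h a N : 0 < h -> h <= s ->
  \sum_(0 <= j < N) h * inv_quadratic s (a + j%:R * h) <= 8 / s.
Proof.
move=> h0 hs; have s0 : 0 < s by exact: lt_le_trans hs.
pose u j : R := 4 * capped_inverse s (a + j%:R * h - h).
apply: (@le_trans _ _ (\sum_(0 <= j < N) (u j.+1 - u j))).
  apply: ler_sum => j _; rewrite -mulrBr.
  have -> : a + j.+1%:R * h - h = a + j%:R * h by rewrite -natr1; ring.
  exact: capped_inverse_step.
rewrite telescope_sumr //.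
have b v : `|4 * capped_inverse s v| <= 4 / s.
  by rewrite normrM ger0_norm // ler_wpM2l // capped_inverse_le.
have -> : 8 / s = 4 / s + 4 / s by field; rewrite lt0r_neq0.
by apply: le_trans (ler_norm _) (le_trans (ler_normB _ _) (lerD (b _) (b _))).
Qed.

(** In the variable rescaled by the critical length, the drift near a double
    root is [c (v + b) ^ 2] and the noise contributes [- 2 P v / (1 + v ^ 2)];
    the shift [b] makes them add up to something positive: the noise helps for
    [v < 0], and the drift is already large for [v >= 0]. *)
Lemma shifted_profile c P0 : 0 < c -> 0 < P0 ->
  exists b kap : R, [/\ 0 <= b, 0 < kap &
    forall v P, P0 <= P <= 1 ->
      kap * (1 + v ^+ 2) ^+ 2 <= c * (v + b) ^+ 2 * (1 + v ^+ 2) - 2 * P * v].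
Proof.
move=> c0 P00; pose b := c^-1 + 2; pose q := (1 + 4 * b ^+ 2) ^+ 2.
have b2 : 2 <= b by rewrite lerDr invr_ge0 ltW.
have cb : 1 + 2 * c <= c * b ^+ 2.
  have e : c * b = 1 + 2 * c by rewrite /b; field; rewrite lt0r_neq0.
  by rewrite -e expr2 mulrA ler_peMr ?mulr_ge0 ?(ltW c0) //; lra.
have q0 : 0 < q by rewrite exprn_gt0 // ltr_wpDr // mulr_ge0 ?sqr_ge0.
pose kap := Num.min (c / 8) (P0 / q).
have k0 : 0 < kap by rewrite lt_min !divr_gt0.
have kc : kap <= c / 8 by rewrite ge_min lexx.
have kP : kap * q <= P0 by rewrite -ler_pdivlMr // ge_min lexx orbT.
exists b, kap; split=> //; first lra.
move=> v P /andP[PP0 P1].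
have v1 : 1 <= 1 + v ^+ 2 by rewrite lerDl sqr_ge0.
have [v0|v0] := leP 0 v.
  apply: (@le_trans _ _ (c * (1 + v ^+ 2) ^+ 2)).
    by rewrite ler_wpM2r ?sqr_ge0 //; lra.
  have h1 : 2 * P * v <= 1 + v ^+ 2.
    apply: (@le_trans _ _ (2 * v)); last by have := sqr_ge0 (v - 1); rewrite sqrrB1; lra.
    by rewrite ler_wpM2r // -[leRHS]mulr1 ler_wpM2l.
  have h2 : c * (1 + v ^+ 2) + 1 <= c * (v + b) ^+ 2.
    have : 0 <= c * (v * b) by rewrite !mulr_ge0 ?(ltW c0) //; lra.
    rewrite sqrrD; lra.
  have : (c * (1 + v ^+ 2) + 1) * (1 + v ^+ 2) <= c * (v + b) ^+ 2 * (1 + v ^+ 2).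
    by rewrite ler_wpM2r //; lra.
  rewrite expr2; lra.
have Pv : 0 <= - (P * v) by rewrite -mulrN mulr_ge0 //; lra.
have kap8 : kap * (1 + v ^+ 2) ^+ 2 <= c / 8 * (1 + v ^+ 2) ^+ 2.
  by rewrite ler_wpM2r ?sqr_ge0.
have [va|va] := leP (- v) 2^-1.
  have h1 : 1 <= (v + b) ^+ 2 by rewrite -[leLHS](expr1n _ 2) ler_pXn2r ?nnegrE //; lra.
  have h2 : v ^+ 2 <= 1 by rewrite -sqrrN -(expr1n _ 2) ler_pXn2r ?nnegrE //; lra.
  have h3 : c * (1 + v ^+ 2) <= c * (v + b) ^+ 2 * (1 + v ^+ 2).
    by rewrite ler_wpM2r //; [lra | rewrite ler_peMr // ltW].
  have h4 : (1 + v ^+ 2) ^+ 2 <= 2 * (1 + v ^+ 2).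
    by rewrite expr2 ler_wpM2r //; lra.
  have : c / 8 * (1 + v ^+ 2) ^+ 2 <= c / 8 * (2 * (1 + v ^+ 2)).
    by rewrite ler_wpM2l // divr_ge0 // ltW.
  have : 0 <= c * (1 + v ^+ 2) by rewrite mulr_ge0 ?(ltW c0) //; lra.
  lra.
have [vb|vb] := leP (- v) (2 * b).
  have h2 : v ^+ 2 <= 4 * b ^+ 2.
    have -> : 4 * b ^+ 2 = (2 * b) ^+ 2 by ring.
    by rewrite -sqrrN ler_pXn2r ?nnegrE //; lra.
  have h3 : (1 + v ^+ 2) ^+ 2 <= q by rewrite ler_pXn2r ?nnegrE //; lra.
  have h4 : kap * (1 + v ^+ 2) ^+ 2 <= P0.
    by apply: le_trans kP; rewrite ler_wpM2l // ltW.
  have h5 : 0 <= c * (v + b) ^+ 2 * (1 + v ^+ 2).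
    by rewrite mulr_ge0 ?(le_trans ler01 v1) // mulr_ge0 ?sqr_ge0 ?(ltW c0).
  have : P0 * 2^-1 <= P * - v by apply: ler_pM; rewrite ?invr_ge0 ?(ltW P00) ?(ltW va).
  lra.
have h1 : v ^+ 2 / 4 <= (v + b) ^+ 2.
  have -> : v ^+ 2 / 4 = (- v / 2) ^+ 2 by field.
  by rewrite -[(v + b) ^+ 2]sqrrN ler_pXn2r ?nnegrE //; lra.
have h2 : 1 <= v ^+ 2 by rewrite -sqrrN -[leLHS](expr1n _ 2) ler_pXn2r ?nnegrE //; lra.
have h3 : (1 + v ^+ 2) / 8 <= (v + b) ^+ 2 by lra.
have : c * ((1 + v ^+ 2) / 8) * (1 + v ^+ 2) <= c * (v + b) ^+ 2 * (1 + v ^+ 2).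
  by rewrite ler_wpM2r ?ler_wpM2l ?(ltW c0) //; lra.
have := expr2 (1 + v ^+ 2); nra.
Qed.

(** A bump of width [s1] next to the double root [r2], for the passage through it,
    plus the reciprocal of the drift near the root [r] of order [m], capped at the
    distance [s]. *)
Definition barrier m r p s1 s x : R :=
  inv_quadratic s1 (x - p) + (r - x + s) ^- m.

Lemma inv_quadratic_diff s h v : 0 < s ->
  inv_quadratic s v - inv_quadratic s (v - h)
  = - (inv_quadratic s (v - h) * (h * (2 * v - h) * inv_quadratic s v)).
Proof.
move=> s0; have q w : s ^+ 2 + w ^+ 2 != 0.
  by rewrite lt0r_neq0 // ltr_wpDr ?sqr_ge0 ?exprn_gt0.
by rewrite /inv_quadratic; field; rewrite !q.
Qed.

(** [shifted_profile] in the rescaled variable [(x - p) / s]. *)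
Lemma bump_near c P0 L b kap s D P x r2 h p :
  (forall v P, P0 <= P <= 1 ->
      kap * (1 + v ^+ 2) ^+ 2 <= c * (v + b) ^+ 2 * (1 + v ^+ 2) - 2 * P * v) ->
  0 < s -> s <= 1 -> 0 < kap -> 0 <= P0 -> L * s <= kap / 2 -> P0 <= P <= 1 ->
  c * (x - r2) ^+ 2 - L * s ^+ 3 <= D ->
  h = s ^+ 3 -> p = r2 + b * s ->
  kap / 6 <= D * inv_quadratic s (x - h - p)
             + P * (inv_quadratic s (x - p) - inv_quadratic s (x - h - p)).
Proof.
move=> prof s0 s1 k0 P00 Ls PP Dge hE pE.
have h0 : 0 < h by rewrite hE exprn_gt0.
have hs : h <= s by rewrite hE -[leRHS]expr1 ler_wiXn2l // ltW.
have P1 : 0 <= P by have /andP[a _] := PP; exact: le_trans a.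
have -> : x - h - p = (x - p) - h by ring.
move vE : (x - p) => v.
have q0 := inv_quadratic_gt0 v s0; have q1 := inv_quadratic_gt0 (v - h) s0.
rewrite inv_quadratic_diff // [leRHS](_ : _ = inv_quadratic s (v - h)
  * (D - P * (h * (2 * v - h) * inv_quadratic s v))); last by ring.
have iv : inv_quadratic s v * (s ^+ 2 + v ^+ 2) = 1.
  by rewrite mulVf // lt0r_neq0 // ltr_wpDr ?sqr_ge0 ?exprn_gt0.
have iu : inv_quadratic s (v - h) * (s ^+ 2 + (v - h) ^+ 2) = 1.
  by rewrite mulVf // lt0r_neq0 // ltr_wpDr ?sqr_ge0 ?exprn_gt0.
have key : kap / 2 * (s ^+ 2 + v ^+ 2)
    <= D - P * (h * (2 * v - h) * inv_quadratic s v).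
  have nu := prof (v / s) P PP.
  have e1 : s ^+ 2 * (1 + (v / s) ^+ 2) = s ^+ 2 + v ^+ 2 by field; rewrite lt0r_neq0.
  have n1 : 0 < 1 + (v / s) ^+ 2 by rewrite ltr_wpDr ?sqr_ge0.
  have nu' : kap * (1 + (v / s) ^+ 2)
      <= c * (v / s + b) ^+ 2 - 2 * P * (v / s) / (1 + (v / s) ^+ 2).
    have -> : c * (v / s + b) ^+ 2 - 2 * P * (v / s) / (1 + (v / s) ^+ 2)
       = (c * (v / s + b) ^+ 2 * (1 + (v / s) ^+ 2) - 2 * P * (v / s)) / (1 + (v / s) ^+ 2).
      by rewrite mulrBl mulfK ?lt0r_neq0.
    by rewrite ler_pdivlMr //; apply: le_trans nu; rewrite [X in _ <= kap * X]expr2 mulrA.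
  have {nu nu'} := ler_wpM2l (sqr_ge0 s) nu'.
  rewrite mulrCA e1 mulrBr.
  have -> : s ^+ 2 * (c * (v / s + b) ^+ 2) = c * (x - r2) ^+ 2.
    by rewrite -vE pE; field; rewrite lt0r_neq0.
  have -> : s ^+ 2 * (2 * P * (v / s) / (1 + (v / s) ^+ 2))
      = P * (h * (2 * v) * inv_quadratic s v).
    rewrite /inv_quadratic -e1 hE; field.
    by rewrite !lt0r_neq0 // ltr_wpDr ?sqr_ge0 ?exprn_gt0.
  move=> H.
  have : L * s ^+ 3 <= kap / 2 * (s ^+ 2 + v ^+ 2).
    apply: (@le_trans _ _ (kap / 2 * s ^+ 2)).
      by rewrite exprS mulrA ler_wpM2r ?sqr_ge0.
    by rewrite ler_wpM2l ?divr_ge0 ?(ltW k0) // lerDl sqr_ge0.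
  have : 0 <= P * (h * h * inv_quadratic s v) by rewrite !mulr_ge0 // ?(ltW h0) ?(ltW q0).
  have -> : P * (h * (2 * v - h) * inv_quadratic s v)
    = P * (h * (2 * v) * inv_quadratic s v) - P * (h * h * inv_quadratic s v) by ring.
  lra.
apply: le_trans (ler_wpM2l (ltW q1) key).
have u3 : s ^+ 2 + (v - h) ^+ 2 <= 3 * (s ^+ 2 + v ^+ 2).
  have := sqr_ge0 (v + h).
  have : h ^+ 2 <= s ^+ 2 by rewrite ler_pXn2r ?nnegrE // ltW.
  rewrite sqrrB sqrrD !mulr2n; have := sqr_ge0 v; lra.
have -> : kap / 6 = inv_quadratic s (v - h) * (kap / 6 * (s ^+ 2 + (v - h) ^+ 2)).
  by rewrite mulrCA iu mulr1.
rewrite ler_wpM2l ?(ltW q1) //.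
have : kap / 6 * (s ^+ 2 + (v - h) ^+ 2) <= kap / 6 * (3 * (s ^+ 2 + v ^+ 2)).
  by rewrite ler_wpM2l // divr_ge0 // ltW.
lra.
Qed.

(** At a fixed distance of its centre the bump and its increments are bounded, so
    an unfavourable drift of size [L * h] costs only [O(h)]. *)
Lemma bump_away L eta s h D P v :
  0 < eta -> 0 < s -> 0 < h -> h <= eta / 4 -> 0 <= L ->
  eta / 2 <= `|v| -> 0 <= P <= 1 -> - (L * h) <= D ->
  - (h * ((L + 6 / eta) * (16 / eta ^+ 2)))
    <= D * inv_quadratic s (v - h)
       + P * (inv_quadratic s v - inv_quadratic s (v - h)).
Proof.
move=> e0 s0 h0 he L0 ve /andP[P0 P1] DL.
have q0 := inv_quadratic_gt0 v s0; have q1 := inv_quadratic_gt0 (v - h) s0.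
have v0 : 0 < `|v| by apply: lt_le_trans ve; rewrite divr_gt0.
rewrite inv_quadratic_diff // [leRHS](_ : _ = inv_quadratic s (v - h)
  * (D - P * (h * (2 * v - h) * inv_quadratic s v))); last by ring.
have u4 : eta / 4 <= `|v - h|.
  have := ler_distD h v 0; rewrite !subr0 (gtr0_norm h0); lra.
have qu : inv_quadratic s (v - h) <= 16 / eta ^+ 2.
  have -> : 16 / eta ^+ 2 = ((eta / 4) ^+ 2)^-1 by field; rewrite lt0r_neq0.
  rewrite lef_pV2 ?posrE ?exprn_gt0 ?divr_gt0 //; last first.
    by rewrite ltr_wpDr ?sqr_ge0 ?exprn_gt0.
  rewrite -[(v - h) ^+ 2]real_normK ?num_real // -[leLHS]add0r lerD ?sqr_ge0 //.
  by rewrite ler_pXn2r ?nnegrE ?divr_ge0 ?(ltW e0).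
have qv : `|2 * v - h| * inv_quadratic s v <= 6 / eta.
  rewrite ler_pdivrMr; last by rewrite ltr_wpDr ?sqr_ge0 ?exprn_gt0.
  have h3 : `|2 * v - h| <= 3 * `|v|.
    apply: le_trans (ler_normB _ _) _; rewrite normrM normr_nat (gtr0_norm h0); lra.
  apply: le_trans h3 _.
  apply: (@le_trans _ _ (6 / eta * v ^+ 2)); last first.
    by rewrite ler_wpM2l ?divr_ge0 ?(ltW e0) // lerDr sqr_ge0.
  rewrite -[v ^+ 2]real_normK ?num_real // expr2 mulrA ler_wpM2r ?normr_ge0 //.
  by rewrite mulrAC ler_pdivlMr //; lra.
have key : - (h * (L + 6 / eta)) <= D - P * (h * (2 * v - h) * inv_quadratic s v).
  have : P * (h * (2 * v - h) * inv_quadratic s v) <= h * (6 / eta).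
    apply: (@le_trans _ _ (1 * (h * (6 / eta)))); last by rewrite mul1r.
    apply: (@le_trans _ _ (P * (h * (6 / eta)))).
      rewrite ler_wpM2l // -mulrA ler_wpM2l ?(ltW h0) //.
      by apply: le_trans qv; rewrite ler_wpM2r ?(ltW q0) // ler_norm.
    by rewrite ler_wpM2r // mulr_ge0 ?divr_ge0 ?(ltW h0) ?(ltW e0).
  rewrite mulrDr; lra.
apply: le_trans (ler_wpM2l (ltW q1) key); rewrite mulrN lerN2 mulrCA.
by rewrite ler_wpM2l ?(ltW h0) // [leLHS]mulrC ler_wpM2l // addr_ge0 // divr_ge0 // ltW.
Qed.

Lemma inv_pow_diff_ge m z h : 0 < z -> 0 < h ->
  h * (z + h) ^- m.+2 <= z ^- m.+1 - (z + h) ^- m.+1.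
Proof.
move=> z0 h0; have zh : 0 < z + h by exact: addr_gt0.
have zzh : z <= z + h by rewrite lerDl ltW.
apply: (@le_trans _ _ (z^-1 * (z + h) ^- m - (z + h) ^- m.+1)).
  have -> : z^-1 * (z + h) ^- m - (z + h) ^- m.+1 = h * (z^-1 * (z + h) ^- m.+1).
    by rewrite exprS; field; rewrite expf_neq0 ?lt0r_neq0.
  rewrite ler_wpM2l ?(ltW h0) // [in leLHS]exprS invfM.
  by rewrite ler_wpM2r ?invr_ge0 ?exprn_ge0 ?(ltW zh) // lef_pV2 ?posrE.
rewrite lerD2r exprS invfM ler_wpM2l ?invr_ge0 ?(ltW z0) //.
by rewrite lef_pV2 ?posrE ?exprn_gt0 // lerXn2r ?nnegrE ?(ltW z0) ?(ltW zh).
Qed.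

(** Within the critical length [s] of the root the drift may be negligible, but
    there the noise alone drives [z ^- m] up at a sufficient rate. *)
Lemma well_near c P0 L eta s h D P y m :
  0 < c -> 0 < P0 -> 0 <= L -> L * eta <= P0 / 4 -> L * (2 * s) <= P0 / 4 ->
  0 < s -> s <= 1 -> h = s ^+ m.+2 -> 0 < y -> y <= eta -> P0 <= P ->
  c * y ^+ m.+1 - L * h <= D ->
  Num.min c (P0 / 2) / 3 ^+ m.+2
    <= D * (y + s + h) ^- m.+1 + P * ((y + s) ^- m.+1 - (y + s + h) ^- m.+1).
Proof.
move=> c0 P00 L0 Leta Ls s0 s1 hE y0 ye PP Dge.
have h0 : 0 < h by rewrite hE exprn_gt0.
have hs : h <= s by rewrite hE -[leRHS]expr1 ler_wiXn2l // ltW.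
have ys : 0 < y + s by exact: addr_gt0.
have z0 : 0 < y + s + h by exact: addr_gt0.
set z := y + s + h in z0 *; set k := Num.min _ _.
have k0 : 0 < k by rewrite lt_min c0 divr_gt0.
have kc : k <= c by rewrite ge_min lexx.
have kP : k <= P0 / 2 by rewrite ge_min lexx orbT.
have pow : z ^+ m.+2 <= 3 ^+ m.+2 * (y ^+ m.+2 + s ^+ m.+2).
  have zM : z <= 3 * Num.max y s.
    have : y <= Num.max y s by rewrite le_max lexx.
    have : s <= Num.max y s by rewrite le_max lexx orbT.
    rewrite /z; lra.
  have M0 : 0 <= Num.max y s by rewrite le_max ltW.
  apply: (@le_trans _ _ ((3 * Num.max y s) ^+ m.+2)).
    by rewrite lerXn2r ?nnegrE ?(ltW z0) ?mulr_ge0.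
  rewrite exprMn ler_wpM2l ?exprn_ge0 //; case: (leP y s) => _.
    by rewrite lerDr exprn_ge0 // ltW.
  by rewrite lerDl exprn_ge0 // ltW.
have main : k / 3 ^+ m.+2 * z ^+ m.+2 <= D * z + P0 * h.
  apply: (@le_trans _ _ (k * (y ^+ m.+2 + s ^+ m.+2))).
    have -> : k / 3 ^+ m.+2 * z ^+ m.+2 = k * (z ^+ m.+2 / 3 ^+ m.+2) by ring.
    by rewrite ler_wpM2l ?(ltW k0) // ler_pdivrMr ?exprn_gt0 // mulrC.
  rewrite -hE mulrDr.
  have Lz : L * z <= P0 / 2.
    have : L * z <= L * (eta + 2 * s) by rewrite ler_wpM2l //; rewrite /z; lra.
    rewrite mulrDr; lra.
  have e1 : k * y ^+ m.+2 <= c * y ^+ m.+1 * z.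
    rewrite exprSr mulrA ler_pM ?mulr_ge0 ?exprn_ge0 ?(ltW y0) ?(ltW k0) //.
      by rewrite ler_wpM2r ?exprn_ge0 ?(ltW y0).
    by rewrite /z -addrA lerDl addr_ge0 ?(ltW s0) ?(ltW h0).
  have e2 : (c * y ^+ m.+1 - L * h) * z <= D * z by rewrite ler_wpM2r // ltW.
  have e3 : k * h <= P0 / 2 * h by rewrite ler_wpM2r // ltW.
  have e4 : (L * z) * h <= P0 / 2 * h by rewrite ler_wpM2r // ltW.
  have e5 : (c * y ^+ m.+1 - L * h) * z = c * y ^+ m.+1 * z - (L * z) * h by ring.
  lra.
have zm : 0 < z ^- m.+2 by rewrite invr_gt0 exprn_gt0.
have := ler_wpM2r (ltW zm) main.
rewrite mulfK ?expf_neq0 ?lt0r_neq0 // mulrDl => /le_trans; apply.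
have -> : D * z * z ^- m.+2 = D * z ^- m.+1.
  by rewrite [in LHS]exprS invfM -mulrA mulVKf ?lt0r_neq0.
rewrite lerD2l -mulrA ler_pM ?mulr_ge0 ?(ltW P00) ?(ltW h0) ?(ltW zm) //.
exact: inv_pow_diff_ge.
Qed.

Lemma well_away L eta s h D P y m :
  0 <= L -> 0 < eta -> 0 < s -> 0 < h -> eta <= y -> 0 <= P -> - (L * h) <= D ->
  - (h * (L / eta ^+ m.+1))
    <= D * (y + s + h) ^- m.+1 + P * ((y + s) ^- m.+1 - (y + s + h) ^- m.+1).
Proof.
move=> L0 e0 s0 h0 ey P0 DL.
have y0 : 0 < y by exact: lt_le_trans ey.
have ys : 0 < y + s by exact: addr_gt0.
have z0 : 0 < y + s + h by exact: addr_gt0.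
have zm : 0 < (y + s + h) ^- m.+1 by rewrite invr_gt0 exprn_gt0.
rewrite -[leLHS]addr0 lerD //; last first.
  rewrite mulr_ge0 //; apply: le_trans (inv_pow_diff_ge m ys h0).
  by rewrite mulr_ge0 ?(ltW h0) // invr_ge0 exprn_ge0 // ltW.
apply: le_trans (ler_wpM2r (ltW zm) DL); rewrite mulNr lerN2 mulrA.
rewrite [h * L]mulrC ler_wpM2l ?mulr_ge0 ?(ltW h0) //.
rewrite lef_pV2 ?posrE ?exprn_gt0 // lerXn2r ?nnegrE ?(ltW e0) ?(ltW z0) //.
lra.
Qed.

(** Here [P] and [P - D] are the rescaled rates of the jumps of size [h] to the
    right and to the left, and [D] is bounded below by a drift with a root of
    order [m.+1] at [r] and a double root at [r2]. At distance at least [eta] of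
    [r], the first term of the barrier yields a positive quantity ([bump_near])
    and the second one costs [O(h)] ([well_away]); nearer to [r] the roles are
    exchanged ([well_near], [bump_away]). The factor [A] normalizes the sum. *)
Lemma barrier_drift c P0 L r r2 m : 0 < c -> 0 < P0 -> 0 <= L -> r != r2 ->
  exists b A e0 : R, [/\ 0 < A, 0 < e0, e0 <= 1 &
    forall h s1 s x P D, h = s1 ^+ 3 -> h = s ^+ m.+2 ->
      0 < s1 <= e0 -> 0 < s <= e0 -> x < r -> P0 <= P <= 1 ->
      c * ((r - x) ^+ m.+1 * (x - r2) ^+ 2) - L * h <= D ->
      1 + (P - D) * (A * barrier m.+1 r (r2 + b * s1) s1 s (x - h))
        <= P * (A * barrier m.+1 r (r2 + b * s1) s1 s x)].
Proof.
move=> c0 P00 L0 rr2; pose d := `|r - r2|.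
have d0 : 0 < d by rewrite normr_gt0 subr_eq0.
pose eta := Num.min (d / 2) (P0 / (4 * (L + 1))).
have L1 : 0 < L + 1 by rewrite ltr_wpDl.
have eta0 : 0 < eta by rewrite lt_min !divr_gt0 ?mulr_gt0.
have eta_d : eta <= d / 2 by rewrite ge_min lexx.
have Leta : L * eta <= P0 / 4.
  have : eta * (4 * (L + 1)) <= P0 by rewrite -ler_pdivlMr ?mulr_gt0 // ge_min lexx orbT.
  lra.
pose c1 := c * eta ^+ m.+1; pose c2 := c * eta ^+ 2.
have c10 : 0 < c1 by rewrite mulr_gt0 ?exprn_gt0.
have c20 : 0 < c2 by rewrite mulr_gt0 ?exprn_gt0.
have [b [kap [b0 kap0 prof]]] := shifted_profile c10 P00.
pose kap2 := Num.min c2 (P0 / 2) / 3 ^+ m.+2.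
have kap20 : 0 < kap2 by rewrite divr_gt0 ?exprn_gt0 // lt_min c20 divr_gt0.
pose E := (L + 6 / eta) * (16 / eta ^+ 2).
have E0 : 0 <= E by rewrite mulr_ge0 ?addr_ge0 ?divr_ge0 ?exprn_ge0 ?(ltW eta0).
pose E' := L / eta ^+ m.+1.
have E'0 : 0 <= E' by rewrite divr_ge0 ?exprn_ge0 ?(ltW eta0).
pose A := 12 / kap + 2 / kap2.
have A0 : 0 < A by apply: addr_gt0; apply: divr_gt0.
pose t1 := 2 * L / kap; pose t2 := 12 * E' / kap; pose t3 := 8 * L / P0.
pose t4 := 2 * b / eta; pose t5 := 4 / eta; pose t6 := 2 * E / kap2.
have quot N den : 0 <= N -> 0 < den -> 0 <= N / den :> R.
  by move=> ? ?; rewrite divr_ge0 // ltW.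
have u1 : 0 <= t1 by apply: quot => //; apply: mulr_ge0.
have u2 : 0 <= t2 by apply: quot => //; apply: mulr_ge0.
have u3 : 0 <= t3 by apply: quot => //; apply: mulr_ge0.
have u4 : 0 <= t4 by apply: quot => //; apply: mulr_ge0.
have u5 : 0 <= t5 by apply: quot.
have u6 : 0 <= t6 by apply: quot => //; apply: mulr_ge0.
pose B := t1 + t2 + t3 + t4 + t5 + t6 + 1.
have sum_ge (x1 x2 x3 x4 x5 x6 : R) :
    0 <= x1 -> 0 <= x2 -> 0 <= x3 -> 0 <= x4 -> 0 <= x5 -> 0 <= x6 ->
    let x := x1 + x2 + x3 + x4 + x5 + x6 + 1 in
    [/\ 1 <= x, x1 <= x, x2 <= x & [/\ x3 <= x, x4 <= x, x5 <= x & x6 <= x]].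
  by clear => a1 a2 a3 a4 a5 a6 x; rewrite /x; clear x; split; [lra|lra|lra|split; lra].
have [B1 tB1 tB2 [tB3 tB4 tB5 tB6]] := sum_ge _ _ _ _ _ _ u1 u2 u3 u4 u5 u6.
rewrite -/B in B1 tB1 tB2 tB3 tB4 tB5 tB6.
have B0 : 0 < B by exact: lt_le_trans B1.
have small u (N den : R) : 0 < den -> 0 <= N -> N / den <= B -> 0 < u -> u <= B^-1 ->
    N * u <= den.
  move=> den0 N0 NB u0 uB; rewrite ler_pdivrMr // in NB.
  have uB1 : B * u <= 1 by rewrite mulrC -ler_pdivlMr // div1r.
  have : N * u <= B * den * u by rewrite ler_wpM2r // ltW.
  have : (B * u) * den <= 1 * den by rewrite ler_wpM2r // ltW.
  lra.
exists b, A, B^-1; split=> //; first by rewrite invr_gt0.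
  by rewrite invf_le1.
move=> h s1 s x P D h1E h2E /andP[s10 s1B] /andP[s0 sB] xr PP Dge.
have /andP[PP0 P1] := PP; have P0' : 0 <= P by apply: le_trans PP0; exact: ltW.
have Bi1 : B^-1 <= 1 by rewrite invf_le1.
have s11 : s1 <= 1 by exact: le_trans Bi1.
have s1' : s <= 1 by exact: le_trans Bi1.
have h0 : 0 < h by rewrite h1E exprn_gt0.
have hs1 : h <= s1 by rewrite h1E -[leRHS]expr1 ler_wiXn2l // ltW.
have hB : h <= B^-1 by exact: le_trans s1B.
have g1 := small s1 (2 * L) kap kap0 (mulr_ge0 (ler0n _ 2) L0) tB1 s10 s1B.
have g2 := small h (12 * E') kap kap0 (mulr_ge0 (ler0n _ 12) E'0) tB2 h0 hB.
have g3 := small s (8 * L) P0 P00 (mulr_ge0 (ler0n _ 8) L0) tB3 s0 sB.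
have g4 := small s1 (2 * b) eta eta0 (mulr_ge0 (ler0n _ 2) b0) tB4 s10 s1B.
have g5 := small h 4 eta eta0 (ler0n _ 4) tB5 h0 hB.
have g6 := small h (2 * E) kap2 kap20 (mulr_ge0 (ler0n _ 2) E0) tB6 h0 hB.
set p := r2 + b * s1; pose y := r - x.
have y0 : 0 < y by rewrite subr_gt0.
pose T1 := D * inv_quadratic s1 (x - h - p)
           + P * (inv_quadratic s1 (x - p) - inv_quadratic s1 (x - h - p)).
pose T2 := D * (y + s + h) ^- m.+1 + P * ((y + s) ^- m.+1 - (y + s + h) ^- m.+1).
suff TT : A^-1 <= T1 + T2.
  have -> : P * (A * barrier m.+1 r p s1 s x) = A * (T1 + T2)
      + (P - D) * (A * barrier m.+1 r p s1 s (x - h)).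
    rewrite /barrier (_ : r - (x - h) + s = y + s + h); last by rewrite /y; ring.
    by rewrite /T1 /T2 -/y; ring.
  by rewrite lerD2r mulrC -ler_pdivrMr // div1r.
have DL : - (L * h) <= D.
  apply: le_trans Dge; rewrite -[leLHS]add0r lerD2r.
  by rewrite mulr_ge0 ?(ltW c0) // mulr_ge0 ?sqr_ge0 // exprn_ge0 // ltW.
have [ye|ye] := leP eta y.
  have n1 : kap / 6 <= T1.
    have L_s : L * s1 <= kap / 2 by move: g1; clear => ?; lra.
    have D_ge : c1 * (x - r2) ^+ 2 - L * s1 ^+ 3 <= D.
      rewrite -h1E; apply: le_trans Dge; rewrite lerD2r /c1 -mulrA.
      rewrite ler_wpM2l ?(ltW c0) // ler_wpM2r ?sqr_ge0 //.
      by rewrite lerXn2r ?nnegrE ?(ltW eta0) ?(ltW y0).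
    exact: (@bump_near c1 P0 L b kap s1 D P x r2 h p prof s10 s11 kap0 (ltW P00) L_s PP D_ge h1E erefl).
  have n2 := well_away m L0 eta0 s0 h0 ye P0' DL.
  have A_le : A^-1 <= kap / 12.
    have A2 : 12 / kap <= A by rewrite lerDl divr_ge0 // ltW.
    have A3 : 0 < 12 / kap by rewrite divr_gt0.
    by rewrite -[kap / 12]invf_div lef_pV2.
  move: n2; rewrite -/T2 -/E'; move: n1 A_le g2.
  have combine (a1 a2 a3 a4 a5 a6 : R) : a1 / 6 <= a2 -> a3 <= a1 / 12 ->
      12 * a4 * a5 <= a1 -> - (a5 * a4) <= a6 -> a3 <= a2 + a6 by clear => *; lra.
  exact: combine.
have xr2 : eta <= `|x - r2|.
  have := ler_distD x r r2; rewrite -/d -/y (gtr0_norm y0).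
  have half_le (a1 a2 a3 a4 : R) : a1 <= a4 -> a4 <= a2 / 2 -> a2 <= a1 + a3 -> a4 <= a3.
    by clear => *; lra.
  exact: half_le (ltW ye) eta_d.
have n1 : kap2 <= T2.
  have L_s : L * (2 * s) <= P0 / 4 by move: g3; clear => ?; lra.
  have D_ge : c2 * y ^+ m.+1 - L * h <= D.
    apply: le_trans Dge; rewrite lerD2r /c2 -mulrA ler_wpM2l ?(ltW c0) //.
    rewrite mulrC ler_wpM2l ?exprn_ge0 ?(ltW y0) //.
    by rewrite -[(x - r2) ^+ 2]real_normK ?num_real // lerXn2r ?nnegrE ?(ltW eta0).
  exact: (@well_near c2 P0 L eta s h D P y m c20 P00 L0 Leta L_s s0 s1' h2E y0 (ltW ye) PP0 D_ge).
have n2 : - (h * E) <= T1.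
  rewrite /T1 (_ : x - h - p = (x - p) - h); last by ring.
  have he4 : h <= eta / 4 by move: g5; clearbody eta; clear => ?; lra.
  have P01 : 0 <= P <= 1 by rewrite P0'.
  apply: (@bump_away L eta s1 h D P (x - p) eta0 s10 h0 he4 L0 _ P01 DL).
  have pr : p - r2 = b * s1 by rewrite /p addrC addKr.
  have bs : 0 <= b * s1 by rewrite mulr_ge0 // ltW.
  have := ler_distD p x r2; rewrite pr (ger0_norm bs).
  have half_le (a1 a2 a3 a4 : R) :
      a4 <= a1 -> 2 * a2 <= a4 -> a1 <= a3 + a2 -> a4 / 2 <= a3 by clear => *; lra.
  by apply: half_le xr2 _; rewrite mulrA.
have A_le : A^-1 <= kap2 / 2.
  have A2 : 2 / kap2 <= A by rewrite lerDr divr_ge0 // ltW.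
  have A3 : 0 < 2 / kap2 by rewrite divr_gt0.
  by rewrite -[kap2 / 2]invf_div lef_pV2.
apply: (le_trans A_le); rewrite addrC; apply: le_trans (lerD n1 n2).
have gE : h * E <= kap2 / 2.
  rewrite ler_pdivlMr // (_ : h * E * 2 = 2 * E * h) //.
  by rewrite mulrC mulrA mulrAC.
move: gE; clearbody kap2 E; clear; move=> gE; lra.
Qed.

(** The two integrals are of order [1 / s1 = h ^ (- 1 / 3)] and
    [s ^- (k + 1) = h ^ (- (k + 1) / (k + 3))], and the second is never smaller. *)
Lemma barrier_sum k r p s1 s h a N : 0 < s1 -> 0 < s -> s <= 1 -> 0 < h ->
  h = s1 ^+ 3 -> h = s ^+ k.+3 -> (forall j, (j < N)%N -> a + j%:R * h < r) ->
  \sum_(0 <= j < N) h * barrier k.+2 r p s1 s (a + j%:R * h) <= 16 / s ^+ k.+1.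
Proof.
move=> s10 s0 s1' h0 h1E h2E ar.
have h1 : h <= 1 by rewrite h2E exprn_ile1 // ltW.
have s1_le1 : s1 <= 1.
  by rewrite -(@ler_pXn2r _ 3) ?nnegrE ?(ltW s10) // expr1n -h1E.
have hs1 : h <= s1 by rewrite h1E -[leRHS]expr1 ler_wiXn2l // ltW.
have hs : h <= s by rewrite h2E -[leRHS]expr1 ler_wiXn2l // ltW.
have ss1 : s ^+ k.+1 <= s1.
  rewrite -(@ler_pXn2r _ 3) ?nnegrE ?exprn_ge0 ?(ltW s10) ?(ltW s0) //.
  by rewrite -h1E h2E -exprM ler_wiXn2l ?(ltW s0) //; lia.
apply: (@le_trans _ _ (\sum_(0 <= j < N) h * inv_quadratic s1 ((a - p) + j%:R * h)
    + (s ^+ k)^-1 * \sum_(0 <= j < N) h * inv_quadratic s ((a - r) + j%:R * h))).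
  rewrite mulr_sumr -big_split /= !big_mkord; apply: ler_sum => j _.
  have xr := ar j (ltn_ord j); move: xr; move xE : (a + j%:R * h) => x xr.
  have -> : a - p + j%:R * h = x - p by rewrite -xE; ring.
  have -> : a - r + j%:R * h = x - r by rewrite -xE; ring.
  rewrite /barrier mulrDr lerD2l mulrCA ler_wpM2l ?(ltW h0) //.
  have y0 : 0 < r - x by rewrite subr_gt0.
  have ys : 0 < r - x + s by exact: addr_gt0.
  rewrite -addn2 exprD invfM ler_pM ?invr_ge0 ?exprn_ge0 ?(ltW ys) //.
    rewrite lef_pV2 ?posrE ?exprn_gt0 // lerXn2r ?nnegrE ?(ltW s0) ?(ltW ys) //.
    by rewrite lerDr ltW.
  rewrite lef_pV2 ?posrE ?exprn_gt0 //; last by rewrite ltr_wpDr ?sqr_ge0 ?exprn_gt0.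
  have : 0 <= (r - x) * s by rewrite mulr_ge0 // ltW.
  by rewrite !expr2; lra.
have -> : 16 / s ^+ k.+1 = 8 / s ^+ k.+1 + (s ^+ k)^-1 * (8 / s).
  by rewrite exprS; field; rewrite expf_neq0 ?lt0r_neq0.
rewrite lerD //; last first.
  by rewrite ler_wpM2l ?invr_ge0 ?exprn_ge0 ?(ltW s0) // sum_inv_quadratic_le.
apply: le_trans (sum_inv_quadratic_le _ _ h0 hs1) _.
by rewrite ler_wpM2l // lef_pV2 ?posrE ?exprn_gt0.
Qed.

Lemma barrier_gt0 m r p s1 s x : 0 < s1 -> 0 < s -> x <= r ->
  0 < barrier m r p s1 s x.
Proof.
move=> s10 s0 xr; apply: addr_gt0; first exact: inv_quadratic_gt0.
by rewrite invr_gt0 exprn_gt0 // ltr_wpDl // subr_ge0.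
Qed.

End Barrier.

(** * A test function for displacements *)

Section Displacement.
Context {R : realFieldType}.
Implicit Types (s h v : R).

(** A smooth indicator of the complement of a window of half-width [s], with
    bounded first and second derivatives in [v / s]; it tends to 1 like
    [1 - (s / v) ^ 2], which makes its slope small enough far away to beat a
    drift of order 2 or 3. *)
Definition displacement s v : R := v ^+ 2 * inv_quadratic s v.

Definition displacement_slope s v : R := 2 * s ^+ 2 * v * inv_quadratic s v ^+ 2.

Lemma inv_quadraticK s v : 0 < s -> (s ^+ 2 + v ^+ 2) * inv_quadratic s v = 1.
Proof. by move=> s0; rewrite mulfV // lt0r_neq0 // ltr_wpDr ?sqr_ge0 ?exprn_gt0. Qed.

Lemma displacement0 s : displacement s 0 = 0.
Proof. by rewrite /displacement expr0n mul0r. Qed.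

Lemma displacement_ge0 s v : 0 < s -> 0 <= displacement s v.
Proof. by move=> s0; rewrite mulr_ge0 ?sqr_ge0 ?(ltW (inv_quadratic_gt0 _ s0)). Qed.

Lemma displacement_ge_half s v : 0 < s -> s <= `|v| -> 2^-1 <= displacement s v.
Proof.
move=> s0 sv; rewrite /displacement /inv_quadratic ler_pdivlMr; last first.
  by rewrite ltr_wpDr ?sqr_ge0 ?exprn_gt0.
have : s ^+ 2 <= `|v| ^+ 2 by rewrite lerXn2r ?nnegrE ?(ltW s0).
rewrite real_normK ?num_real //; lra.
Qed.

Lemma inv_quadratic_le s v : 0 < s -> inv_quadratic s v <= (s ^+ 2)^-1.
Proof.
move=> s0; rewrite lef_pV2 ?posrE ?exprn_gt0 // ?lerDl ?sqr_ge0 //.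
by rewrite ltr_wpDr ?sqr_ge0 ?exprn_gt0.
Qed.

(** Taylor's formula with an exact remainder, the difference of two rational
    functions. *)
Lemma displacement_step s h v : 0 < s -> `|h| <= s ->
  displacement s (v + h) - displacement s v
    <= h * displacement_slope s v + 6 * h ^+ 2 / s ^+ 2.
Proof.
move=> s0 hs; set J := inv_quadratic s v; set K := inv_quadratic s (v + h).
have J0 : 0 < J by exact: inv_quadratic_gt0.
have K0 : 0 < K by exact: inv_quadratic_gt0.
have JE : (s ^+ 2 + v ^+ 2) * J = 1 by exact: inv_quadraticK.
have KE : (s ^+ 2 + (v + h) ^+ 2) * K = 1 by exact: inv_quadraticK.
have h2 : h ^+ 2 <= s ^+ 2.
  by rewrite -[h ^+ 2]real_normK ?num_real // lerXn2r ?nnegrE ?(ltW s0).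
have -> : displacement s (v + h) - displacement s v
   = h * displacement_slope s v
     + (s ^+ 2 * h ^+ 2 * J * K) * (1 - 2 * v * (2 * v + h) * J).
  rewrite /displacement /displacement_slope -/J -/K.
  have sq w : s ^+ 2 + w ^+ 2 != 0 by rewrite lt0r_neq0 // ltr_wpDr ?sqr_ge0 ?exprn_gt0.
  by rewrite /J /K /inv_quadratic; field; rewrite !sq.
rewrite lerD2l.
have b1 : 1 - 2 * v * (2 * v + h) * J <= 6.
  have : - (2 * v * (2 * v + h)) <= 5 * (s ^+ 2 + v ^+ 2).
    have := sqr_ge0 (v + h); have := sqr_ge0 v; have := sqr_ge0 s; lra.
  by move/(ler_wpM2r (ltW J0)); rewrite -[5 * _ * J]mulrA JE; lra.
have q0 : 0 <= s ^+ 2 * h ^+ 2 * J * K.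
  by rewrite mulr_ge0 ?(ltW K0) // mulr_ge0 ?(ltW J0) // mulr_ge0 ?sqr_ge0.
apply: (le_trans (ler_wpM2l q0 b1)).
have -> : 6 * h ^+ 2 / s ^+ 2 = s ^+ 2 * h ^+ 2 * (s ^+ 2)^-1 * (s ^+ 2)^-1 * 6.
  by field; rewrite lt0r_neq0.
rewrite ler_wpM2r //; apply: ler_pM; rewrite ?(ltW K0) ?inv_quadratic_le //.
  by rewrite mulr_ge0 ?(ltW J0) // mulr_ge0 ?sqr_ge0.
by rewrite ler_wpM2l ?inv_quadratic_le // mulr_ge0 ?sqr_ge0.
Qed.

Lemma displacement_slope_norm s v : 0 < s ->
  `|displacement_slope s v| = 2 * s ^+ 2 * `|v| * inv_quadratic s v ^+ 2.
Proof.
move=> s0; rewrite /displacement_slope normrM (ger0_norm (sqr_ge0 _)) normrM.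
by rewrite ger0_norm // mulr_ge0 ?sqr_ge0.
Qed.

Lemma displacement_slope_le s v : 0 < s -> `|displacement_slope s v| <= s^-1.
Proof.
move=> s0; rewrite displacement_slope_norm //; set J := inv_quadratic s v.
have J0 : 0 < J by exact: inv_quadratic_gt0.
have : 2 * s * `|v| * J <= 1.
  rewrite -[leRHS](inv_quadraticK v s0) -/J ler_wpM2r ?(ltW J0) //.
  by rewrite -[v ^+ 2]real_normK ?num_real //; have := sqr_ge0 (s - `|v|); lra.
have : s * J <= s^-1.
  have -> : s^-1 = s * (s ^+ 2)^-1 by field; rewrite lt0r_neq0.
  by rewrite ler_wpM2l ?(ltW s0) // inv_quadratic_le.
have sJ : 0 <= s * J by rewrite mulr_ge0 ?(ltW s0) ?(ltW J0).
move=> a b; have := ler_wpM2r sJ b; rewrite mul1r => c.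
apply: le_trans a; apply: le_trans c.
by rewrite le_eqVlt; apply/orP; left; apply/eqP; ring.
Qed.

(** The slope is of order [s ^ 2 / |v| ^ 3] far away, which absorbs a power
    [k + 2] of the distance as long as it is at most 3. *)
Lemma displacement_slope_pow k s v : (k <= 1)%N -> 0 < s ->
  (`|v| + 4 * s) ^+ k.+2 * `|displacement_slope s v| <= 2 * 5 ^+ k.+2 * s ^+ k.+1.
Proof.
move=> k1 s0; rewrite displacement_slope_norm //; set J := inv_quadratic s v.
have J0 : 0 < J by exact: inv_quadratic_gt0.
set y := `|v|; have y0 : 0 <= y by exact: normr_ge0.
have JE : (s ^+ 2 + y ^+ 2) * J = 1.
  by rewrite /y real_normK ?num_real //; exact: inv_quadraticK.
have s2 : s ^+ 2 * J <= 1 by rewrite -[leRHS]JE ler_wpM2r ?(ltW J0) // lerDl sqr_ge0.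
have y2 : y ^+ 2 * J <= 1 by rewrite -[leRHS]JE ler_wpM2r ?(ltW J0) // lerDr sqr_ge0.
have sJ0 : 0 <= s ^+ 2 * J by rewrite mulr_ge0 ?sqr_ge0 ?(ltW J0).
have yJ0 : 0 <= y ^+ 2 * J by rewrite mulr_ge0 ?sqr_ge0 ?(ltW J0).
have five : 0 <= 2 * 5 ^+ k.+2 :> R by rewrite mulr_ge0 ?exprn_ge0.
have [ys|sy] := leP y s.
  apply: (@le_trans _ _ ((5 * s) ^+ k.+2 * (2 * s ^+ 2 * s * J ^+ 2))).
    have s4 : 0 <= 4 * s by rewrite mulr_ge0 // ltW.
    apply: ler_pM.
    - by rewrite exprn_ge0 // addr_ge0.
    - by rewrite mulr_ge0 ?sqr_ge0 // mulr_ge0 // mulr_ge0 ?sqr_ge0.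
    - by rewrite lerXn2r ?nnegrE //; lra.
    - by rewrite ler_wpM2r ?sqr_ge0 // ler_wpM2l // mulr_ge0 ?sqr_ge0.
  have -> : (5 * s) ^+ k.+2 * (2 * s ^+ 2 * s * J ^+ 2)
      = 2 * 5 ^+ k.+2 * (s ^+ k.+1 * ((s ^+ 2 * J) * (s ^+ 2 * J))).
    by rewrite exprMn [s ^+ k.+2]exprS; ring.
  rewrite ler_wpM2l // ler_piMr ?exprn_ge0 ?(ltW s0) //.
  by rewrite mulr_ile1.
apply: (@le_trans _ _ ((5 * y) ^+ k.+2 * (2 * s ^+ 2 * y * J ^+ 2))).
  apply: ler_wpM2r; first by rewrite mulr_ge0 ?sqr_ge0 // mulr_ge0 // mulr_ge0 ?sqr_ge0.
  by rewrite lerXn2r ?nnegrE //; lra.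
have -> : (5 * y) ^+ k.+2 * (2 * s ^+ 2 * y * J ^+ 2)
    = 2 * 5 ^+ k.+2 * ((s * s * y ^+ k.+3) * J ^+ 2).
  by rewrite exprMn [y ^+ k.+3]exprS; ring.
rewrite ler_wpM2l //.
have yk : s * y ^+ k.+3 <= s ^+ k * y ^+ 4.
  case: k k1 {five} => [|[|//]] _.
    by rewrite expr0 mul1r [leRHS]exprS ler_wpM2r ?exprn_ge0 // ltW.
  by [].
apply: (@le_trans _ _ (s * (s ^+ k * y ^+ 4) * J ^+ 2)).
  by rewrite ler_wpM2r ?sqr_ge0 // -mulrA ler_wpM2l // ltW.
have -> : s * (s ^+ k * y ^+ 4) * J ^+ 2 = s ^+ k.+1 * ((y ^+ 2 * J) * (y ^+ 2 * J)).
  by rewrite [s ^+ k.+1]exprS; ring.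
by rewrite ler_piMr ?exprn_ge0 ?(ltW s0) // mulr_ile1.
Qed.

(** [P] and [M] are the rescaled rates of the two jumps of size [h]; at the
    critical length, drift and noise move the displacement at the same speed. *)
Lemma displacement_drift k s h v a C L P M : (k <= 1)%N -> 0 < s -> s <= 1 ->
  h = s ^+ k.+3 -> 0 <= P <= 1 -> 0 <= M <= 1 -> 0 <= C -> 0 <= L ->
  0 <= a <= `|v| + 4 * s -> `|P - M| <= C * a ^+ k.+2 + L * h ->
  P * (displacement s (v + h) - displacement s v)
    + M * (displacement s (v - h) - displacement s v)
    <= h * ((2 * 5 ^+ k.+2 * C + L + 12) * s ^+ k.+1).
Proof.
move=> k1 s0 s1 hE /andP[P0 P1] /andP[M0 M1] C0 L0 /andP[a0 av] PM.
have h0 : 0 < h by rewrite hE exprn_gt0.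
have hs : h <= s by rewrite hE -[leRHS]expr1 ler_wiXn2l // ltW.
set S := displacement_slope s v.
have up : displacement s (v + h) - displacement s v <= h * S + 6 * h ^+ 2 / s ^+ 2.
  by apply: displacement_step => //; rewrite gtr0_norm.
have dn : displacement s (v - h) - displacement s v <= - h * S + 6 * h ^+ 2 / s ^+ 2.
  by rewrite -[h ^+ 2]sqrrN; apply: displacement_step => //; rewrite normrN gtr0_norm.
have e0 : 0 <= 6 * h ^+ 2 / s ^+ 2 by rewrite divr_ge0 ?sqr_ge0 // mulr_ge0 ?sqr_ge0.
have rem : 12 * h ^+ 2 / s ^+ 2 = h * (12 * s ^+ k.+1).
  have -> : h ^+ 2 = h * (s ^+ k.+1 * s ^+ 2) by rewrite expr2 {2}hE -exprD addn2.
  by field; rewrite lt0r_neq0.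
have slope : `|P - M| * `|S| <= (2 * 5 ^+ k.+2 * C + L) * s ^+ k.+1.
  apply: (le_trans (ler_wpM2r (normr_ge0 S) PM)); rewrite mulrDl mulrDl lerD //.
    apply: (@le_trans _ _ (C * ((`|v| + 4 * s) ^+ k.+2 * `|S|))).
      rewrite -mulrA ler_wpM2l // ler_wpM2r ?normr_ge0 //.
      by rewrite lerXn2r ?nnegrE //; exact: le_trans av.
    rewrite (_ : 2 * 5 ^+ k.+2 * C * s ^+ k.+1 = C * (2 * 5 ^+ k.+2 * s ^+ k.+1)); last by ring.
    by rewrite ler_wpM2l // displacement_slope_pow.
  rewrite -mulrA ler_wpM2l //.
  apply: (le_trans (ler_wpM2l (ltW h0) (displacement_slope_le v s0))).
  rewrite hE exprS mulrAC mulfV ?lt0r_neq0 // mul1r ler_wiXn2l // ltW //.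
have lin : (P - M) * S <= `|P - M| * `|S| by rewrite -normrM ler_norm.
have u1 := ler_wpM2l P0 up; have d1 := ler_wpM2l M0 dn.
apply: (le_trans (lerD u1 d1)).
have -> : P * (h * S + 6 * h ^+ 2 / s ^+ 2) + M * (- h * S + 6 * h ^+ 2 / s ^+ 2)
   = h * ((P - M) * S) + (P + M) * (6 * h ^+ 2 / s ^+ 2) by ring.
have e2 : (P + M) * (6 * h ^+ 2 / s ^+ 2) <= 12 * h ^+ 2 / s ^+ 2.
  have -> : 12 * h ^+ 2 / s ^+ 2 = 2 * (6 * h ^+ 2 / s ^+ 2) by ring.
  by rewrite ler_wpM2r //; lra.
rewrite [(_ + 12) * _]mulrDl mulrDr -rem lerD // ler_wpM2l ?(ltW h0) //.
exact: le_trans lin slope.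
Qed.

End Displacement.

(** * The limiting drift *)

Section VotingPolynomial.
Context {R : realType}.
Implicit Types (x : R) (h p : {poly R}).

(** The derivatives of consecutive terms telescope, which leaves the beta
    density. *)
Lemma deriv_binomial_tail n i : (i <= n)%N ->
  (\sum_(i.+1 <= r < n.+1) 'C(n, r)%:R *: ('X ^+ r * (1 - 'X) ^+ (n - r)) : {poly R})^`()
  = (i.+1 * 'C(n, i.+1))%:R *: ('X ^+ i * (1 - 'X) ^+ (n - i.+1)).
Proof.
move=> ni; move dE : (n - i)%N => d; elim: d i ni dE => [|d IH] i ni dE.
  have -> : i = n by apply/eqP; rewrite eqn_leq ni -subn_eq0 dE.
  by rewrite big_geq // deriv0 bin_small ?muln0 ?scale0r.
have lin : (i < n)%N by rewrite -subn_gt0 dE.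
rewrite big_ltn // derivD IH //; last by rewrite subnS dE.
rewrite mul_bin_left derivZ derivM derivXn.
have -> : ((1 - 'X) ^+ (n - i.+1) : {poly R})^`()
    = - ((1 - 'X) ^+ (n - i.+2)) *+ (n - i.+1).
  by rewrite deriv_exp derivB derivX derivC sub0r mulN1r -subnS.
have sc (a b : nat) (A : {poly R}) : a%:R *: (A *+ b) = (b * a)%:R *: A.
  by rewrite -[A *+ b]scaler_nat scalerA -natrM mulnC.
rewrite /= mulrnAl mulrnAr scalerDr !sc mulrN scalerN subrK.
by [].
Qed.

Variable k : nat.
Hypothesis k_gt0 : (0 < k)%N.

Local Notation P := (Pk k : {poly R}).

Lemma horner_Pk x : P.[x] =
  \sum_(k.+1 <= r < (2 * k).+1) 'C(2 * k, r)%:R * (x ^+ r * (1 - x) ^+ (2 * k - r)).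
Proof. by rewrite /Pk horner_sum; apply: eq_bigr => r _; rewrite !hornerE. Qed.

Lemma Pk_term_ge0 x r : 0 <= x <= 1 ->
  0 <= 'C(2 * k, r)%:R * (x ^+ r * (1 - x) ^+ (2 * k - r)).
Proof. by move=> /andP[x0 x1]; rewrite !mulr_ge0 ?exprn_ge0 ?subr_ge0. Qed.

Lemma Pk_ge_pow x : 0 <= x <= 1 -> x ^+ (2 * k) <= P.[x].
Proof.
move=> x01; rewrite horner_Pk big_nat_recr /=; last by rewrite mulnC muln2 -addnn -addn1 leq_add2l.
rewrite binn subnn expr0 mulr1 mul1r lerDr; apply: sumr_ge0 => r _; exact: Pk_term_ge0.
Qed.

Lemma Pk_le1 x : 0 <= x <= 1 -> P.[x] <= 1.
Proof.
move=> x01; have -> : 1 = ((1 - x) + x) ^+ (2 * k) by rewrite subrK expr1n.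
rewrite exprDn horner_Pk -(big_mkord xpredT (fun i => (_ ^+ (_ - i) * _ ^+ i) *+ 'C(_, i))).
rewrite (big_cat_nat (leq0n k.+1)) /=; last by rewrite ltnS mulnC muln2 -addnn leq_addr.
rewrite -[leLHS]add0r lerD //.
  apply: sumr_ge0 => r _; rewrite -[_ *+ 'C(_, _)]mulr_natl [_ ^+ _ * x ^+ _]mulrC; exact: Pk_term_ge0.
by apply: ler_sum => r _; rewrite -[leRHS]mulr_natl [_ ^+ _ * x ^+ _]mulrC.
Qed.

Lemma Pk_ge0 x : 0 <= x <= 1 -> 0 <= P.[x].
Proof.
move=> x01; apply: le_trans (Pk_ge_pow x01).
by rewrite exprn_ge0 //; case/andP: x01.
Qed.

Lemma Pk_gt0 x : 0 < x <= 1 -> 0 < P.[x].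
Proof.
move=> /andP[x0 x1]; apply: lt_le_trans (Pk_ge_pow _); first by rewrite exprn_gt0.
by rewrite ltW.
Qed.

(** Term by term: [r] is more than half of [2 * k], so the power of the larger of
    [x] and [1 - x] dominates. *)
Lemma Pk_le_refl x : 0 <= x -> x <= 1 - x -> P.[x] <= P.[1 - x].
Proof.
move=> x0 xx; have y0 : 0 <= 1 - x by exact: le_trans xx.
rewrite !horner_Pk big_nat [leRHS]big_nat; apply: ler_sum => r /andP[kr rk].
rewrite subKr ler_wpM2l //.
have -> : r = ((2 * k - r) + (2 * r - 2 * k))%N.
  by rewrite ltnS in rk; lia.
set a := (2 * k - r)%N; set b := (2 * r - 2 * k)%N.
have -> : (2 * k - (a + b))%N = a by rewrite /a /b; rewrite ltnS in rk; lia.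
rewrite !exprD mulrAC [leRHS]mulrAC -!exprMn [(1 - x) * x]mulrC.
by rewrite ler_wpM2l ?exprn_ge0 ?mulr_ge0 // lerXn2r.
Qed.

Definition Pk_slope : R := (k.+1 * 'C(2 * k, k.+1))%:R.

Lemma Pk_slope_gt0 : 0 < Pk_slope.
Proof.
rewrite ltr0n muln_gt0 bin_gt0 /=; lia.
Qed.

Lemma deriv_Pk : P^`() = Pk_slope *: ('X ^+ k * (1 - 'X) ^+ k.-1).
Proof.
rewrite /Pk deriv_binomial_tail; last by lia.
by congr (_ *: (_ * _ ^+ _)); lia.
Qed.

Lemma horner_deriv_Pk x : P^`().[x] = Pk_slope * (x * (x * (1 - x)) ^+ k.-1).
Proof.
rewrite deriv_Pk hornerZ hornerM !horner_exp hornerD hornerN !hornerX hornerC.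
rewrite [x ^+ k](_ : _ = x * x ^+ k.-1); last by rewrite -exprS prednK.
by rewrite exprMn; ring.
Qed.

Lemma horner_deriv2_Pk x : P^`()^`().[x]
  = Pk_slope * ((x * (1 - x)) ^+ k.-1
                + x * ((1 - 2 * x) * (x * (1 - x)) ^+ k.-2 *+ k.-1)).
Proof.
have -> : P^`() = Pk_slope *: ('X * ('X * (1 - 'X)) ^+ k.-1).
  rewrite deriv_Pk ['X ^+ k](_ : _ = 'X * 'X ^+ k.-1); last by rewrite -exprS prednK.
  by rewrite exprMn mulrA.
rewrite derivZ derivM derivX deriv_exp derivM derivX derivB derivC derivX.
rewrite !(hornerD, hornerN, hornerZ, hornerM, hornerMn, horner_exp, hornerX, hornerC) /=.
ring.
Qed.

Variables g0 g1 : R.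
Hypothesis gamma : in_Gamma g0 g1.

Local Notation D := (Delta k g0 g1).

Lemma gamma_bounds : [/\ 0 < g0, 0 < g1 & g0 + g1 < 1].
Proof. by case: gamma => /andP[? _] /andP[? _] /andP[]. Qed.

Lemma horner_Delta x :
  D.[x] = (1 - x - g0) * P.[x] - (x - g1) * P.[1 - x].
Proof. by rewrite /Delta !(hornerD, hornerN, hornerM, hornerX, hornerC, horner0, horner_comp). Qed.

Lemma Delta_left_gt0 : 0 < D.[g1].
Proof.
have [g0_gt0 g1_gt0 g_lt1] := gamma_bounds.
have g11 : 0 < g1 <= 1 by rewrite g1_gt0 /=; lra.
by rewrite horner_Delta subrr mul0r subr0 mulr_gt0 ?Pk_gt0 //; lra.
Qed.

Lemma Delta_right_lt0 : D.[1 - g0] < 0.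
Proof.
have [g0_gt0 g1_gt0 g_lt1] := gamma_bounds.
have g01 : 0 < g0 <= 1 by rewrite g0_gt0 /=; lra.
have e : 1 - (1 - g0) = g0 by ring.
rewrite horner_Delta e subrr mul0r sub0r oppr_lt0 mulr_gt0 ?Pk_gt0 //; lra.
Qed.

Lemma Delta_neq0 : D != 0.
Proof.
by apply/negP => /eqP D0; have := Delta_left_gt0; rewrite D0 horner0 ltxx.
Qed.

Lemma Delta_root_interior x : in_S g0 g1 x -> root D x -> g1 < x < 1 - g0.
Proof.
move=> /andP[a b] /rootP Dx; rewrite !lt_neqAle a b !andbT; apply/andP; split.
  by apply/eqP => e; have := Delta_left_gt0; move: Dx; rewrite -e => ->; rewrite ltxx.
by apply/eqP => e; have := Delta_right_lt0; move: Dx; rewrite e => ->; rewrite ltxx.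
Qed.

Lemma deriv_reflect p : (p \Po (1 - 'X))^`() = - (p^`() \Po (1 - 'X)).
Proof. by rewrite deriv_comp derivB derivX derivC sub0r mulrN1. Qed.

Lemma deriv_Delta : D^`() = (1 - 'X - g0%:P) * P^`() - P - (P \Po (1 - 'X))
  + ('X - g1%:P) * (P^`() \Po (1 - 'X)).
Proof.
by rewrite /Delta derivB !derivM !derivB !derivC derivX deriv_reflect; ring.
Qed.

Lemma horner_deriv_Delta x : D^`().[x] =
  (1 - x - g0) * P^`().[x] - P.[x] - P.[1 - x] + (x - g1) * P^`().[1 - x].
Proof.
by rewrite deriv_Delta !(hornerD, hornerN, hornerM, hornerX, hornerC, horner_comp).
Qed.

Lemma horner_deriv2_Delta x : D^`()^`().[x] =
  (1 - x - g0) * P^`()^`().[x] - 2 * P^`().[x] + 2 * P^`().[1 - x]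
  - (x - g1) * P^`()^`().[1 - x].
Proof.
rewrite deriv_Delta derivD !derivB !derivM !derivB !derivC derivX !deriv_reflect.
rewrite !(hornerD, hornerN, hornerM, hornerX, hornerC, horner0, horner_comp).
ring.
Qed.

(** With [a = P(x)] and [b = P(1 - x)], the three equations at a triple root
    eliminate to [u (a'' b - a b'') = 2 (a' + b') b] with [u = 1 - x - g0 >= 0],
    and for [x < 1/2] the left side is nonnegative while the right side is
    negative; this is the convexity of [a / (a + b)] left of [1/2]. The case
    [x > 1/2] has all signs reversed, so [x = 1/2], where [a = b]. *)
Lemma triple_root_half x : in_S g0 g1 x -> D.[x] = 0 -> D^`().[x] = 0 ->
  D^`()^`().[x] = 0 -> x = 1 / 2.
Proof.
move=> xS D0 D1 D2; have /andP[gx xg] := xS.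
have [g0_gt0 g1_gt0 g_lt1] := gamma_bounds.
have x0 : 0 < x by exact: lt_le_trans gx.
have y0 : 0 < 1 - x by lra.
move: D0 D2; rewrite horner_Delta horner_deriv2_Delta.
rewrite !horner_deriv_Pk !horner_deriv2_Pk.
have -> : 1 - (1 - x) = x by ring.
have -> : 1 - 2 * (1 - x) = - (1 - 2 * x) by ring.
rewrite [(1 - x) * x]mulrC -![_ * (x * (1 - x)) ^+ _ *+ _]mulr_natr.
set q := x * (1 - x); set c := Pk_slope; set j : R := k.-1%:R.
have q0 : 0 < q by exact: mulr_gt0.
have c0 : 0 < c by exact: Pk_slope_gt0.
have j0 : 0 <= j by exact: ler0n.
have [Q1 Q2] : 0 < q ^+ k.-1 /\ 0 < q ^+ k.-2 by split; exact: exprn_gt0.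
have jq : j * q ^+ k.-1 = q * (j * q ^+ k.-2).
  rewrite /j; case: (k) => [|[|k']] /=; rewrite ?mul0r ?mulr0 // exprS; ring.
have a0 : 0 < P.[x] by rewrite Pk_gt0 // x0 /=; lra.
have b0 : 0 < P.[1 - x] by rewrite Pk_gt0 // y0 /=; lra.
have ab := @Pk_le_refl x (ltW x0).
have ba := @Pk_le_refl (1 - x) (ltW y0); rewrite (_ : 1 - (1 - x) = x) in ba; last by ring.
move: a0 b0 ab ba; set a := P.[x]; set b := P.[1 - x] => a0 b0 ab ba D0 D2.
move: Q1 Q2 jq D2; set q1 := q ^+ k.-1; set q2 := q ^+ k.-2 => Q1 Q2 jq D2.
set u := 1 - x - g0 in D0 D2; set v := x - g1 in D0 D2.
have u0 : 0 <= u by rewrite /u; lra.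
have vb : v * b = u * a by lra.
have key : u * (c * (q1 * (b - a) + j * q2 * (1 - 2 * x) * (b * x + a * (1 - x))))
    = 2 * (c * q1) * (2 * x - 1) * b.
  have : b * (u * (c * (q1 + x * ((1 - 2 * x) * q2 * j)))
    - 2 * (c * (x * q1)) + 2 * (c * ((1 - x) * q1))
    - v * (c * (q1 + (1 - x) * (- (1 - 2 * x) * q2 * j)))) = 0 by rewrite D2 mulr0.
  have -> : b * (u * (c * (q1 + x * ((1 - 2 * x) * q2 * j)))
    - 2 * (c * (x * q1)) + 2 * (c * ((1 - x) * q1))
    - v * (c * (q1 + (1 - x) * (- (1 - 2 * x) * q2 * j))))
   = b * u * c * (q1 + x * ((1 - 2 * x) * q2 * j))
    + 2 * (c * q1) * (1 - 2 * x) * b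
    - (v * b) * (c * (q1 + (1 - x) * (- (1 - 2 * x) * q2 * j))) by ring.
  rewrite vb => H.
  apply/eqP; rewrite -subr_eq0; apply/eqP; rewrite -H; ring.
have cq : 0 < 2 * (c * q1) by rewrite !mulr_gt0.
have s0 : 0 <= b * x + a * (1 - x) by rewrite addr_ge0 // mulr_ge0 // ltW.
have [xh|xh|//] := ltgtP x (1 / 2).
  have le : a <= b by apply: ab; lra.
  have : 0 <= u * (c * (q1 * (b - a) + j * q2 * (1 - 2 * x) * (b * x + a * (1 - x)))).
    rewrite mulr_ge0 // mulr_ge0 ?(ltW c0) // addr_ge0 ?mulr_ge0 ?subr_ge0 ?(ltW Q1) //; lra.
  have : 2 * (c * q1) * (2 * x - 1) * b < 0.
    rewrite pmulr_llt0 // pmulr_rlt0 //; lra.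
  by rewrite key => A B; have := lt_le_trans A B; rewrite ltxx.
have le : b <= a by apply: ba; lra.
have : 0 <= - (u * (c * (q1 * (b - a) + j * q2 * (1 - 2 * x) * (b * x + a * (1 - x))))).
  have -> : - (u * (c * (q1 * (b - a) + j * q2 * (1 - 2 * x) * (b * x + a * (1 - x)))))
    = u * (c * (q1 * (a - b) + j * q2 * (2 * x - 1) * (b * x + a * (1 - x)))) by ring.
  rewrite mulr_ge0 // mulr_ge0 ?(ltW c0) // addr_ge0 ?mulr_ge0 ?subr_ge0 ?(ltW Q1) //; lra.
have : 0 < 2 * (c * q1) * (2 * x - 1) * b.
  rewrite mulr_gt0 // mulr_gt0 //; lra.
rewrite key; lra.
Qed.

End VotingPolynomial.

(** * The critical cases *)

Section PolynomialBounds.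
Context {R : realType}.
Implicit Types (x a b r : R) (h p q : {poly R}).

(** By the intermediate value theorem [h] keeps the sign it has at [a], and it
    attains its maximum. *)
Lemma poly_le_neg h a b : a <= b -> (forall x, a <= x <= b -> ~~ root h x) ->
  h.[a] < 0 -> exists2 c, 0 < c & forall x, a <= x <= b -> h.[x] <= - c.
Proof.
move=> ab nr ha.
have [|x0] := @EVT_max R (fun x => h.[x]) a b ab.
  by apply: continuous_subspaceT => x; exact: continuous_horner.
rewrite in_itv /= => /andP[ax xb] hmax.
have hx0 : h.[x0] < 0.
  rewrite ltNge; apply/negP => h0.
  have [|y /andP[ay yx] ry] := @poly_ivt R h a x0 ax; first by rewrite (ltW ha).
  by have := nr y; rewrite ay (le_trans yx xb) ry => /(_ isT).
exists (- h.[x0]); first by rewrite oppr_gt0.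
by move=> x xab; rewrite opprK; apply: hmax; rewrite in_itv.
Qed.

Lemma poly_bounded p : exists2 C, 0 <= C & forall x, 0 <= x <= 1 -> `|p.[x]| <= C.
Proof.
elim/poly_ind: p => [|p c [C C0 hC]]; first by exists 0 => // x _; rewrite horner0 normr0.
exists (C + `|c|); first by rewrite addr_ge0.
move=> x x01; have /andP[x0 x1] := x01; rewrite hornerMXaddC.
apply: le_trans (ler_normD _ _) _; rewrite lerD2r normrM (ger0_norm x0).
by apply: le_trans (hC x x01); rewrite ler_piMr.
Qed.

Lemma poly_lipschitz p : exists2 C, 0 <= C & forall x y, 0 <= x <= 1 -> 0 <= y <= 1 ->
  `|p.[x] - p.[y]| <= C * `|x - y|.
Proof.
elim/poly_ind: p => [|p c [C C0 hC]].
  by exists 0 => // x y _ _; rewrite !horner0 subrr normr0 mul0r.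
have [B B0 hB] := poly_bounded p.
exists (C + B); first by rewrite addr_ge0.
move=> x y x01 y01; have /andP[x0 x1] := x01; rewrite !hornerMXaddC.
have -> : p.[x] * x + c - (p.[y] * y + c) = (p.[x] - p.[y]) * x + p.[y] * (x - y) by ring.
apply: le_trans (ler_normD _ _) _; rewrite !normrM mulrDl lerD //; last first.
  by rewrite ler_wpM2r // hB.
rewrite (ger0_norm x0); apply: le_trans (hC x y x01 y01).
by rewrite ler_piMr.
Qed.

Lemma mup_factor p r n : p != 0 -> mup r p = n ->
  exists2 q, p = q * ('X - r%:P) ^+ n & ~~ root q r.
Proof.
move=> p0 rn; have : ('X - r%:P) ^+ n %| p by rewrite -mup_geq // rn.
move=> /dvdpP[q pE]; exists q => //; apply/negP; rewrite -dvdp_XsubCl => /dvdpP[q' qE].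
have : (mup r p <= n)%N by rewrite rn.
rewrite mup_leq // => /negP; apply; rewrite pE qE -mulrA -exprS.
by rewrite dvdp_mull.
Qed.

Lemma deriv_simple_root q r : (q * ('X - r%:P))^`().[r] = q.[r].
Proof.
rewrite derivM derivXsubC mulr1.
by rewrite hornerD hornerM hornerXsubC subrr mulr0 add0r.
Qed.

Lemma deriv_multiple_root q r n : (q * ('X - r%:P) ^+ n.+2)^`().[r] = 0.
Proof. by rewrite exprSr mulrA deriv_simple_root hornerM horner_exp hornerXsubC subrr expr0n mulr0. Qed.

Lemma deriv2_triple_root q r : (q * ('X - r%:P) ^+ 3)^`()^`().[r] = 0.
Proof.
rewrite derivM deriv_exp derivXsubC mul1r.
have -> : q^`() * ('X - r%:P) ^+ 3 + q * (('X - r%:P) ^+ 3.-1 *+ 3)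
   = (q^`() * ('X - r%:P) + q *+ 3) * ('X - r%:P) ^+ 2 by rewrite /=; ring.
exact: deriv_multiple_root.
Qed.

End PolynomialBounds.

Section CriticalDrift.
Context {R : realType}.
Variables (k : nat) (g0 g1 : R).
Hypothesis k_gt0 : (0 < k)%N.
Hypothesis gamma : in_Gamma g0 g1.

Local Notation D := (Delta k g0 g1).

(** The features of the drift that determine the time scale, in a form common to
    both cases. The root [r] attracts the chain; [r2] is where it may slow down on
    its way, and [p] is a root of order [m] at least, where it must slow down. If
    there is a simple and a double root, [r] is the simple one, [r2] and [p] are
    the double one, and replacing the simple zero of the lower bound at [r] by one
    of order [m = 2] does not change the time scale. If there is a triple root,
    it is both [r] and [p], and [r2] is a point out of the way. *)
Definition critical_drift (m : nat) (r r2 p : R) : Prop :=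
  [/\ g1 < r < 1 - g0, g1 < p < 1 - g0, r != r2 &
   [/\ exists2 c, 0 < c & forall x, in_S g0 g1 x ->
         (x < r -> c * ((r - x) ^+ m * (x - r2) ^+ 2) <= D.[x]) /\
         (r < x -> c * ((x - r) ^+ m * (x - r2) ^+ 2) <= - D.[x]) &
       exists2 C, 0 <= C & forall x, in_S g0 g1 x -> `|D.[x]| <= C * `|x - p| ^+ m]].

Let itv01 x : in_S g0 g1 x -> 0 <= x <= 1.
Proof.
have [a b c] := gamma_bounds gamma.
by move=> /andP[? ?]; apply/andP; split; lra.
Qed.

Lemma simple_double_drift r1 r2 : root_in_S k g0 g1 r1 1 -> root_in_S k g0 g1 r2 2 ->
  (forall x, in_S g0 g1 x -> root D x -> x = r1 \/ x = r2) ->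
  critical_drift 2 r1 r2 r2.
Proof.
move=> [S1 R1 M1] [S2 R2 M2] only; have D0 := Delta_neq0 k_gt0 gamma.
have r12 : r1 != r2 by apply/eqP => e; move: M1; rewrite e M2.
have [q DE qr] := mup_factor D0 M1; rewrite expr1 in DE.
have q0 : q != 0 by apply/eqP => e; move: D0; rewrite DE e mul0r eqxx.
have Mq : mup r2 q = 2%N.
  rewrite -M2 DE mupMl // root_XsubC eq_sym (negbTE r12) //.
have [h qE hr] := mup_factor q0 Mq.
have De x : D.[x] = h.[x] * (x - r2) ^+ 2 * (x - r1).
  by rewrite DE qE 2!hornerM horner_exp !hornerXsubC.
have [a b c] := gamma_bounds gamma.
have g10 : g1 <= 1 - g0 by lra.
have [c0 c0_gt0 hc] : exists2 c, 0 < c & forall x, g1 <= x <= 1 - g0 -> h.[x] <= - c.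
  apply: poly_le_neg => // [x xS|].
    apply/negP => hx; have Dx : root D x by apply/rootP; rewrite De (rootP hx) !mul0r.
    case: (only x xS Dx) => e; move: hx; rewrite e; apply/negP => //.
    by apply: contra qr => hx; rewrite qE rootM hx.
  have := Delta_left_gt0 k_gt0 gamma; have /andP[gr1 _] := Delta_root_interior k_gt0 gamma S1 R1.
  have /andP[gr2 _] := Delta_root_interior k_gt0 gamma S2 R2.
  rewrite De nmulr_lgt0 ?subr_lt0 // pmulr_llt0 // exprn_even_gt0 //= subr_eq0.
  by rewrite lt_eqF.
split; rewrite ?r12 ?(Delta_root_interior k_gt0 gamma S1 R1) ?(Delta_root_interior k_gt0 gamma S2 R2) //.
split.
  exists c0 => // x xS; have hx := hc x xS; have /andP[x0 x1] := itv01 xS.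
  have /andP[s0 s1] := itv01 S1; have d0 := sqr_ge0 (x - r2).
  have main y : 0 <= y <= 1 -> c0 * (y ^+ 2 * (x - r2) ^+ 2) <= - h.[x] * (y * (x - r2) ^+ 2).
    move=> /andP[y0 y1]; apply: ler_pM.
    - exact: ltW.
    - by apply: mulr_ge0 => //; exact: sqr_ge0.
    - lra.
    - by rewrite ler_wpM2r // expr2 ler_piMr.
  split => xr; rewrite De.
    rewrite [leRHS](_ : _ = - h.[x] * ((r1 - x) * (x - r2) ^+ 2)); last by ring.
    by apply: main; apply/andP; split; lra.
  rewrite [leRHS](_ : _ = - h.[x] * ((x - r1) * (x - r2) ^+ 2)); last by ring.
  by apply: main; apply/andP; split; lra.
have [C C0 hC] := poly_bounded h; exists C => // x xS.
have x01 := itv01 xS; have /andP[s0 s1] := itv01 S1; have /andP[x0 x1] := x01.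
rewrite De 2!normrM normrX -mulrA ler_pM ?mulr_ge0 ?exprn_ge0 ?hC //.
by rewrite ler_piMr ?exprn_ge0 // ler_norml; apply/andP; split; lra.
Qed.

Lemma triple_drift r : root_in_S k g0 g1 r 3 ->
  (forall x, in_S g0 g1 x -> root D x -> x = r) -> critical_drift 3 r (r + 1) r.
Proof.
move=> [S1 R1 M1] only; have D0 := Delta_neq0 k_gt0 gamma.
have [h DE hr] := mup_factor D0 M1.
have De x : D.[x] = h.[x] * (x - r) ^+ 3.
  by rewrite DE hornerM horner_exp hornerXsubC.
have [a b c] := gamma_bounds gamma.
have g10 : g1 <= 1 - g0 by lra.
have rint := Delta_root_interior k_gt0 gamma S1 R1.
have [c0 c0_gt0 hc] : exists2 c, 0 < c & forall x, g1 <= x <= 1 - g0 -> h.[x] <= - c.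
  apply: poly_le_neg => // [x xS|].
    apply/negP => hx; have Dx : root D x by apply/rootP; rewrite De (rootP hx) mul0r.
    by move: hx; rewrite (only x xS Dx); apply/negP.
  have := Delta_left_gt0 k_gt0 gamma; have /andP[gr1 _] := rint.
  by rewrite De nmulr_lgt0 // exprn_odd_lt0 //= subr_lt0.
split; rewrite ?rint //; first by rewrite lt_eqF // ltrDl.
split.
  exists (c0 / 4); first by rewrite divr_gt0.
  move=> x xS; have hx := hc x xS; have /andP[x0 x1] := itv01 xS.
  have /andP[s0 s1] := itv01 S1.
  have d4 : (x - (r + 1)) ^+ 2 <= 4.
    rewrite -sqrrN (_ : 4 = 2 ^+ 2); last by ring.
    by rewrite ler_pXn2r ?nnegrE //; lra.
  have main y : 0 <= y -> c0 / 4 * (y ^+ 3 * (x - (r + 1)) ^+ 2) <= - h.[x] * y ^+ 3.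
    move=> y0; have y3 : 0 <= y ^+ 3 by exact: exprn_ge0.
    have : c0 / 4 * y ^+ 3 * (x - (r + 1)) ^+ 2 <= c0 / 4 * y ^+ 3 * 4.
      by rewrite ler_wpM2l // mulr_ge0 // divr_ge0 // ltW.
    have : c0 * y ^+ 3 <= - h.[x] * y ^+ 3 by rewrite ler_wpM2r //; lra.
    rewrite mulrA; lra.
  split => xr; rewrite De.
    rewrite [leRHS](_ : _ = - h.[x] * (r - x) ^+ 3); last by ring.
    by apply: main; rewrite subr_ge0 ltW.
  by rewrite -mulNr; apply: main; rewrite subr_ge0 ltW.
have [C C0 hC] := poly_bounded h; exists C => // x xS.
by rewrite De normrM normrX ler_wpM2r ?exprn_ge0 // hC // itv01.
Qed.

(** At [1 / 2], both terms of the drift involve the same positive value of the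
    polynomial [Pk], so a root there makes [1 - r - g0] and [r - g1] equal. *)
Lemma triple_root_sym r : root_in_S k g0 g1 r 3 -> g0 = g1.
Proof.
move=> [S1 R1 M1]; have D0 := Delta_neq0 k_gt0 gamma.
have [q DE _] := mup_factor D0 M1.
have rh : r = 1 / 2.
  apply: (triple_root_half k_gt0 gamma S1); first exact/rootP.
    by rewrite DE deriv_multiple_root.
  by rewrite DE deriv2_triple_root.
move/rootP: R1; rewrite horner_Delta (_ : 1 - r = r); last by rewrite rh; field.
have P0 : 0 < (Pk k : {poly R}).[r].
  by apply: Pk_gt0 => //; have [a b c] := gamma_bounds gamma; rewrite rh; apply/andP; split; lra.
rewrite -mulrBl => /eqP; rewrite mulf_eq0 (gt_eqF P0) orbF => /eqP.
rewrite rh; lra.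
Qed.

(** If [g0 = g1], the reflection [x -> 1 - x] preserves the roots and tells a
    simple root from a double one, so both would be fixed, that is equal to
    [1 / 2]. *)
Lemma simple_double_asym r1 r2 :
  root_in_S k g0 g1 r1 1 -> root_in_S k g0 g1 r2 2 ->
  (forall x, in_S g0 g1 x -> root D x -> x = r1 \/ x = r2) -> g0 <> g1.
Proof.
move=> [S1 R1 M1] [S2 R2 M2] only g01; have D0 := Delta_neq0 k_gt0 gamma.
have r12 : r1 <> r2 by move=> e; move: M1; rewrite e M2.
have refl x : in_S g0 g1 x -> root D x -> 1 - x = r1 \/ 1 - x = r2.
  move=> xS /rootP Dx; apply: only.
    by move: xS; rewrite /in_S -g01 => /andP[? ?]; apply/andP; split; lra.
  apply/rootP; move: Dx; rewrite !horner_Delta -g01 (_ : 1 - (1 - x) = x); last by ring.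
  by move=> H; rewrite -[RHS]oppr0 -H; ring.
have d1 : D^`().[r1] != 0.
  have [q DE qr] := mup_factor D0 M1.
  by rewrite DE expr1 deriv_simple_root -rootE.
have d2 : D^`().[r2] = 0.
  by have [q DE _] := mup_factor D0 M2; rewrite DE deriv_multiple_root.
have dsym x : D^`().[1 - x] = D^`().[x].
  rewrite !horner_deriv_Delta -g01 (_ : 1 - (1 - x) = x); last by ring.
  ring.
case: (refl _ S1 R1) => e1.
  case: (refl _ S2 R2) => e2; apply: r12; lra.
by move/eqP: d1; apply; rewrite -dsym e1.
Qed.

End CriticalDrift.

Lemma Gamma_crit_cases {R : realType} (k : nat) (g0 g1 : R) : (0 < k)%N ->
  Gamma_crit k g0 g1 ->
  (g0 != g1 -> exists r r2 p, critical_drift k g0 g1 2 r r2 p /\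
     forall r', root_in_S k g0 g1 r' 1 -> r' = r) /\
  (g0 = g1 -> exists r r2 p, critical_drift k g0 g1 3 r r2 p /\
     forall r', in_S g0 g1 r' -> root (Delta k g0 g1) r' -> r' = r).
Proof.
move=> k0 [G [[r1 [r2 [h1 h2 only]]]|[r [h3 only]]]]; split=> g01.
- exists r1, r2, r2; split; first exact: simple_double_drift.
  move=> r' [S' R' M']; case: (only r' S' R') => // e.
  by case: h2 => _ _; rewrite -e M'.
- by have := simple_double_asym k0 G h1 h2 only.
- by move/eqP: g01; have := triple_root_sym k0 G h3.
- by exists r, (r + 1), r; split; [exact: triple_drift|exact: only].
Qed.

(** * Jump rates of the model *)

Lemma stubborn_bounds {R : realType} n (g : R) : 0 <= g ->
  n%:R * g <= (stubborn n g)%:R < n%:R * g + 1.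
Proof.
move=> g0; have c0 : 0 <= Num.ceil (n%:R * g).
  by rewrite ceil_ge0 (lt_le_trans _ (mulr_ge0 (ler0n R n) g0)) // ltrN10.
have -> : (stubborn n g)%:R = (Num.ceil (n%:R * g))%:~R :> R.
  by rewrite /stubborn -[in RHS](gez0_abs c0).
have /andP[a b] := ceil_itv (n%:R * g); rewrite b /=.
by move: a; rewrite rmorphB /= ltrBlDr.
Qed.

Section Rates.
Context {R : realType}.
Variables (k : nat) (g0 g1 : R).
Hypothesis k_gt0 : (0 < k)%N.
Hypothesis gamma : in_Gamma g0 g1.
Implicit Types (x : R) (n i : nat).

Local Notation P := (Pk k : {poly R}).

Definition frac0 n : R := (N0 g0 n)%:R / n%:R.
Definition frac1 n : R := (N1 g1 n)%:R / n%:R.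

Definition up_rate n x : R := (1 - x - frac0 n) * P.[bn n * x].
Definition down_rate n x : R := (x - frac1 n) * P.[bn n * (1 - x)].

Definition grid n i : R := (N1 g1 n + i)%:R / n%:R.

Lemma frac_bounds n (g : R) : (0 < n)%N -> 0 < g ->
  [/\ g <= (stubborn n g)%:R / n%:R, (stubborn n g)%:R / n%:R < g + n%:R^-1 &
      n%:R^-1 <= (stubborn n g)%:R / n%:R :> R].
Proof.
move=> n0 gp; have n0' : 0 < n%:R :> R by rewrite ltr0n.
have /andP[a b] := stubborn_bounds n (ltW gp); split.
- by rewrite ler_pdivlMr // mulrC.
- by rewrite ltr_pdivrMr // mulrDl mulVf ?lt0r_neq0 // mulrC.
- rewrite -[leLHS]mul1r ler_wpM2r ?invr_ge0 ?ler0n // ler1n -(ltr0n R).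
  by apply: lt_le_trans a; rewrite mulr_gt0.
Qed.

Lemma frac0_bounds n : (0 < n)%N ->
  [/\ g0 <= frac0 n, frac0 n < g0 + n%:R^-1 & n%:R^-1 <= frac0 n].
Proof. by move=> n0; apply: frac_bounds => //; have [] := gamma_bounds gamma. Qed.

Lemma frac1_bounds n : (0 < n)%N ->
  [/\ g1 <= frac1 n, frac1 n < g1 + n%:R^-1 & n%:R^-1 <= frac1 n].
Proof. by move=> n0; apply: frac_bounds => //; have [] := gamma_bounds gamma. Qed.

(** The rescaled argument stays in [0, 1] because there is at least one stubborn
    agent of each opinion. *)
Lemma bn_itv n x : (1 < n)%N -> 0 < x -> x <= 1 - n%:R^-1 -> x <= bn n * x <= 1.
Proof.
move=> n1 x0 x1; have n1' : 1 < n%:R :> R by rewrite ltr1n.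
have d0 : 0 < n%:R - 1 :> R by rewrite subr_gt0.
have n0 : 0 < n%:R :> R by exact: lt_trans n1'.
rewrite /bn; apply/andP; split.
  rewrite mulrC mulrA ler_pdivlMr // ler_wpM2l ?(ltW x0) //; lra.
rewrite mulrAC ler_pdivrMr // mul1r.
have : n%:R * x <= n%:R * (1 - n%:R^-1) by rewrite ler_wpM2l // ltW.
by rewrite mulrBr mulr1 mulfV // lt0r_neq0.
Qed.

Lemma bn_dist n x : (1 < n)%N -> 0 <= x <= 1 -> `|bn n * x - x| <= 2 / n%:R.
Proof.
move=> n1 /andP[x0 x1]; have n2 : 2 <= n%:R :> R by rewrite ler_nat.
have d0 : 0 < n%:R - 1 :> R by lra.
have n0 : 0 < n%:R :> R by lra.
have -> : bn n * x - x = x / (n%:R - 1) by rewrite /bn; field; rewrite lt0r_neq0.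
rewrite ger0_norm ?divr_ge0 ?(ltW d0) // ler_pdivrMr // mulrAC ler_pdivlMr //.
have : x * n%:R <= 1 * n%:R by rewrite ler_wpM2r // ltW.
lra.
Qed.

Section FixedSize.
Variable n : nat.
Hypothesis n_gt1 : (1 < n)%N.

Let n_gt0 : (0 < n)%N. Proof. exact: ltnW. Qed.

Lemma range_itv x : frac1 n <= x <= 1 - frac0 n ->
  [/\ 0 < x, x <= 1 - n%:R^-1, 0 < 1 - x & 1 - x <= 1 - n%:R^-1].
Proof.
have [a1 a2 a3] := frac0_bounds n_gt0; have [b1 b2 b3] := frac1_bounds n_gt0.
have i0 : 0 < n%:R^-1 :> R by rewrite invr_gt0 ltr0n.
by move=> /andP[? ?]; split; lra.
Qed.

Lemma range_in_S x : frac1 n <= x <= 1 - frac0 n -> in_S g0 g1 x.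
Proof.
have [a1 a2 a3] := frac0_bounds n_gt0; have [b1 b2 b3] := frac1_bounds n_gt0.
by move=> /andP[? ?]; apply/andP; split; lra.
Qed.

Lemma up_arg_itv x : frac1 n <= x <= 1 - frac0 n -> 0 < bn n * x <= 1.
Proof.
move=> /range_itv[x0 x1 _ _]; have /andP[a ->] := bn_itv n_gt1 x0 x1.
by rewrite andbT (lt_le_trans x0).
Qed.

Lemma down_arg_itv x : frac1 n <= x <= 1 - frac0 n -> 0 < bn n * (1 - x) <= 1.
Proof.
move=> /range_itv[_ _ x0 x1]; have /andP[a ->] := bn_itv n_gt1 x0 x1.
by rewrite andbT (lt_le_trans x0).
Qed.

Lemma up_rate_itv x : frac1 n <= x <= 1 - frac0 n -> 0 <= up_rate n x <= 1.
Proof.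
move=> xr; have /andP[x1 x2] := xr; have [y1 y2 y3 y4] := range_itv xr.
have /andP[u0 u1] := up_arg_itv xr; have u01 : 0 <= bn n * x <= 1 by rewrite (ltW u0).
have [_ _ i0] := frac0_bounds n_gt0.
have iv : 0 < n%:R^-1 :> R by rewrite invr_gt0 ltr0n.
rewrite mulr_ge0 ?Pk_ge0 //=; last by lra.
by rewrite mulr_ile1 ?Pk_ge0 ?Pk_le1 //; lra.
Qed.

Lemma down_rate_itv x : frac1 n <= x <= 1 - frac0 n -> 0 <= down_rate n x <= 1.
Proof.
move=> xr; have /andP[x1 x2] := xr; have [y1 y2 y3 y4] := range_itv xr.
have /andP[u0 u1] := down_arg_itv xr.
have u01 : 0 <= bn n * (1 - x) <= 1 by rewrite (ltW u0).
have [_ _ i0] := frac1_bounds n_gt0.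
have iv : 0 < n%:R^-1 :> R by rewrite invr_gt0 ltr0n.
rewrite mulr_ge0 ?Pk_ge0 //=; last by lra.
by rewrite mulr_ile1 ?Pk_ge0 ?Pk_le1 //; lra.
Qed.

Lemma up_rate_ge x a : 0 <= a -> a <= 1 - x - frac0 n ->
  frac1 n <= x <= 1 - frac0 n -> a * g1 ^+ (2 * k) <= up_rate n x.
Proof.
move=> a0 ax xr; have [y1 y2 y3 y4] := range_itv xr.
have /andP[u0 u1] := up_arg_itv xr; have u01 : 0 <= bn n * x <= 1 by rewrite (ltW u0).
have [b1 _ _] := frac1_bounds n_gt0; have [_ g1_gt0 _] := gamma_bounds gamma.
have /andP[c1 _] := bn_itv n_gt1 y1 y2; have /andP[d1 _] := xr.
rewrite /up_rate ler_pM ?exprn_ge0 ?(ltW g1_gt0) //.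
apply: le_trans (Pk_ge_pow k_gt0 u01).
by rewrite lerXn2r ?nnegrE ?(ltW g1_gt0) ?(ltW u0) //; lra.
Qed.

Lemma down_rate_ge x a : 0 <= a -> a <= x - frac1 n ->
  frac1 n <= x <= 1 - frac0 n -> a * g0 ^+ (2 * k) <= down_rate n x.
Proof.
move=> a0 ax xr; have [y1 y2 y3 y4] := range_itv xr.
have /andP[u0 u1] := down_arg_itv xr.
have u01 : 0 <= bn n * (1 - x) <= 1 by rewrite (ltW u0).
have [b1 _ _] := frac0_bounds n_gt0; have [g0_gt0 _ _] := gamma_bounds gamma.
have /andP[c1 _] := bn_itv n_gt1 y3 y4; have /andP[_ d1] := xr.
rewrite /down_rate ler_pM ?exprn_ge0 ?(ltW g0_gt0) //.
apply: le_trans (Pk_ge_pow k_gt0 u01).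
by rewrite lerXn2r ?nnegrE ?(ltW g0_gt0) ?(ltW u0) //; lra.
Qed.

End FixedSize.

(** Rounding the numbers of stubborn agents and rescaling the argument by
    [n / (n - 1)] both cost [O(1 / n)]. *)
Lemma drift_error : exists2 L : R, 0 <= L & forall n x, (1 < n)%N ->
  frac1 n <= x <= 1 - frac0 n ->
  `|up_rate n x - down_rate n x - (Delta k g0 g1).[x]| <= L * n%:R^-1.
Proof.
have [C C0 hC] := poly_lipschitz P; exists (4 * C + 2); first by rewrite addr_ge0 ?mulr_ge0.
move=> n x n1 xr; have n0 : (0 < n)%N by exact: ltnW.
have [y1 y2 y3 y4] := range_itv n1 xr.
have [a1 a2 a3] := frac0_bounds n0; have [b1 b2 b3] := frac1_bounds n0.
have iv : 0 < n%:R^-1 :> R by rewrite invr_gt0 ltr0n.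
have /andP[u0 u1] := up_arg_itv n1 xr; have u01 : 0 <= bn n * x <= 1 by rewrite (ltW u0).
have /andP[v0 v1] := down_arg_itv n1 xr.
have v01 : 0 <= bn n * (1 - x) <= 1 by rewrite (ltW v0).
have x01 : 0 <= x <= 1 by apply/andP; split; lra.
have x01' : 0 <= 1 - x <= 1 by apply/andP; split; lra.
have /andP[x1 x2] := xr.
have lip y : 0 <= y <= 1 -> 0 <= bn n * y <= 1 ->
    `|P.[bn n * y] - P.[y]| <= 2 * C * n%:R^-1.
  move=> y01 by01; apply: le_trans (hC _ _ by01 y01) _.
  rewrite (_ : 2 * C * n%:R^-1 = C * (2 / n%:R)); last by ring.
  by rewrite ler_wpM2l // bn_dist.
rewrite horner_Delta /up_rate /down_rate.
have -> : (1 - x - frac0 n) * P.[bn n * x] - (x - frac1 n) * P.[bn n * (1 - x)]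
    - ((1 - x - g0) * P.[x] - (x - g1) * P.[1 - x])
  = ((1 - x - frac0 n) * (P.[bn n * x] - P.[x]) + (g0 - frac0 n) * P.[x])
    - ((x - frac1 n) * (P.[bn n * (1 - x)] - P.[1 - x]) + (g1 - frac1 n) * P.[1 - x]).
  by ring.
have part (a e p d : R) : 0 <= a <= 1 -> `|e| <= n%:R^-1 -> 0 <= p <= 1 ->
    `|d| <= 2 * C * n%:R^-1 -> `|a * d + e * p| <= (2 * C + 1) * n%:R^-1.
  move=> /andP[a0 a1'] en /andP[p0 p1] dn.
  apply: le_trans (ler_normD _ _) _; rewrite !normrM mulrDl mul1r.
  rewrite (ger0_norm a0) (ger0_norm p0) lerD //.
    by apply: le_trans dn; rewrite ler_piMl.
  by apply: le_trans en; rewrite ler_piMr.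
have -> : (4 * C + 2) * n%:R^-1 = (2 * C + 1) * n%:R^-1 + (2 * C + 1) * n%:R^-1 :> R by ring.
apply: le_trans (ler_normB _ _) (lerD _ _); apply: part; rewrite ?lip ?Pk_ge0 ?Pk_le1 //.
- by apply/andP; split; lra.
- by rewrite ler_norml; apply/andP; split; lra.
- by apply/andP; split; lra.
- by rewrite ler_norml; apply/andP; split; lra.
Qed.

End Rates.

Section ModelChain.
Context {R : realType}.
Variables (k : nat) (g0 g1 : R) (n : nat).
Hypothesis k_gt0 : (0 < k)%N.
Hypothesis gamma : in_Gamma g0 g1.
Hypothesis n_gt1 : (1 < n)%N.
Hypothesis stubborn_le : (N0 g0 n + N1 g1 n <= n)%N.

Local Notation m := (nstates g0 g1 n).
Local Notation Q := (generator k g0 g1 n).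
Local Notation grid := (grid g1 n).

Let n_gt0 : (0 < n)%N. Proof. exact: ltnW. Qed.
Let nR_gt0 : 0 < n%:R :> R. Proof. by rewrite ltr0n ltnW. Qed.

Definition birth (i : nat) : R := qplus k g0 n (grid i).
Definition death (i : nat) : R := qminus k g1 n (grid i).

Lemma birthE i : birth i = n%:R * up_rate k g0 n (grid i).
Proof. by rewrite /birth /qplus /up_rate [RHS]mulrA. Qed.

Lemma deathE i : death i = n%:R * down_rate k g1 n (grid i).
Proof. by rewrite /death /qminus /down_rate [RHS]mulrA. Qed.

Lemma generatorE : Q = birth_death_gen m birth death.
Proof. by apply/matrixP => i j; rewrite !mxE. Qed.

Lemma gridS i : grid i.+1 = grid i + n%:R^-1.
Proof. by rewrite /grid addnS -natr1 mulrDl mul1r. Qed.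

Lemma gridE i : grid i = frac1 g1 n + i%:R * n%:R^-1.
Proof. by rewrite /grid natrD mulrDl. Qed.

Lemma grid_range i : (i < m)%N -> frac1 g1 n <= grid i <= 1 - frac0 g0 n.
Proof.
rewrite /nstates => im; apply/andP; split.
  by rewrite gridE lerDl mulr_ge0 // invr_ge0 ler0n.
rewrite lerBrDr /grid /frac0 -mulrDl ler_pdivrMr // mul1r -natrD ler_nat.
by move: im stubborn_le; clear; lia.
Qed.

Lemma grid_last i : i.+1 = m -> grid i = 1 - frac0 g0 n.
Proof.
move=> im; apply/eqP; rewrite -subr_eq0 opprB addrA subr_eq0 /grid /frac0 -mulrDl -natrD.
have -> : (N1 g1 n + i + N0 g0 n)%N = n by move: im stubborn_le; rewrite /nstates; clear; lia.
by rewrite mulfV ?lt0r_neq0.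
Qed.

Lemma death0 : death 0 = 0.
Proof. by rewrite deathE /down_rate gridE mul0r addr0 subrr mul0r mulr0. Qed.

Lemma birth_last i : i.+1 = m -> birth i = 0.
Proof. by move=> /grid_last e; rewrite birthE /up_rate e subKr subrr mul0r mulr0. Qed.

Lemma birth_gt0 i : (i.+1 < m)%N -> 0 < birth i.
Proof.
move=> im; rewrite birthE mulr_gt0 // mulr_gt0 //.
  have /andP[_] := grid_range im; rewrite gridS.
  have : 0 < n%:R^-1 :> R by rewrite invr_gt0.
  lra.
by rewrite Pk_gt0 // (up_arg_itv gamma) // grid_range // ltnW.
Qed.

Lemma death_gt0 i : (i.+1 < m)%N -> 0 < death i.+1.
Proof.
move=> im; rewrite deathE mulr_gt0 // mulr_gt0 //.
  rewrite gridE addrC addKr mulr_gt0 ?ltr0n //.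
  by rewrite invr_gt0.
by rewrite Pk_gt0 // (down_arg_itv gamma) // grid_range.
Qed.

Lemma rates_itv i : (i < m)%N -> 0 <= birth i <= n%:R /\ 0 <= death i <= n%:R.
Proof.
move=> /grid_range ir; rewrite birthE deathE.
have /andP[a b] := up_rate_itv k_gt0 gamma n_gt1 ir.
have /andP[c d] := down_rate_itv k_gt0 gamma n_gt1 ir.
have n0 : 0 <= n%:R :> R by exact: ltW.
split; apply/andP; split; try exact: mulr_ge0; by rewrite ler_piMr.
Qed.

Lemma generator_offdiag (i j : 'I_m) : i != j -> 0 <= Q i j.
Proof.
move=> ij; rewrite generatorE mxE.
have [/andP[a _] /andP[b _]] := rates_itv (ltn_ord i).
by case: ifP => _ //; case: ifP => _ //; rewrite (negbTE ij).
Qed.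

Lemma generator_sum (i : 'I_m) : \sum_j Q i j = 0.
Proof.
have := birth_death_act death0 birth_last (fun=> 1) i; rewrite -generatorE /mx_act.
by under eq_bigr do rewrite mulr1; move->; rewrite subrr !mulr0 addr0.
Qed.

(** The total rate is at most [2 n]; uniformization at the rate [4 n] therefore
    gives a lazy kernel. *)
Lemma generator_diag (i : 'I_m) : - Q i i <= (4 * n%:R) / 2.
Proof.
rewrite generatorE mxE (ltn_eqF (ltnSn i)) eqxx opprK.
have [/andP[_ a] /andP[_ b]] := rates_itv (ltn_ord i); lra.
Qed.

Lemma generator_rate_ge1 : 1 <= 4 * n%:R :> R.
Proof. by have : 1 <= n%:R :> R; [rewrite ler1n | lra]. Qed.

Lemma generator_act (G : nat -> R) (i : 'I_m) :
  mx_act Q (fun j => G j) i = birth i * (G i.+1 - G i) + death i * (G i.-1 - G i).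
Proof. by rewrite generatorE birth_death_act //; [exact: death0|exact: birth_last]. Qed.

End ModelChain.

Lemma right_state_arith (a b c n : nat) :
  (b <= a)%N -> (a + c <= n)%N -> (a - b < n.+1 - (c + b))%N.
Proof. lia. Qed.

Section CriticalModel.
Context {R : realType}.
Variables (k : nat) (g0 g1 : R).
Hypothesis k_gt0 : (0 < k)%N.
Hypothesis gamma : in_Gamma g0 g1.

Lemma stubborn_le_near : exists2 e : R, 0 < e & forall n, (0 < n)%N -> n%:R^-1 <= e ->
  (1 < n)%N /\ (N0 g0 n + N1 g1 n <= n)%N.
Proof.
have [g0_gt0 g1_gt0 g_lt1] := gamma_bounds gamma.
exists ((1 - g0 - g1) / 2); first by rewrite divr_gt0 //; lra.
move=> n n0 ne; have nR : 0 < n%:R :> R by rewrite ltr0n.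
have i1 : n%:R * n%:R^-1 = 1 :> R by rewrite mulfV // lt0r_neq0.
split.
  rewrite -(ltr_nat R); have : n%:R * n%:R^-1 <= n%:R * ((1 - g0 - g1) / 2) by rewrite ler_wpM2l // ltW.
  rewrite i1; nra.
have [_ a _] := frac0_bounds gamma n0; have [_ b _] := frac1_bounds gamma n0.
have ab : frac0 g0 n + frac1 g1 n <= 1 by lra.
move: ab; rewrite /frac0 /frac1 -mulrDl ler_pdivrMr // mul1r -natrD ler_nat //.
Qed.

(** [stubborn n y] is the ceiling of [n * y], and the index [i] stands for the
    state [(N1 + i) / n]: this is the first state that is at least [y]. *)
Definition right_state n (y : R) : nat := (stubborn n y - N1 g1 n)%N.

Lemma right_stateP y : g1 < y < 1 - g0 -> exists2 e : R, 0 < e &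
  forall n, (0 < n)%N -> n%:R^-1 <= e ->
  [/\ (right_state n y < nstates g0 g1 n)%N, y <= grid g1 n (right_state n y) &
      grid g1 n (right_state n y) < y + n%:R^-1].
Proof.
move=> /andP[gy yg]; have [g0_gt0 g1_gt0 g_lt1] := gamma_bounds gamma.
pose e := Num.min (y - g1) ((1 - g0 - y) / 2).
have e0 : 0 < e by rewrite lt_min subr_gt0 gy divr_gt0 //; lra.
exists e => // n n0; rewrite le_min => /andP[ne1 ne2].
have nR : 0 < n%:R :> R by rewrite ltr0n.
have y0 : 0 < y by lra.
have [_ a _] := frac0_bounds gamma n0; have [_ b _] := frac1_bounds gamma n0.
have [c1 c2 _] := frac_bounds n0 y0.
have le1 : (N1 g1 n <= stubborn n y)%N.
  have : frac1 g1 n <= (stubborn n y)%:R / n%:R by lra.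
  by rewrite /frac1 ler_pM2r ?invr_gt0 // ler_nat.
have le2 : (stubborn n y + N0 g0 n <= n)%N.
  have : (stubborn n y)%:R / n%:R + frac0 g0 n <= 1 by lra.
  by rewrite /frac0 -mulrDl ler_pdivrMr // mul1r -natrD ler_nat.
have gE : grid g1 n (right_state n y) = (stubborn n y)%:R / n%:R.
  by rewrite /grid /right_state subnKC.
by rewrite gE; split=> //; exact: right_state_arith le1 le2.
Qed.

Variables (kap : nat) (r r2 p : R).
Hypothesis crit : critical_drift k g0 g1 kap.+2 r r2 p.

(** What [barrier_drift] needs on the left of [r]. On the right, the reflection
    [x -> 1 - x] exchanges the two rates. *)
Lemma drift_left : exists c P0 L : R, [/\ 0 < c, 0 < P0, 0 <= L &
  exists2 e : R, 0 < e & forall n x, (0 < n)%N -> n%:R^-1 <= e ->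
    frac1 g1 n <= x <= 1 - frac0 g0 n -> x < r ->
    P0 <= up_rate k g0 n x <= 1 /\
    c * ((r - x) ^+ kap.+2 * (x - r2) ^+ 2) - L * n%:R^-1
      <= up_rate k g0 n x - down_rate k g1 n x].
Proof.
have [/andP[gr rg] _ _ [[c c0 hc] _]] := crit.
have [L L0 hL] := drift_error k_gt0 gamma.
have [g0_gt0 g1_gt0 g_lt1] := gamma_bounds gamma.
have [e e0 he] := stubborn_le_near.
pose a := (1 - g0 - r) / 2; have a0 : 0 < a by rewrite divr_gt0 //; lra.
exists c, (a * g1 ^+ (2 * k)), L; split=> //; first by rewrite mulr_gt0 ?exprn_gt0.
exists (Num.min e a); first by rewrite lt_min e0.
move=> n x n0; rewrite le_min => /andP[/(he n n0)[n1 Nn] na] xr xlt.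
have [b1 b2 b3] := frac0_bounds gamma n0.
split.
  rewrite (up_rate_ge k_gt0 gamma) // ?(ltW a0) //; last by rewrite /a in na *; lra.
  by have /andP[] := up_rate_itv k_gt0 gamma n1 xr.
have := hL n x n1 xr; rewrite ler_norml => /andP[lo _].
have [/(_ xlt) d _] := hc x (range_in_S gamma n1 xr); lra.
Qed.

Lemma drift_right : exists c P0 L : R, [/\ 0 < c, 0 < P0, 0 <= L &
  exists2 e : R, 0 < e & forall n x, (0 < n)%N -> n%:R^-1 <= e ->
    frac1 g1 n <= x <= 1 - frac0 g0 n -> r < x ->
    P0 <= down_rate k g1 n x <= 1 /\
    c * ((x - r) ^+ kap.+2 * (x - r2) ^+ 2) - L * n%:R^-1
      <= down_rate k g1 n x - up_rate k g0 n x].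
Proof.
have [/andP[gr rg] _ _ [[c c0 hc] _]] := crit.
have [L L0 hL] := drift_error k_gt0 gamma.
have [g0_gt0 g1_gt0 g_lt1] := gamma_bounds gamma.
have [e e0 he] := stubborn_le_near.
pose a := (r - g1) / 2; have a0 : 0 < a by rewrite divr_gt0 //; lra.
exists c, (a * g0 ^+ (2 * k)), L; split=> //; first by rewrite mulr_gt0 ?exprn_gt0.
exists (Num.min e a); first by rewrite lt_min e0.
move=> n x n0; rewrite le_min => /andP[/(he n n0)[n1 Nn] na] xr xlt.
have [b1 b2 b3] := frac1_bounds gamma n0.
split.
  rewrite (down_rate_ge k_gt0 gamma) // ?(ltW a0) //; last by rewrite /a in na *; lra.
  by have /andP[] := down_rate_itv k_gt0 gamma n1 xr.
have := hL n x n1 xr; rewrite ler_norml => /andP[_ hi].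
have [_ /(_ xlt) d] := hc x (range_in_S gamma n1 xr); lra.
Qed.

End CriticalModel.

(** * Time to reach the attracting root *)

Lemma rev_index_arith M z j : (j < M - z)%N -> (M - z - j.+1 + z).+1 = (M - j)%N.
Proof. lia. Qed.

Section CriticalScale.
Context {R : realType}.
Variables (k : nat) (g0 g1 : R).
Hypothesis k_gt0 : (0 < k)%N.
Hypothesis gamma : in_Gamma g0 g1.
Variables (kap : nat) (r r2 p : R).
Hypothesis crit : critical_drift k g0 g1 kap.+2 r r2 p.

Local Notation m n := (nstates g0 g1 n).
Local Notation Q n := (generator k g0 g1 n).
Local Notation grid n := (grid g1 n).

Lemma cube_root (h : R) : 0 < h -> exists2 s : R, 0 < s & s ^+ 3 = h.
Proof.
move=> h0; exists (h `^ 3^-1); first exact: powR_gt0.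
rewrite -powR_mulrn ?powR_ge0 // -powRrM mulVf ?powRr1 ?(ltW h0) //.
Qed.

Lemma grid_ltn n i j : (i < j)%N -> grid n i + n%:R^-1 <= grid n j.
Proof.
move=> ij; by rewrite -gridS !gridE lerD2l ler_wpM2r ?invr_ge0 ?ler0n // ler_nat.
Qed.

(** Here [z] is a state next to [r], [pi] is the stationary distribution, and [g]
    is up to a constant the expected time to reach [z]. The barrier for the drift,
    and its mirror image on the right of [r], bound the increments of [g]. *)
Lemma critical_hitting : exists e C : R, [/\ 0 < e, 0 < C &
  forall n s, (0 < n)%N -> n%:R^-1 <= e -> 0 < s -> s <= 1 -> s ^+ kap.+3 = n%:R^-1 ->
  [/\ (1 < n)%N, (N0 g0 n + N1 g1 n <= n)%N &
  exists (z : 'I_(m n)) (pi g : 'I_(m n) -> R),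
  [/\ r - n%:R^-1 < grid n z < r + n%:R^-1,
      (forall i, 0 < pi i) /\ \sum_i pi i = 1,
      forall i j, pi i * Q n i j = pi j * Q n j i,
      forall i, mx_act (Q n) g i = (i == z)%:R / pi z - 1 &
      forall i, 0 <= g i - g z <= C / s ^+ kap.+1]]].
Proof.
have [rint _ rr2 _] := crit.
have [cl [Pl [Ll [cl0 Pl0 Ll0 [el el0 hl]]]]] := drift_left k_gt0 gamma crit.
have [cr [Pr [Lr [cr0 Pr0 Lr0 [er er0 hr]]]]] := drift_right k_gt0 gamma crit.
have [es es0 hs] := stubborn_le_near gamma.
have [ez ez0 hz] := right_stateP gamma rint.
have [bl [Al [dl [Al0 dl0 dl1 barl]]]] := barrier_drift kap.+1 cl0 Pl0 Ll0 rr2.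
have rr2' : 1 - r != 1 - r2 by rewrite (inj_eq (subrI 1)).
have [br [Ar [dr [Ar0 dr0 dr1 barr]]]] := barrier_drift kap.+1 cr0 Pr0 Lr0 rr2'.
pose dd := Num.min dl dr; have dd0 : 0 < dd by rewrite lt_min dl0.
pose e := Num.min (Num.min (Num.min el er) (Num.min es ez)) (Num.min (dd ^+ 3) (dd ^+ kap.+3)).
have e0 : 0 < e by rewrite !lt_min el0 er0 es0 ez0 !exprn_gt0.
exists e, (16 * (Al + Ar)); split=> //; first by rewrite mulr_gt0 // addr_gt0.
move=> n s n0; rewrite !le_min => /andP[/andP[/andP[nel ner] /andP[nes nez]] /andP[nd3 ndk]].
move=> s0 s1 sE; have [n1 Nn] := hs n n0 nes; have [zm rz zr] := hz n n0 nez.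
split=> //; set h := n%:R^-1 in nel ner nes nez nd3 ndk sE zr *.
have nR : 0 < n%:R :> R by rewrite ltr0n.
have h0 : 0 < h by rewrite invr_gt0.
have nh : n%:R * h = 1 by rewrite mulfV // lt0r_neq0.
have [t t0 tE] := cube_root h0.
have td : t <= dd by rewrite -(@ler_pXn2r _ 3) ?nnegrE ?(ltW t0) ?(ltW dd0) // tE.
have sd : s <= dd by rewrite -(@ler_pXn2r _ kap.+3) ?nnegrE ?(ltW s0) ?(ltW dd0) // sE.
have [tl tr] : t <= dl /\ t <= dr by move: td; rewrite le_min => /andP[].
have [sl sr] : s <= dl /\ s <= dr by move: sd; rewrite le_min => /andP[].
pose Wl x := Al * barrier kap.+2 r (r2 + bl * t) t s x.
pose Wr x := Ar * barrier kap.+2 (1 - r) (1 - r2 + br * t) t s x.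
pose wl i := h * Wl (grid n i); pose wr i := h * Wr (1 - grid n i).
set z := right_state g1 n r in zm rz zr.
have left i : (i < z)%N -> grid n i < r.
  by move=> iz; have := grid_ltn n iz; rewrite -/h; lra.
have right i : (z < i)%N -> r < grid n i.
  by move=> iz; have := grid_ltn n iz; rewrite -/h; lra.
have range i : (i < m n)%N -> frac1 g1 n <= grid n i <= 1 - frac0 g0 n.
  exact: grid_range.
have scale x y : n%:R * x * (h * y) = x * y.
  by rewrite mulrACA nh mul1r.
have wl_drift i : (i < z)%N -> 1 + death k g1 n i * wl i.-1 <= birth k g0 g1 n i * wl i.
  move=> iz; have im := ltn_trans iz zm; have [Pi Di] := hl n _ n0 nel (range i im) (left i iz).
  have := barl h t s (grid n i) _ _ (esym tE) (esym sE) _ _ (left i iz) Pi Di.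
  rewrite t0 tl s0 sl => /(_ isT isT).
  rewrite birthE deathE /wl !scale subKr -/(Wl _) -/(Wl _).
  case: i {iz im Pi Di} => [|i]; last by rewrite gridS addrK.
  move=> H; apply: le_trans H; rewrite lerD2l.
  by rewrite /down_rate gridE mul0r addr0 subrr !mul0r.
have wr_drift i : (z < i < m n)%N -> 1 + birth k g0 g1 n i * wr i.+1 <= death k g1 n i * wr i.
  move=> /andP[zi im]; have [Pi Di] := hr n _ n0 ner (range i im) (right i zi).
  have xr : 1 - grid n i < 1 - r by have := right i zi; lra.
  have Di' : cr * ((1 - r - (1 - grid n i)) ^+ kap.+2 * (1 - grid n i - (1 - r2)) ^+ 2)
      - Lr * h <= down_rate k g1 n (grid n i) - up_rate k g0 n (grid n i).
    have -> : 1 - r - (1 - grid n i) = grid n i - r by ring.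
    have -> : (1 - grid n i - (1 - r2)) ^+ 2 = (grid n i - r2) ^+ 2 by ring.
    exact: Di.
  have := barr h t s (1 - grid n i) _ _ (esym tE) (esym sE) _ _ xr Pi Di'.
  rewrite t0 tr s0 sr => /(_ isT isT).
  rewrite birthE deathE /wr !scale subKr -/(Wr _) -/(Wr _).
  by rewrite gridS -/h opprD addrA.
have Wl_ge0 x : x <= r -> 0 <= Wl x.
  by move=> xr; rewrite mulr_ge0 ?(ltW Al0) ?(ltW (barrier_gt0 _ _ t0 s0 xr)).
have Wr_ge0 x : x <= 1 - r -> 0 <= Wr x.
  by move=> xr; rewrite mulr_ge0 ?(ltW Ar0) ?(ltW (barrier_gt0 _ _ t0 s0 xr)).
have wl_ge0 i : (i < z)%N -> 0 <= wl i.
  by move=> /left iz; rewrite mulr_ge0 ?(ltW h0) // Wl_ge0 // ltW.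
have wr_ge0 i : (z < i < m n)%N -> 0 <= wr i.
  by move=> /andP[/right iz _]; rewrite mulr_ge0 ?(ltW h0) // Wr_ge0 //; lra.
pose H := 16 * (Al + Ar) / s ^+ kap.+1.
have sk : 0 < s ^+ kap.+1 by exact: exprn_gt0.
have wl_sum : \sum_(0 <= i < z) wl i <= H.
  have := barrier_sum (r2 + bl * t) t0 s0 s1 h0 (esym tE) (esym sE)
    (a := frac1 g1 n) (r := r) (N := z).
  have l j : (j < z)%N -> frac1 g1 n + j%:R * h < r.
    by move=> /left; rewrite gridE.
  move=> /(_ l) B; apply: (@le_trans _ _ (Al * (16 / s ^+ kap.+1))).
    apply: le_trans (ler_wpM2l (ltW Al0) B); rewrite mulr_sumr; apply: ler_sum => i _.
    by rewrite /wl /Wl gridE -/h mulrCA.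
  rewrite /H mulrCA -!mulrA ler_wpM2l // ler_wpM2r ?invr_ge0 ?(ltW sk) //.
  by rewrite lerDl ltW.
have wr_sum : \sum_(z <= i < (m n).-1) wr i.+1 <= H.
  pose N := ((m n).-1 - z)%N.
  have := barrier_sum (1 - r2 + br * t) t0 s0 s1 h0 (esym tE) (esym sE)
    (a := frac0 g0 n) (r := 1 - r) (N := N).
  have mpos : (0 < m n)%N by exact: leq_ltn_trans zm.
  have refl j : (j < N)%N -> 1 - grid n ((m n).-1 - j)%N = frac0 g0 n + j%:R * h.
    move=> jN; have jm : (j <= (m n).-1)%N := leq_trans (ltnW jN) (leq_subr _ _).
    have gl := grid_last n1 Nn (prednK mpos).
    have e1 : grid n (m n).-1 = grid n ((m n).-1 - j)%N + j%:R * h.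
      by rewrite !gridE natrB // -/h; ring.
    lra.
  have l j : (j < N)%N -> frac0 g0 n + j%:R * h < 1 - r.
    move=> jN; rewrite -refl // ltrD2l ltrN2; apply: right.
    by rewrite ltn_subRL addnC -ltn_subRL.
  move=> /(_ l) B; apply: (@le_trans _ _ (Ar * (16 / s ^+ kap.+1))).
    apply: le_trans (ler_wpM2l (ltW Ar0) B).
    rewrite -{1}[z]add0n big_addn big_nat_rev /= add0n mulr_sumr.
    rewrite big_nat [leRHS]big_nat; apply: ler_sum => j /andP[_ jN].
    have -> : (N - j.+1 + z).+1 = ((m n).-1 - j)%N by exact: rev_index_arith.
    by rewrite /wr /Wr refl // mulrCA.
  rewrite /H mulrCA -!mulrA ler_wpM2l // ler_wpM2r ?invr_ge0 ?(ltW sk) //.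
  by rewrite lerDr ltW.
exists (Ordinal zm), (fun i => bd_stat (m n) (birth k g0 g1 n) (death k g1 n) i),
  (fun i => mean_hitting (m n) (birth k g0 g1 n) (death k g1 n) z i).
have bp := birth_gt0 k_gt0 gamma n1 Nn.
have dp := death_gt0 k_gt0 gamma n1 Nn.
have d0 := death0 k g1 n.
have bl0 := birth_last k n1 Nn.
split.
- by move: rz zr h0; clear => *; apply/andP; split; rewrite /=; lra.
- split=> [i|]; first exact: bd_stat_gt0.
  by apply: bd_stat_sum => //; exact: leq_ltn_trans zm.
- by move=> i j; rewrite generatorE; exact: birth_death_reversible.
- by move=> i; rewrite generatorE; exact: mean_hitting_poisson.
- by move=> i; apply: (mean_hitting_itv _ _ _ _ _ wl_drift wr_drift).
Qed.

End CriticalScale.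

(** * Critical behaviour *)

Lemma grid_le_ltn {R : realType} (g0 g1 : R) n i : (0 < n)%N -> (N0 g0 n + N1 g1 n <= n)%N ->
  grid g1 n i <= 1 - frac0 g0 n -> (i < nstates g0 g1 n)%N.
Proof.
move=> n0 Nn; rewrite lerBrDr /grid /frac0 -mulrDl ler_pdivrMr ?ltr0n // mul1r.
rewrite -natrD ler_nat /nstates; move: Nn; clear; lia.
Qed.

Section CriticalEscape.
Context {R : realType}.
Variables (k : nat) (g0 g1 : R).
Hypothesis k_gt0 : (0 < k)%N.
Hypothesis gamma : in_Gamma g0 g1.
Variables (kap : nat) (r r2 p : R).
Hypothesis kap_le1 : (kap <= 1)%N.
Hypothesis crit : critical_drift k g0 g1 kap.+2 r r2 p.

Local Notation m n := (nstates g0 g1 n).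
Local Notation Q n := (generator k g0 g1 n).
Local Notation grid n := (grid g1 n).

(** Two starting states next to the root [p], more than [2 * s] apart: the
    displacement from either of them grows in mean at speed [O(s ^ kap.+1)], and
    no state is within [s] of both. *)
Lemma critical_escape : exists e c : R, [/\ 0 < e, 0 < c &
  forall n s t, (0 < n)%N -> n%:R^-1 <= e -> 0 < s -> s <= 1 -> s ^+ kap.+3 = n%:R^-1 ->
  0 <= t -> tv_dist (Q n) t <= 4^-1 -> c / s ^+ kap.+1 <= t].
Proof.
have [_ pint _ [_ [C C0 hC]]] := crit.
have [L L0 hL] := drift_error k_gt0 gamma.
have [es es0 hs] := stubborn_le_near gamma.
have [ez ez0 hz] := right_stateP gamma pint.
have /andP[gp pg] := pint.
pose dd := (1 - g0 - p) / 5; have dd0 : 0 < dd by rewrite divr_gt0 //; lra.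
pose e := Num.min (Num.min es ez) (dd ^+ kap.+3).
have e0 : 0 < e by rewrite !lt_min es0 ez0 exprn_gt0.
pose B := 2 * 5 ^+ kap.+2 * C + L + 12.
have B0 : 0 < B.
  rewrite ltr_wpDl // addr_ge0 // mulr_ge0 // mulr_ge0 // exprn_ge0 //.
exists e, (8 * B)^-1; split=> //; first by rewrite invr_gt0 mulr_gt0.
move=> n s t n0; rewrite !le_min => /andP[/andP[nes nez] ndk] s0 s1 sE t0 tv.
have [n1 Nn] := hs n n0 nes; have [im pz zp] := hz n n0 nez.
set h := n%:R^-1 in nes nez ndk sE zp.
have nR : 0 < n%:R :> R by rewrite ltr0n.
have h0 : 0 < h by rewrite invr_gt0.
have nh : n%:R * h = 1 by rewrite mulfV // lt0r_neq0.
have sd : s <= dd by rewrite -(@ler_pXn2r _ kap.+3) ?nnegrE ?(ltW s0) ?(ltW dd0) // sE.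
have hs' : h <= s by rewrite -sE -[leRHS]expr1 ler_wiXn2l // ltW.
set i0 := right_state g1 n p in im pz zp.
pose u := (Num.truncn (2 * s * n%:R)).+1; pose i1 := (i0 + u)%N.
have d1 : grid n i0 + 2 * s < grid n i1 <= grid n i0 + 2 * s + h.
  have a : 2 * s < u%:R * h by rewrite ltr_pdivlMr // truncnS_gt.
  have b : u%:R * h <= 2 * s + h.
    rewrite -[u]addn1 natrD mulrDl mul1r lerD2r ler_pdivrMr // truncn_le //.
    by rewrite !mulr_ge0 // ltW.
  have e1 : grid n i1 = grid n i0 + u%:R * h by rewrite !gridE natrD mulrDl addrA.
  by rewrite e1 -addrA ltrD2l lerD2l a.
have /andP[d1l d1u] := d1.
have [_ f0 _] := frac0_bounds gamma n0; rewrite -/h in f0.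
have im1 : (i1 < m n)%N.
  by apply: grid_le_ltn => //; rewrite /dd in sd; lra.
pose f x0 (j : nat) := displacement s (grid n j - x0).
have drift x0 (i : 'I_(m n)) : `|x0 - p| <= 4 * s ->
    mx_act (Q n) (fun j => f x0 j) i <= B * s ^+ kap.+1.
  move=> x0p; rewrite generator_act // birthE deathE /f.
  set v := grid n i - x0.
  have e1 : grid n i.+1 - x0 = v + h by rewrite gridS /v -/h; ring.
  have ir := grid_range n1 Nn (ltn_ord i).
  have e2 : n%:R * down_rate k g1 n (grid n i) * (displacement s (grid n i.-1 - x0) - displacement s v)
     = n%:R * down_rate k g1 n (grid n i) * (displacement s (v - h) - displacement s v).
    rewrite /v; case: (i : nat) => [|j] /=; last by rewrite gridS addrAC -/h addrK.
    by rewrite /down_rate gridE mul0r addr0 subrr mul0r mulr0 !mul0r.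
  rewrite e1 e2 -!(mulrA n%:R) -mulrDr.
  have av : `|grid n i - p| <= `|v| + 4 * s.
    have := ler_distD x0 (grid n i) p; rewrite -/v; lra.
  have PM : `|up_rate k g0 n (grid n i) - down_rate k g1 n (grid n i)|
      <= C * `|grid n i - p| ^+ kap.+2 + L * h.
    have a := hL n _ n1 ir; have b := hC _ (range_in_S gamma n1 ir).
    rewrite -(subrK (Delta k g0 g1).[grid n i] (_ - _)) addrC.
    by apply: le_trans (ler_normD _ _) _; exact: lerD.
  have := displacement_drift (v := v) (a := `|grid n i - p|) kap_le1 s0 s1 (esym sE)
    (up_rate_itv k_gt0 gamma n1 ir) (down_rate_itv k_gt0 gamma n1 ir) C0 L0 _ PM.
  rewrite normr_ge0 av => /(_ isT) D.
  apply: (le_trans (ler_wpM2l (ltW nR) D)).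
  by rewrite mulrA nh mul1r.
have bp := birth_gt0 k_gt0 gamma n1 Nn.
have dp := death_gt0 k_gt0 gamma n1 Nn.
have pi0 (i : 'I_(m n)) : 0 < bd_stat (m n) (birth k g0 g1 n) (death k g1 n) i.
  exact: bd_stat_gt0.
have pi1 : \sum_(i < m n) bd_stat (m n) (birth k g0 g1 n) (death k g1 n) i = 1.
  by apply: bd_stat_sum => //; exact: leq_ltn_trans im.
have pirev (i j : 'I_(m n)) : bd_stat (m n) (birth k g0 g1 n) (death k g1 n) i * Q n i j
    = bd_stat (m n) (birth k g0 g1 n) (death k g1 n) j * Q n j i.
  by rewrite generatorE; exact: birth_death_reversible.
have near0 : `|grid n i0 - p| <= 4 * s.
  by move: s0 pz zp hs'; clear => *; rewrite ger0_norm; lra.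
have near1 : `|grid n i1 - p| <= 4 * s.
  by move: s0 pz zp hs' d1l d1u; clear => *; rewrite ger0_norm; lra.
have := tv_dist_two_starts (generator_offdiag k_gt0 gamma n1 Nn)
  (generator_sum k n1 Nn) (generator_rate_ge1 n1)
  (generator_diag k_gt0 gamma n1 Nn) pi0 pi1 pirev
  (x := Ordinal im) (y := Ordinal im1)
  (fx := fun i => f (grid n i0) i) (fy := fun i => f (grid n i1) i)
  (B := B * s ^+ kap.+1) t0.
move=> /(_ _ _ _ _ _ _ _ tv) two.
have {two} : 8^-1 <= B * s ^+ kap.+1 * t.
  apply: two.
  - by rewrite /f subrr displacement0.
  - by rewrite /f subrr displacement0.
  - by move=> i; exact: displacement_ge0.
  - by move=> i; exact: displacement_ge0.
  - by move=> i; exact: drift.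
  - by move=> i; exact: drift.
  move=> i; have [si|si] := leP s `|grid n i - grid n i0|.
    by left; exact: displacement_ge_half.
  right; apply: displacement_ge_half => //.
  have := ler_distD (grid n i) (grid n i0) (grid n i1).
  rewrite distrC [`|grid n i0 - grid n i|]distrC [X in X <= _]ger0_norm; move: s0 si d1l; clear => *; lra.
have sk : 0 < s ^+ kap.+1 by exact: exprn_gt0.
move=> H; rewrite ler_pdivrMr // -[_^-1]mul1r ler_pdivrMr ?mulr_gt0 //.
have : 8 * 8^-1 <= 8 * (B * s ^+ kap.+1 * t) by rewrite ler_wpM2l.
by rewrite mulfV ?pnatr_eq0 // => H'; apply: le_trans H' _;
   rewrite le_eqVlt; apply/orP; left; apply/eqP; ring.
Qed.

End CriticalEscape.

Section Asymptotics.
Context {R : realType}.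
Local Open Scope ereal_scope.

Lemma extO_near (f g : nat -> \bar R) (C : R) :
  (\forall n \near \oo, f n / g n <= C%:E) -> extO f g.
Proof.
move=> fg; apply: (@le_lt_trans _ _ C%:E); last exact: ltry.
apply: ge_ereal_inf; exists (ereal_sup [set f n / g n | n in [set n | f n / g n <= C%:E]]).
  by exists [set n | f n / g n <= C%:E].
by apply: ge_ereal_sup => _ [n /= fn <-].
Qed.

Lemma npow_gt0 (a : R) n : (0 < n)%N -> (0 < n%:R `^ a)%R.
Proof. by move=> n0; rewrite powR_gt0 // ltr0n. Qed.

Lemma extO_le_npow (f : nat -> \bar R) (C a : R) :
  (\forall n \near \oo, f n <= (C * n%:R `^ a)%:E) -> extO f (npow a).
Proof.
move=> fC; apply: (@extO_near _ _ C); near=> n.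
have n0 : (0 < n)%N by near: n; exact: nbhs_infty_gt.
have p0 := npow_gt0 a n0.
rewrite /npow inver (gt_eqF p0) -(mulfK (lt0r_neq0 p0) C) EFinM.
apply: lee_wpmul2r; first by rewrite lee_fin invr_ge0 ltW.
by near: n.
Unshelve. all: by end_near. Qed.

Lemma extO_ge_npow (f : nat -> \bar R) (c a : R) : (0 < c)%R ->
  (\forall n \near \oo, (c * n%:R `^ a)%:E <= f n) -> extO (npow a) f.
Proof.
move=> c0 fc; apply: (@extO_near _ _ c^-1); near=> n.
have n0 : (0 < n)%N by near: n; exact: nbhs_infty_gt.
have p0 := npow_gt0 a n0; have cp : (0 < c * n%:R `^ a)%R by rewrite mulr_gt0.
have : (c * n%:R `^ a)%:E <= f n by near: n.
rewrite /npow; case: (f n) => [x| |]//; last first.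
  by rewrite invey mule0 lee_fin invr_ge0 (ltW c0).
rewrite lee_fin => cx; have x0 : (0 < x)%R by exact: lt_le_trans cx.
rewrite inver (gt_eqF x0) -EFinM lee_fin ler_pdivrMr // mulrC ler_pdivlMr //.
by rewrite mulrC.
Unshelve. all: by end_near. Qed.

End Asymptotics.

Lemma critical_length {R : realType} (kap n : nat) : (0 < n)%N ->
  exists s : R, [/\ 0 < s, s <= 1, s ^+ kap.+3 = n%:R^-1 &
    (s ^+ kap.+1)^-1 = n%:R `^ (kap.+1%:R / kap.+3%:R)].
Proof.
move=> n0; have nR : 1 <= n%:R :> R by rewrite ler1n.
have n0' : 0 < n%:R :> R by rewrite ltr0n.
have k3 : kap.+3%:R != 0 :> R by rewrite pnatr_eq0.
exists (n%:R `^ (- kap.+3%:R^-1)); split.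
- by rewrite powR_gt0.
- by rewrite powRN invf_le1 ?powR_gt0 // -[leLHS](powRr0 n%:R) ler_powR // invr_ge0.
- by rewrite -powR_mulrn ?powR_ge0 // -powRrM mulNr mulVf // powR_inv1 // ltW.
- by rewrite -powR_mulrn ?powR_ge0 // -powRrM mulNr powRN invrK mulrC.
Qed.

Lemma near_inv_le {R : realType} (e : R) : 0 < e ->
  \forall n \near \oo, (0 < n)%N /\ n%:R^-1 <= e.
Proof.
move=> e0; near=> n.
have n0 : (0 < n)%N by near: n; exact: nbhs_infty_gt.
split=> //; rewrite -[e]invrK lef_pV2 ?posrE ?invr_gt0 ?ltr0n //.
by near: n; exact: nbhs_infty_ger.
Unshelve. all: by end_near. Qed.

Section CriticalBehaviour.
Context {R : realType}.
Variables (k : nat) (g0 g1 : R).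
Hypothesis k_gt0 : (0 < k)%N.
Hypothesis gamma : in_Gamma g0 g1.
Variables (kap : nat) (r r2 p : R).
Hypothesis kap_le1 : (kap <= 1)%N.
Hypothesis crit : critical_drift k g0 g1 kap.+2 r r2 p.

Local Notation a := (kap.+1%:R / kap.+3%:R : R).

(** The state [z] is within [1 / n] of [r], hence in [B n]. *)
Lemma critical_mean_T_enter (B : nat -> set R) :
  (\forall n \near \oo, openball n%:R^-1 r `<=` B n) ->
  mean_T_enter_bigO k g0 g1 B a.
Proof.
move=> rB x d T P X chain.
have [e [C [e0 C0 hit]]] := critical_hitting k_gt0 gamma crit.
apply: (@extO_le_npow _ _ (2 * C) a); near=> n.
have [n0 ne] : (0 < n)%N /\ n%:R^-1 <= e by near: n; exact: near_inv_le.
have [s [s0 s1 sE sa]] := @critical_length R kap n n0.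
have [n1 Nn [z [pi [g [zr [pi0 pi1] rev Qg gH]]]]] := hit n s n0 ne s0 s1 sE.
have ch : process_from k g0 g1 n (x n) (P n) (X n) by near: n.
have Bn : openball n%:R^-1 r `<=` B n by near: n.
have [_ _ _ [[i0 xi0] _] _] := ch.
pose gz i := g i - g z; pose H := C / s ^+ kap.+1.
have QB i : ~ B n (@state R g0 g1 n i) -> mx_act (generator k g0 g1 n) gz i <= - 1.
  move=> nB; have iz : i != z.
    by apply/eqP => e1; apply: nB; rewrite e1; apply: Bn.
  have -> : mx_act (generator k g0 g1 n) gz i
     = mx_act (generator k g0 g1 n) (fun j => 1 * g j + (- g z) * 1) i.
    by apply: eq_mx_act => j; rewrite /gz mul1r mulr1.
  rewrite mx_actZD Qg (negbTE iz) mul0r sub0r mul1r /mx_act.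
  by under eq_bigr do rewrite mulr1; rewrite generator_sum // mulr0 addr0.
have [h h0 lyap] := trans_act_lyapunov (generator_offdiag k_gt0 gamma n1 Nn)
  (generator_sum k n1 Nn) (generator_rate_ge1 n1)
  (generator_diag k_gt0 gamma n1 Nn) gH.
have gz0 i : 0 <= gz i by case/andP: (gH i).
apply: le_trans (mean_T_enter_le ch h0 gz0 (B := B n) _ xi0) _.
  by move=> i nB; apply: lyap; exact: QB.
rewrite lee_fin -mulrA ler_wpM2l // -sa.
by case/andP: (gH i0).
Unshelve. all: by end_near. Qed.

Lemma critical_t_mix : extTheta (t_mix k g0 g1) (npow a).
Proof.
have [e [C [e0 C0 hit]]] := critical_hitting k_gt0 gamma crit.
have [e' [c [e'0 c0 esc]]] := critical_escape k_gt0 gamma kap_le1 crit.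
split.
  have [K K0 KE] : exists2 K : R, 0 <= K & K = 4000%:R.
    by exists 4000%:R => [|//]; exact: ler0n.
  apply: (@extO_le_npow _ _ (K * (C + 1)) a); near=> n.
  have [n0 ne] : (0 < n)%N /\ n%:R^-1 <= e by near: n; exact: near_inv_le.
  have [s [s0 s1 sE sa]] := @critical_length R kap n n0.
  have [n1 Nn [z [pi [g [zr [pi0 pi1] rev Qg gH]]]]] := hit n s n0 ne s0 s1 sE.
  have sk : 0 < s ^+ kap.+1 by exact: exprn_gt0.
  have si : 1 <= (s ^+ kap.+1)^-1 by rewrite invf_ge1 // exprn_ile1 // ltW.
  pose H := (C + 1) * (s ^+ kap.+1)^-1.
  have H1 : 1 <= H.
    rewrite -[leLHS]mulr1; apply: ler_pM => //; by rewrite lerDr ltW.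
  have gH' i : 0 <= g i - g z <= H.
    have /andP[-> b] := gH i; apply: (le_trans b).
    by rewrite ler_wpM2r ?invr_ge0 ?(ltW sk) // lerDl.
  have CK : 0 <= K * (C + 1) by rewrite mulr_ge0 // addr_ge0 // ltW.
  apply: ereal_inf_lbound; exists (K * (C + 1) * n%:R `^ a) => [|//]; split.
    by rewrite mulr_ge0 ?powR_ge0.
  have tvH := tv_dist_hitting (generator_offdiag k_gt0 gamma n1 Nn)
    (generator_sum k n1 Nn) (generator_rate_ge1 n1)
    (generator_diag k_gt0 gamma n1 Nn) pi0 pi1 rev H1 Qg gH'.
  by apply: tvH; rewrite -KE -sa /H mulrA.
apply: (extO_ge_npow c0); near=> n.
have [n0 ne] : (0 < n)%N /\ n%:R^-1 <= e' by near: n; exact: near_inv_le.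
have [s [s0 s1 sE sa]] := @critical_length R kap n n0.
apply: le_ereal_inf_tmp => _ [t [t0 tv] <-].
by rewrite lee_fin -sa; exact: esc n0 ne s0 s1 sE t0 tv.
Unshelve. all: by end_near. Qed.

End CriticalBehaviour.

Theorem theorem7 (R : realType) (k : nat) (g0 g1 : R)
    (hk : (1 <= k)%N) (hcrit : Gamma_crit k g0 g1) :
  (g0 != g1 ->
     (forall r : R, root_in_S k g0 g1 r 1 ->
        exists2 delta0 : R, 0 < delta0 & forall delta : R, 0 < delta < delta0 ->
          mean_T_enter_bigO k g0 g1 (fun=> openball delta r) (1 / 3)) /\
     extTheta (t_mix k g0 g1) (npow (1 / 3))) /\
  (g0 = g1 ->
     (forall r : R, in_S g0 g1 r -> root (Delta k g0 g1) r ->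
        mean_T_enter_bigO k g0 g1 (fun n => openball (1 / n%:R) r) (1 / 2)) /\
     extTheta (t_mix k g0 g1) (npow (1 / 2))).
Proof.
have [gamma _] := hcrit.
have [neq eq] := Gamma_crit_cases hk hcrit.
split=> [/neq|/eq] [r [r2 [p [crit uniq]]]].
  split; last exact: critical_t_mix crit.
  (* the witness is arbitrary: for large [n] every ball around [r] contains the
     ball of radius [1 / n] *)
  move=> r' /uniq ->; exists 1 => // delta /andP[d0 _].
  apply: (critical_mean_T_enter hk gamma crit); near=> n.
  have [_ nd] : (0 < n)%N /\ n%:R^-1 <= delta by near: n; exact: near_inv_le.
  by move=> x /= /andP[? ?]; apply/andP; split; lra.
(* the exponent [(m - 1) / (m + 1)] for [m = 3] *)
have half : (1 / 2 : R) = 2%:R / 4%:R by field.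
rewrite half; split; last exact: critical_t_mix crit.
move=> r' rS rD; rewrite (uniq r' rS rD).
apply: (critical_mean_T_enter hk gamma crit).
by apply: nearW => n; rewrite div1r.
Unshelve. all: by end_near. Qed.
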